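(* Let $S_j$ be local potentials satisfying (A)–(E), let $\omega\in\mathbb{Q}^d$ and let $(p_1,q_1),\dots,(p_d,q_d)$ be principal periods for $\omega$. Then there exists a sequence of families of local potentials $S_j^n$, $n\in\mathbb{N}$, such that: (1) each family $S_j^n$ satisfies (A)–(E); (2) the interaction ranges of the $S_j^n$ are bounded uniformly in $n$; (3) for every $n$ the periodic action $W^n_{p,q}=\sum_{j\in B_p}S_j^n$ is a Morse function on $\mathbb{X}_{p,q}$; (4) $\lim_{n\to\infty}\|\nabla S_0^n-\nabla S_0\|_{C^1(\mathbb{R}^{\mathbb{Z}^d})}=0$; (5) $S_j^n\to S_j$ uniformly on $\mathcal{B}\cap\mathbb{X}_{p,q}$.
   Context: Notation: $\|i\|=\sum_{k=1}^d|i_k|$, $B_j^r=\{k:\|k-j\|\le r\}$, $(\tau_{k,l}x)_i=x_{i+k}+l$. Local potentials $S_j:\mathbb{R}^{\mathbb{Z}^d}\to\mathbb{R}$, $j\in\mathbb{Z}^d$, satisfy: (A) there is $r\in(0,\infty)$ (the interaction range) and $C^2$ functions $s_j:\mathbb{R}^{B_j^r}\to\mathbb{R}$ with $S_j(x)=s_j(x|_{B_j^r})$; (B) $S_j(\tau_{k,l}x)=S_{j+k}(x)$; (C) each $S_j$ is bounded below and $S_j(x)\to\infty$ as $|x_k-x_j|\to\infty$ whenever $\|k-j\|=1$; (D) $\partial_{i,k}S_j\le0$ for $i\ne k$, and $\partial_{i,k}S_i<0$ when $\|i-k\|=1$; (E) $|\partial_{i,k}S_j|\le C$ uniformly. $(p_1,q_1),\dots,(p_d,q_d)$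 are principal periods for $\omega$ if they form a $\mathbb{Z}$-basis of $I_\omega=\{(k,l)\in\mathbb{Z}^d\times\mathbb{Z}:\langle k,\omega\rangle+l=0\}$. With $p$ the matrix with columns $p_j$: $B_p=p([0,1)^d)\cap\mathbb{Z}^d$, $\mathbb{X}_{p,q}=\{x:\tau_{p_j,q_j}x=x\ \forall j\}$ (a finite-dimensional space identified with $\mathbb{R}^{B_p}$ by restriction). A $C^2$ function on $\mathbb{X}_{p,q}$ is Morse if its Hessian is nondegenerate at each critical point. $\mathcal{B}$ is the set of Birkhoff configurations ($\tau_{k,l}x\ge x$ or $\tau_{k,l}x\le x$ pointwise for every $(k,l)$). For $S(x)=s(x|_B)$ with $B$ finite and $s\in C^{m+1}$, $\|\nabla S\|_{C^m(\mathbb{R}^{\mathbb{Z}^d})}=\sum_{1\le k\le m+1}\sum_{j_1,\dots,j_k\in\mathbb{Z}^d}\sup_x|\partial_{j_1\dots j_k}S(x)|$. *)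

(* Defs.v *)
From Stdlib Require Import Reals Lra ZArith QArith Qreals List ClassicalEpsilon.
From Stdlib Require Vectors.Fin.
Open Scope R_scope.

Definition site (d : nat) := Fin.t d -> Z.

Definition sadd {d} (i k : site d) : site d := fun m => (i m + k m)%Z.
Definition ssub {d} (i k : site d) : site d := fun m => (i m - k m)%Z.
Definition szero {d} : site d := fun _ => 0%Z.

Fixpoint fsumZ (d : nat) : (Fin.t d -> Z) -> Z :=
  match d with
  | O => fun _ => 0%Z
  | Datatypes.S d' => fun f => (f Fin.F1 + fsumZ d' (fun m => f (Fin.FS m)))%Z
  end.
Fixpoint fsumR (d : nat) : (Fin.t d -> R) -> R :=
  match d with
  | O => fun _ => 0
  | Datatypes.S d' => fun f => f Fin.F1 + fsumR d' (fun m => f (Fin.FS m))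
  end.

Definition snorm {d} (i : site d) : Z := fsumZ d (fun m => Z.abs (i m)).

Definition config (d : nat) := site d -> R.
Definition Pot (d : nat) := site d -> config d -> R.

Definition tau {d} (k : site d) (l : Z) (x : config d) : config d :=
  fun i => x (sadd i k) + IZR l.

Definition upd {I : Type} (x : I -> R) (i : I) (t : R) : I -> R :=
  fun k => if excluded_middle_informative (k = i) then x k + t else x k.

Definition Partial {I : Type} (F : (I -> R) -> R) (x : I -> R) (i : I) (l : R) : Prop :=
  derivable_pt_lim (fun t => F (upd x i t)) 0 l.

Definition Partial2 {I : Type} (F : (I -> R) -> R) (x : I -> R) (i k : I) (l : R) : Prop :=
  exists g : (I -> R) -> R, (forall y, Partial F y k (g y)) /\ Partial g x i l.

(** continuity for the product topology on I -> R *)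
Definition ContP {I : Type} (g : (I -> R) -> R) : Prop :=
  forall x eps, 0 < eps -> exists delta, 0 < delta /\ exists L : list I,
    forall y, (forall k, In k L -> Rabs (y k - x k) < delta) -> Rabs (g y - g x) < eps.

Definition C2 {I : Type} (F : (I -> R) -> R) : Prop :=
  (forall x i, exists l, Partial F x i l) /\
  (forall i k, exists g : (I -> R) -> R, (forall x, Partial2 F x i k (g x)) /\ ContP g).

Definition ball {d} (j : site d) (r : R) := { k : site d | IZR (snorm (ssub k j)) <= r }.

Definition condA {d} (S : Pot d) (r : R) : Prop :=
  0 < r /\
  forall j : site d, exists s : (ball j r -> R) -> R,
    C2 s /\ forall x : config d, S j x = s (fun k => x (proj1_sig k)).

Definition condB {d} (S : Pot d) : Prop :=
  forall (j k : site d) (l : Z) (x : config d), S j (tau k l x) = S (sadd j k) x.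

Definition condC {d} (S : Pot d) : Prop :=
  forall j : site d,
    (exists m, forall x, m <= S j x) /\
    (forall k, snorm (ssub k j) = 1%Z ->
       forall M, exists Rr, forall x, Rr < Rabs (x k - x j) -> M < S j x).

Definition condD {d} (S : Pot d) : Prop :=
  (forall j i k x l, i <> k -> Partial2 (S j) x i k l -> l <= 0) /\
  (forall i k x l, snorm (ssub i k) = 1%Z -> Partial2 (S i) x i k l -> l < 0).

Definition condE {d} (S : Pot d) : Prop :=
  exists C, forall j i k x l, Partial2 (S j) x i k l -> Rabs l <= C.

Definition LocalPot_r {d} (S : Pot d) (r : R) : Prop :=
  condA S r /\ condB S /\ condC S /\ condD S /\ condE S.

Definition LocalPot {d} (S : Pot d) : Prop := exists r, LocalPot_r S r.

Definition inner {d} (k : site d) (omega : Fin.t d -> Q) : R :=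
  fsumR d (fun m => IZR (k m) * Q2R (omega m)).

Definition InIomega {d} (omega : Fin.t d -> Q) (k : site d) (l : Z) : Prop :=
  inner k omega + IZR l = 0.

Definition PrincipalPeriods {d} (omega : Fin.t d -> Q)
    (p : Fin.t d -> site d) (q : Fin.t d -> Z) : Prop :=
  (forall j, InIomega omega (p j) (q j)) /\
  (forall k l, InIomega omega k l ->
     exists c : Fin.t d -> Z,
       (forall m, k m = fsumZ d (fun j => c j * p j m)%Z) /\
       l = fsumZ d (fun j => c j * q j)%Z) /\
  (forall c : Fin.t d -> Z,
     (forall m, fsumZ d (fun j => c j * p j m)%Z = 0%Z) ->
     fsumZ d (fun j => c j * q j)%Z = 0%Z ->
     forall j, c j = 0%Z).

Definition InBp {d} (p : Fin.t d -> site d) (k : site d) : Prop :=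
  exists t : Fin.t d -> R, (forall j, 0 <= t j < 1) /\
    forall m, IZR (k m) = fsumR d (fun j => t j * IZR (p j m)).

Definition InX {d} (p : Fin.t d -> site d) (q : Fin.t d -> Z) (x : config d) : Prop :=
  forall j, tau (p j) (q j) x = x.

(** tangent space of X_{p,q}: p-periodic variations *)
Definition InV {d} (p : Fin.t d -> site d) (v : config d) : Prop :=
  forall j, tau (p j) 0 v = v.

Definition Birkhoff {d} (x : config d) : Prop :=
  forall (k : site d) (l : Z),
    (forall i, x i <= tau k l x i) \/ (forall i, tau k l x i <= x i).

Definition EnumBp {d} (p : Fin.t d -> site d) (l : list (site d)) : Prop :=
  NoDup l /\ forall k, In k l <-> InBp p k.

Definition Wsum {d} (S : Pot d) (l : list (site d)) (x : config d) : R :=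
  fold_right (fun j acc => S j x + acc) 0 l.

Definition DirD {d} (F : config d -> R) (x v : config d) (l : R) : Prop :=
  derivable_pt_lim (fun t => F (fun i => x i + t * v i)) 0 l.

Definition Hess {d} (F : config d -> R) (x v w : config d) (h : R) : Prop :=
  exists g : R -> R,
    (forall t, DirD F (fun i => x i + t * w i) v (g t)) /\ derivable_pt_lim g 0 h.

Definition MorseOnX {d} (p : Fin.t d -> site d) (q : Fin.t d -> Z)
    (F : config d -> R) : Prop :=
  forall x, InX p q x ->
    (forall v, InV p v -> DirD F x v 0) ->
    forall v, InV p v -> v <> (fun _ => 0) ->
      exists w h, InV p w /\ Hess F x v w h /\ h <> 0.

Fixpoint sumL {A} (f : A -> R) (L : list A) : R :=
  match L with nil => 0 | a :: L' => f a + sumL f L' end.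

Definition C1normLe {d} (D : config d -> R) (eps : R) : Prop :=
  exists (L : list (site d)) (M1 : site d -> R) (M2 : site d -> site d -> R),
    NoDup L /\
    (forall i, ~ In i L -> M1 i = 0) /\
    (forall i k, ~ In i L \/ ~ In k L -> M2 i k = 0) /\
    (forall x i l, Partial D x i l -> Rabs l <= M1 i) /\
    (forall x i k l, Partial2 D x i k l -> Rabs l <= M2 i k) /\
    sumL M1 L + sumL (fun i => sumL (M2 i) L) L <= eps.

(* Main.v *)
Require Import Defs.
From Stdlib Require Import Reals ZArith QArith Qreals List.
From Stdlib Require Vectors.Fin.
From Stdlib Require Import Lra Lia ClassicalEpsilon FunctionalExtensionality.
From Stdlib Require Permutation.
From Coquelicot Require Compactness Rcomplements Derive.
From HB Require Import structures.
From mathcomp Require ssreflect ssrfun ssrbool eqtype ssrnat seq choice fintype finfun bigop.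
Open Scope R_scope.

(** Add to [S_j] the potential [eps * (b + P)] translated to [j].  Here [b] is a sum of the
    convex interactions [sqrt (1 + (x_u - x_w)^2)], whose mixed derivatives are negative
    everywhere, while [P] is a Gaussian in the differences [x_k - x_0] times a polynomial in
    them and in [cos (2 pi x_0)], [sin (2 pi x_0)].  As the Gaussian decays faster than the second
    derivatives of [b], small coefficients of [P] keep the monotonicity condition (D).

    The group of translations modulo [I_omega] acts freely on [X_{p,q}].  A product of squared
    distances therefore vanishes to second order at all points but one of the orbit of [x]
    modulo integers, and the differentials at [x] of the periodic sums of the admissible [P] span
    the cotangent space.  By a parametric form of Sard's theorem for C^1 maps between spaces of
    equal dimension, arbitrarily small coefficients make the periodic action Morse.

    Sard's theorem is proved by counting grid points: the parameters whose degenerate critical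
    point lies in a given cube of side [eta] lie in a slab of width [o(eta)], so the degenerate
    parameters miss a point of every fine enough grid, and a neighbourhood of it.  Baire's
    theorem then handles the whole noncompact space. *)

(** Condition (D) is the obstacle. Away from nearest neighbours the mixed derivatives of [S j] may
    vanish, so a perturbation of indefinite sign is inadmissible by itself, however small; [b] is
    there to absorb the sign of [P], and the bound on the coefficients of [P] relative to [b] does
    not depend on [eps]. Since [b] may be unbounded, only its derivatives are controlled uniformly;
    convergence of the values rests on the bound that the Birkhoff property imposes on differences
    of a periodic configuration. The sites involved are those of [B_p], up to translation, which
    fixes the range.

    The action is only C^2 and its gradient only C^1, so Sard's theorem is used in equal dimensions:
    parameters are restricted to an affine slice with the dimension of [X_{p,q}], along which the
    gradient moves almost as the identity. The parameter family has to be finite and the same at all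
    points; it consists of all products of a fixed number of fixed generators, whose expansions
    contain the point-dependent functions needed at each configuration. *)

Module MorseApproximation.

(* Imported inside the module so that [<=] on [nat] keeps its standard meaning in the theorem. *)
Import ssreflect ssrfun ssrbool eqtype ssrnat seq choice fintype finfun bigop.
Set Implicit Arguments. Unset Strict Implicit. Unset Printing Implicit Defensive.
Open Scope R_scope.

(** * Finite sums of real numbers *)

HB.instance Definition _ := Monoid.isComLaw.Build R 0 Rplus
  (fun a b c => esym (Rplus_assoc a b c)) Rplus_comm Rplus_0_l.
HB.instance Definition _ := Monoid.isComLaw.Build R 1 Rmult
  (fun a b c => esym (Rmult_assoc a b c)) Rmult_comm Rmult_1_l.
HB.instance Definition _ := Monoid.isMulLaw.Build R 0 Rmult Rmult_0_l Rmult_0_r.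
HB.instance Definition _ := Monoid.isAddLaw.Build R Rmult Rplus
  Rmult_plus_distr_r Rmult_plus_distr_l.

Notation "\sum_ i F" := (\big[Rplus/0]_i F) : R_scope.
Notation "\sum_ ( i : T ) F" := (\big[Rplus/0]_(i : T) F) : R_scope.
Notation "\prod_ i F" := (\big[Rmult/1]_i F) : R_scope.

Lemma Rabs_le_elim a b : Rabs a <= b -> - b <= a <= b.
Proof. by move=> h; have := Rle_abs a; have := Rle_abs (- a); rewrite Rabs_Ropp; lra. Qed.

Section Sums.
Variable T : finType.
Implicit Types f g : T -> R.

Lemma rsumD f g : \sum_i (f i + g i) = \sum_i f i + \sum_i g i.
Proof. exact: big_split. Qed.

Lemma rsumZ a f : \sum_i (a * f i) = a * \sum_i f i.
Proof. by rewrite big_distrr. Qed.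

Lemma rsumZr a f : \sum_i (f i * a) = (\sum_i f i) * a.
Proof. by rewrite big_distrl. Qed.

Lemma rsumN f : \sum_i (- f i) = - \sum_i f i.
Proof.
have -> : - \sum_i f i = -1 * \sum_i f i by lra.
by rewrite -rsumZ; apply: eq_bigr => i _; lra.
Qed.

Lemma rsumB f g : \sum_i (f i - g i) = \sum_i f i - \sum_i g i.
Proof. by rewrite /Rminus -rsumN -rsumD. Qed.

Lemma rsum0 : \sum_(i : T) 0 = 0.
Proof. by rewrite big1. Qed.

Lemma ler_rsum f g : (forall i, f i <= g i) -> \sum_i f i <= \sum_i g i.
Proof. by move=> H; elim/big_ind2: _ => [|*|i _]; [lra|lra|exact: H]. Qed.

Lemma rsum_const a : \sum_(i : T) a = INR #|T| * a.
Proof.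
rewrite big_const; elim: #|T| => [|n IH]; first by rewrite /=; lra.
by rewrite iterS IH S_INR; lra.
Qed.

Lemma Rabs_rsum f : Rabs (\sum_i f i) <= \sum_i Rabs (f i).
Proof.
elim/big_ind2: _ => [|x1 x2 y1 y2 ? ?|i _]; [by rewrite Rabs_R0; lra| |lra].
by apply: Rle_trans (Rabs_triang _ _) _; lra.
Qed.

Lemma Rabs_rsum_le f B : (forall i, Rabs (f i) <= B) ->
  Rabs (\sum_i f i) <= INR #|T| * B.
Proof.
move=> H; apply: Rle_trans (Rabs_rsum f) _.
by rewrite -rsum_const; apply: ler_rsum.
Qed.

Lemma rsum_pick f i : (forall j, j != i -> f j = 0) -> \sum_j f j = f i.
Proof. by move=> H; rewrite (bigD1 i) //= big1 //; lra. Qed.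

Lemma exists_argmax f : T -> exists i, forall j, f j <= f i.
Proof.
move=> x0.
suff H : forall s : seq T, exists i, forall j, j \in s -> f j <= f i.
  by have [i Hi] := H (enum T); exists i => j; apply: Hi; rewrite mem_enum.
elim=> [|a s [i IH]]; first by exists x0.
have [le|lt] := Rle_dec (f i) (f a).
  by exists a => j; rewrite inE => /orP[/eqP->|/IH]; lra.
by exists i => j; rewrite inE => /orP[/eqP->|/IH]; lra.
Qed.

Lemma finite_bound f : exists B, 0 < B /\ forall i, Rabs (f i) <= B.
Proof.
exists (1 + \sum_i Rabs (f i)).
have h i : Rabs (f i) <= \sum_i Rabs (f i).
  rewrite (bigD1 i) //=; suff: 0 <= \big[Rplus/0]_(j | j != i) Rabs (f j) by lra.
  by elim/big_ind: _ => [|*|j _]; [lra|lra|apply: Rabs_pos].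
split; last by move=> i; have := h i; lra.
suff: 0 <= \sum_i Rabs (f i) by lra.
by elim/big_ind: _ => [|*|j _]; [lra|lra|apply: Rabs_pos].
Qed.

Lemma finite_radius (P : T -> R -> Prop) :
  (forall i, exists d, 0 < d /\ P i d) ->
  (forall i d d', P i d -> 0 < d' -> d' <= d -> P i d') ->
  exists d, 0 < d /\ forall i, P i d.
Proof.
move=> ex mon.
suff H : forall s : seq T, exists d, 0 < d /\ forall i, i \in s -> P i d.
  have [d [d0 Hd]] := H (enum T); exists d; split => // i.
  by apply: Hd; rewrite mem_enum.
elim=> [|a s [d [d0 IH]]]; first by exists 1; split => //; lra.
have [e [e0 He]] := ex a.
have m0 : 0 < Rmin d e by apply: Rmin_glb_lt.
exists (Rmin d e); split => // i; rewrite inE => /orP[/eqP->|/IH Hi].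
  by apply: mon He m0 (Rmin_r _ _).
by apply: mon Hi m0 (Rmin_l _ _).
Qed.

End Sums.

Lemma rsum_exch (T T' : finType) (f : T -> T' -> R) :
  \sum_i \sum_j f i j = \sum_j \sum_i f i j.
Proof. exact: exchange_big. Qed.

(** * Nowhere density in finite-dimensional spaces *)

Section Cubes.
Variable N : nat.
Implicit Types y z : 'I_N -> R.

Definition Close y z (h : R) := forall c, Rabs (z c - y c) <= h.

Lemma Close_refl y h : 0 <= h -> Close y y h.
Proof. by move=> h0 c; rewrite Rminus_diag Rabs_R0. Qed.

Lemma Close_trans y z w h k : Close y z h -> Close z w k -> Close y w (h + k).
Proof.
move=> H1 H2 c; have -> : w c - y c = (z c - y c) + (w c - z c) by lra.
have := Rabs_triang (z c - y c) (w c - z c); have := H1 c; have := H2 c; lra.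
Qed.

Lemma Close_le y z h k : Close y z h -> h <= k -> Close y z k.
Proof. by move=> H hk c; have := H c; lra. Qed.

End Cubes.

(** * Compactness of cubes in ['I_N -> R] *)

Fixpoint tuple_of_fun n (f : nat -> R) : Compactness.Tn n R :=
  match n with O => tt | S n => (f 0%N, tuple_of_fun n (fun i => f i.+1)) end.

Fixpoint fun_of_tuple n : Compactness.Tn n R -> nat -> R :=
  match n with
  | O => fun _ _ => 0
  | S n => fun x i => match i with O => x.1 | S i => @fun_of_tuple n x.2 i end
  end.

Lemma bounded_n_tuple n (a b f : nat -> R) :
  Compactness.bounded_n n (tuple_of_fun n a) (tuple_of_fun n b) (tuple_of_fun n f)
  <-> forall i, (i < n)%N -> a i <= f i <= b i.
Proof.
elim: n a b f => [|n IH] a b f /=; first by split.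
rewrite IH; split => [[h0 h] [|i] //|h]; first exact: h.
by split; [exact: (h 0%N)|move=> i; apply: (h i.+1)].
Qed.

Lemma bounded_n_fun n (a b : nat -> R) x :
  Compactness.bounded_n n (tuple_of_fun n a) (tuple_of_fun n b) x ->
  forall i, (i < n)%N -> a i <= fun_of_tuple x i <= b i.
Proof.
elim: n a b x => [|n IH] a b x //= ; case: x => x0 x [h0 h] [|i] //=.
by move=> lt; apply: (IH (fun i => a i.+1) (fun i => b i.+1)).
Qed.

Lemma close_n_fun n d (f : nat -> R) x :
  Compactness.close_n n d (tuple_of_fun n f) x ->
  forall i, (i < n)%N -> Rabs (f i - fun_of_tuple x i) < d.
Proof.
elim: n f x => [|n IH] f x //=; case: x => x0 x [h0 h] [|i] //=.
by move=> lt; apply: (IH (fun i => f i.+1)).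
Qed.

Definition extend N (y : 'I_N -> R) (i : nat) : R := oapp y 0 (insub i).

Lemma extendE N (y : 'I_N -> R) (i : 'I_N) : extend y i = y i.
Proof. by rewrite /extend valK. Qed.

(** Cousin's form of compactness: the radius may vary with the tag [t], and the tags lie in the
    cube. The tagged covering of boxes of nested pairs is transported along [fun_of_tuple]. *)
Lemma cube_compact N (y0 : 'I_N -> R) r (delta : ('I_N -> R) -> R) :
  (forall y, 0 < delta y) ->
  exists l : list ('I_N -> R), forall z, Close y0 z r ->
    exists t, In t l /\ Close y0 t r /\ Close t z (delta t).
Proof.
move=> delta0.
pose v (x : Compactness.Tn N R) (i : 'I_N) := fun_of_tuple x i.
pose a i := extend y0 i - r; pose b i := extend y0 i + r.
(* The covering is supplied only under a double negation, hence the argument by contradiction. *)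
apply: NNPP => H.
apply: (Compactness.compactness_list N (tuple_of_fun N a) (tuple_of_fun N b)
          (fun x => mkposreal _ (delta0 (v x)))) => -[l Hl].
apply: H; exists (List.map v l) => z Hz.
have [|t [tl [tb tc]]] := Hl (tuple_of_fun N (extend z)).
  apply/bounded_n_tuple => i lt; have := Hz (Ordinal lt).
  rewrite /a /b -(extendE z) -(extendE y0) /=.
  by move/Rabs_le_elim; lra.
exists (v t); split; first exact: in_map.
split=> c.
  have := bounded_n_fun tb (ltn_ord c); rewrite /a /b extendE /v => h.
  by apply: Rabs_le; lra.
by have := close_n_fun tc (ltn_ord c); rewrite extendE /v /=; lra.
Qed.

Lemma list_min_pos (A : Type) (d : A -> R) (l : list A) :
  (forall t, 0 < d t) -> exists e, 0 < e /\ forall t, In t l -> e <= d t.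
Proof.
move=> d0; elim: l => [|a l [e [e0 IH]]]; first by exists 1; split => //; lra.
exists (Rmin e (d a)); split; first by apply: Rmin_glb_lt.
move=> t /= [<-|/IH h]; first exact: Rmin_r.
exact: Rle_trans (Rmin_l _ _) h.
Qed.

(** * Baire's theorem in a finite-dimensional parameter space *)

Section Baire.
Variable T : finType.
Implicit Types (A B : (T -> R) -> Prop) (a : T -> R).

Definition near_param a a' rho := forall t, Rabs (a' t - a t) <= rho.

(** Both balls are closed, so that the limit of a nested sequence of such balls stays in each of
    them. *)
Definition nowhere_dense A := forall a0 rho, 0 < rho ->
  exists a1 rho1, 0 < rho1 /\ forall a, near_param a1 a rho1 -> near_param a0 a rho /\ ~ A a.

Lemma nowhere_dense_sub A B : (forall a, A a -> B a) -> nowhere_dense B -> nowhere_dense A.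
Proof.
move=> sub ndB a0 rho r0; have [a1 [r1 [r10 H]]] := ndB a0 rho r0.
by exists a1, r1; split=> // a /H[? nB]; split=> // /sub.
Qed.

Lemma nowhere_dense_list (I : Type) (A : I -> (T -> R) -> Prop) (l : list I) :
  (forall i, nowhere_dense (A i)) -> nowhere_dense (fun a => exists i, In i l /\ A i a).
Proof.
move=> nd; elim: l => [|i l IH] a0 rho r0.
  by exists a0, rho; split=> // a h; split=> // -[i [[] _]].
have [a1 [r1 [r10 H1]]] := IH a0 rho r0.
have [a2 [r2 [r20 H2]]] := nd i a1 r1 r10.
exists a2, r2; split=> // a /H2[/H1[h1 h2] h3]; split=> // -[j [/= [<-|jl] Aj]] //.
by apply: h2; exists j.
Qed.

(** Nested closed balls, each avoiding one more set; radii at most [(/2)^n] make the centres Cauchy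
    in every coordinate. *)
Lemma baire (A : nat -> (T -> R) -> Prop) : (forall n, nowhere_dense (A n)) ->
  forall a0 rho, 0 < rho -> exists a, near_param a0 a rho /\ forall n, ~ A n a.
Proof.
move=> nd a0 rho rho0.
pose good n (s s' : (T -> R) * R) := 0 < s'.2 /\ s'.2 <= (/2) ^ n /\
  forall a, near_param s'.1 a s'.2 -> near_param s.1 a s.2 /\ ~ A n a.
have step n s : 0 < s.2 -> exists s', good n s s'.
  move=> s0; have [a1 [r1 [r10 H]]] := nd n s.1 s.2 s0.
  have p0 : 0 < (/2)^n by apply: pow_lt; lra.
  exists (a1, Rmin r1 ((/2)^n)); split; first by apply: Rmin_glb_lt.
  split; first exact: Rmin_r.
  move=> a h; apply: H => t; apply: Rle_trans (h t) (Rmin_l _ _).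
(* Choice needs a total relation, so a successor is demanded only when the radius is positive; the
   other branch returns the state unchanged. *)
have [f Hf] : exists f : nat -> (T -> R) * R -> (T -> R) * R,
    forall n s, 0 < s.2 -> good n s (f n s).
  have [f Hf] := ClassicalEpsilon.choice (fun p s' => 0 < p.2.2 -> good p.1 p.2 s')
    (fun p => match excluded_middle_informative (0 < p.2.2) with
      | left h => let: ex_intro s' hs := step p.1 p.2 h in ex_intro _ s' (fun _ => hs)
      | right h => ex_intro _ p.2 (fun h' => False_ind _ (h h')) end).
  by exists (fun n s => f (n, s)) => n s; apply: (Hf (n, s)).
pose fix seq n := match n with O => (a0, rho) | S n => f n (seq n) end.
have pos n : 0 < (seq n).2.
  by elim: n => [|n IH] //=; case: (Hf n _ IH).
have G n : good n (seq n) (seq n.+1) by apply: Hf.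
have nest n m : (n <= m)%N -> forall a,
    near_param (seq m).1 a (seq m).2 -> near_param (seq n).1 a (seq n).2.
  move=> /subnK <-; elim: (m - n)%N => [|k IH] a //.
  by rewrite addSn => h; apply: IH; case: (G (k + n)%N) => _ [_ /(_ a h)[]].
have self n : near_param (seq n).1 (seq n).1 (seq n).2.
  by move=> t; rewrite Rminus_diag Rabs_R0; have := pos n; lra.
have bnd n m t : (n <= m)%N -> Rabs ((seq m).1 t - (seq n).1 t) <= (seq n).2.
  by move=> le; have := nest n m le _ (self m); apply.
have cau t : Cauchy_crit (fun n => (seq n).1 t).
  move=> eps eps0.
  have [n0 Hn0] := pow_lt_1_zero (/2) (ltac:(rewrite Rabs_right; lra)) (eps/2) (ltac:(lra)).
  have hr : (seq n0.+1).2 < eps / 2.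
    have [_ [h _]] := G n0; have := Hn0 n0 (le_n _).
    rewrite Rabs_right; first lra.
    by apply: Rle_ge; apply: pow_le; lra.
  exists n0.+1 => n m /leP hn /leP hm; rewrite /R_dist.
  have h1 := bnd _ _ t hn; have h2 := bnd _ _ t hm.
  have -> : (seq n).1 t - (seq m).1 t =
    ((seq n).1 t - (seq n0.+1).1 t) - ((seq m).1 t - (seq n0.+1).1 t) by lra.
  by apply: Rle_lt_trans (Rabs_triang _ _) _; rewrite Rabs_Ropp; lra.
have [a Ha] : exists a : T -> R, forall t, Un_cv (fun n => (seq n).1 t) (a t).
  apply: (ClassicalEpsilon.choice (fun t l => Un_cv (fun n => (seq n).1 t) l)) => t.
  by have [l Hl] := R_complete _ (cau t); exists l.
have lim n : near_param (seq n).1 a (seq n).2.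
  move=> t; apply: Rnot_lt_le => lt.
  have [n0 Hn0] := Ha t (Rabs (a t - (seq n).1 t) - (seq n).2) (ltac:(lra)).
  have le : (n <= maxn n n0)%N by apply: leq_maxl.
  have := bnd _ _ t le; have := Hn0 (maxn n n0) (ltac:(apply/leP; exact: leq_maxr)).
  rewrite /R_dist; set b := (seq (maxn n n0)).1 t => h1 h2.
  have := Rabs_triang (a t - b) (b - (seq n).1 t); rewrite (Rabs_minus_sym (a t)).
  have -> : a t - b + (b - (seq n).1 t) = a t - (seq n).1 t by lra.
  lra.
exists a; split; first exact: (lim 0%N).
by move=> n; case: (G n) => _ [_ /(_ a (lim n.+1))[]].
Qed.

End Baire.

(** * A quantitative Sard argument *)

(* All the grid points [s] sharing a cell lie within [D] of each other and are determined by
   their coordinates other than [i], which is what saves one dimension in the count. *)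
Lemma grid_pigeonhole N k m D (cell : {ffun 'I_N.+1 -> 'I_m} -> {ffun 'I_N.+1 -> 'I_k}) :
  (forall s0, exists i, 
     (forall s j, cell s = cell s0 -> (s j <= s0 j + D)%N /\ (s0 j <= s j + D)%N) /\
     (forall s1 s2, cell s1 = cell s0 -> cell s2 = cell s0 ->
        (forall j, j != i -> s1 j = s2 j) -> s1 = s2)) ->
  (m ^ N.+1 <= k ^ N.+1 * (2 * D).+1 ^ N)%N.
Proof.
move=> H.
have [i Hi] := ClassicalEpsilon.choice _ H.
(* A representative that depends only on the cell, so that the distinguished coordinate [i (base s)]
   is shared by all points of a cell. *)
pose base s := odflt s [pick s' | cell s' == cell s].
have baseP s : cell (base s) = cell s.
  by rewrite /base; case: pickP => [s' /eqP|] //.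
have baseE s1 s2 : cell s1 = cell s2 -> base s1 = base s2.
  rewrite /base => ->; case: pickP => //= /(_ s2); by rewrite eqxx.
(* A point is coded by its cell and by the offsets of its other coordinates from the representative,
   shifted by [D] to become natural numbers at most [2 * D]. *)
pose code s : {ffun 'I_N.+1 -> 'I_k} * {ffun 'I_N -> 'I_(2 * D).+1} :=
  (cell s, [ffun j => inord (s (lift (i (base s)) j) + D - base s (lift (i (base s)) j))]).
have inj : injective code.
  move=> s1 s2 [ec /ffunP ed].
  have eb := baseE _ _ ec.
  have [Hd Hu] := Hi (base s1).
  apply: Hu; rewrite ?baseP //= => j ne.
  rewrite eq_sym in ne; have [j' ej _] := unlift_some ne.
  have := ed j'; rewrite !ffunE -eb -ej => /(congr1 val) /=.
  have [d1 d1'] := Hd s1 j (esym (baseP s1)).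
  have [d2 d2'] := Hd s2 j (etrans (esym ec) (esym (baseP s1))).
  rewrite !inordK ?ltnS ?leq_subLR ?mul2n -?addnn ?addnA ?leq_add2r // => e.
   apply/val_inj => /=.
  by apply/eqP; rewrite -(eqn_add2r D); apply/eqP; rewrite -(subnK d1') -(subnK d2') e.
by have := leq_card code inj; rewrite card_prod !card_ffun !card_ord.
Qed.

(** * Matrices close to the identity, and the arithmetic of the grid *)

Section DiagonallyDominant.
Variable N : nat.
Implicit Types (M : 'I_N -> 'I_N -> R) (w v : 'I_N -> R).

(** The tolerance leaves a total deviation of at most 1/2 in a row or column of [N] entries. *)
Definition near_identity M :=
  forall b c, Rabs (M b c - (if b == c then 1 else 0)) <= / (2 * INR N).

Lemma INR_ord (c : 'I_N) : 1 <= INR N.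
Proof. by have := le_INR 1 N; rewrite /=; apply; apply/leP; case: N c => // [[]]. Qed.

(** In the row [b] where [Rabs (w b)] is largest, the off-identity part costs at most half of
    [Rabs (w b)]. *)
Lemma near_identity_inj M w B : near_identity M ->
  (forall b, Rabs (\sum_c w c * M b c) <= B) -> forall c, Rabs (w c) <= 2 * B.
Proof.
move=> HM HB c.
have n1 := INR_ord c.
have [b Hb] := exists_argmax (fun c => Rabs (w c)) c.
suff : Rabs (w b) <= 2 * B by have := Hb c; lra.
have e : \sum_c w c * M b c = w b + \sum_c w c * (M b c - (if b == c then 1 else 0)).
  have -> : w b = \sum_c w c * (if b == c then 1 else 0).
    by rewrite (@rsum_pick _ _ b) ?eqxx; [lra|move=> j; rewrite eq_sym => /negbTE->; lra].
  by rewrite -rsumD; apply: eq_bigr => j _; lra.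
have := HB b; rewrite e.
have : Rabs (\sum_c w c * (M b c - (if b == c then 1 else 0)))
     <= INR #|'I_N| * (Rabs (w b) * / (2 * INR N)).
  apply: Rabs_rsum_le => j; rewrite Rabs_mult.
  by apply: Rmult_le_compat; [exact: Rabs_pos|exact: Rabs_pos|exact: Hb|exact: HM].
rewrite card_ord; have -> : INR N * (Rabs (w b) * / (2 * INR N)) = Rabs (w b) / 2 by field; lra.
set x := \sum_c _ => h1 h2.
by have := Rabs_triang_inv (w b) (- x); rewrite Rabs_Ropp /Rminus Ropp_involutive; lra.
Qed.

(** The slab cut out by a null vector [v] has a normal whose [b0] coordinate is at least 1/2, so it
    is thin along the axis [b0]. *)
Lemma near_identity_row M v b0 : near_identity M ->
  v b0 = 1 -> (forall b, Rabs (v b) <= 1) -> 1 / 2 <= \sum_b v b * M b b0.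
Proof.
move=> HM v1 Hv; have n1 := INR_ord b0.
have -> : \sum_b v b * M b b0 = v b0 + \sum_b v b * (M b b0 - (if b == b0 then 1 else 0)).
  have -> : v b0 = \sum_c v c * (if c == b0 then 1 else 0).
    by rewrite (@rsum_pick _ _ b0) ?eqxx; [lra|move=> j /negbTE->; lra].
  by rewrite -rsumD; apply: eq_bigr => j _; lra.
have : Rabs (\sum_b v b * (M b b0 - (if b == b0 then 1 else 0)))
     <= INR #|'I_N| * (1 * / (2 * INR N)).
  apply: Rabs_rsum_le => j; rewrite Rabs_mult.
  by apply: Rmult_le_compat; [exact: Rabs_pos|exact: Rabs_pos|exact: Hv|exact: HM].
rewrite card_ord; have -> : INR N * (1 * / (2 * INR N)) = 1 / 2 by field; lra.
by move/Rabs_le_elim; lra.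
Qed.

End DiagonallyDominant.

Lemma exists_nat_ge (x : R) : exists m : nat, (0 < m)%N /\ x <= INR m.
Proof.
exists (Z.to_nat (up x)).+1; split=> //; rewrite S_INR.
have [h _] := archimed x.
have [le|lt] := Z_le_gt_dec 0 (up x).
  by rewrite INR_IZR_INZ Z2Nat.id //; lra.
have : IZR (up x) < 0 by apply: IZR_lt; lia.
by have := pos_INR (Z.to_nat (up x)); lra.
Qed.

(** Refutes the bound of [grid_pigeonhole]: the left side has one more power of [e] than the right,
    and [e] exceeds the factor that remains after [(q * k).+1 <= 2 * q * k] and
    [2 * D * e + 1 <= 3 * D * e]. *)
Lemma grid_count N' q k D e : (0 < q)%N -> (0 < k)%N -> (0 < D)%N ->
  e = ((2 * q) ^ N'.+1 * (3 * D) ^ N').+1 ->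
  ~~ ((k * e) ^ N'.+1 <= (q * k).+1 ^ N'.+1 * (2 * (D * e)).+1 ^ N')%N.
Proof.
move=> q0 k0 D0 ee; rewrite -ltnNge.
have e0 : (0 < e)%N by rewrite ee.
apply: (@leq_ltn_trans ((k * (2 * q)) ^ N'.+1 * ((3 * D) * e) ^ N')).
  apply: leq_mul.
    by rewrite leq_exp2r // mulnCA mul2n -addnn -addn1 (mulnC k) leq_add2l muln_gt0 q0.
  have le : (2 * (D * e) < 3 * D * e)%N by rewrite mulnA ltn_pmul2r // ltn_pmul2r.
  by case: (N') => // j; rewrite leq_exp2r.
set P := ((2 * q) ^ N'.+1)%N in ee *; set Q := ((3 * D) ^ N')%N in ee *.
rewrite (expnMn k (2 * q)) (expnMn (3 * D)) (expnMn k e) -/P -/Q [(e ^ N'.+1)%N]expnS.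
rewrite -mulnA [(P * _)%N]mulnA ltn_pmul2l ?expn_gt0 ?k0 //.
by rewrite ltn_pmul2r ?expn_gt0 ?e0 // ee ltnS.
Qed.

Lemma nat_dist_le (i j D : nat) :
  Rabs (INR i - INR j) <= INR D -> (i <= j + D)%N /\ (j <= i + D)%N.
Proof.
move/Rabs_le_elim => h; split; apply/leP; apply: INR_le; rewrite plus_INR; lra.
Qed.

Lemma INR_close_eq (i j : nat) : Rabs (INR i - INR j) < 1 -> i = j.
Proof.
move=> h; apply: INR_eq.
have [lt|[//|lt]] := Rtotal_order (INR i) (INR j); have := le_INR _ _ (INR_lt _ _ lt);
  by rewrite S_INR; move/Rlt_le/Rabs_le_elim: (h); have := Rabs_def2 _ _ h; lra.
Qed.

(** The linear part is taken at [y] while both points vary near [y]. This yields a local Lipschitz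
    bound and, with continuity of [G] and compactness, a remainder uniform in the base point. *)
Definition strictly_differentiable N (g : ('I_N -> R) -> R) (G : 'I_N -> ('I_N -> R) -> R) :=
  forall y eps, 0 < eps -> exists delta, 0 < delta /\ forall z z' h,
    Close y z delta -> Close y z' delta -> Close z z' h ->
    Rabs (g z' - g z - \sum_c G c y * (z' c - z c)) <= eps * h.

Definition continuous_at N (g : ('I_N -> R) -> R) y :=
  forall eps, 0 < eps -> exists delta, 0 < delta /\ forall z, Close y z delta ->
    Rabs (g z - g y) <= eps.

(** * Transversality for gradients that depend linearly on the parameter *)

Section Transversality.
Variables (N' : nat) (T : finType).
Let N := N'.+1.
Notation vec := ('I_N -> R).
Variables (u : T -> 'I_N -> vec -> R) (U : T -> 'I_N -> 'I_N -> vec -> R).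
Hypothesis SD : forall t b, strictly_differentiable (u t b) (U t b).
Hypothesis UC : forall t b c y, continuous_at (U t b c) y.
Hypothesis Span : forall y b, exists alpha : T -> R,
  forall b', \sum_t alpha t * u t b' y = if b' == b then 1 else 0.

Let n := INR N.
Let tau := INR #|T|.

Let n1 : 1 <= n. Proof. by rewrite /n /N S_INR; have := pos_INR N'; lra. Qed.
Let tau0 : 0 <= tau. Proof. exact: pos_INR. Qed.

(** [alpha c] is the parameter direction that moves the gradient at [y0] along the axis [c]; by
    continuity it still does so approximately on a small cube. *)
Lemma local_bounds y0 : exists kappa L Al (alpha : 'I_N -> T -> R),
  0 < kappa /\ 0 < L /\ 0 < Al /\ (forall c t, Rabs (alpha c t) <= Al) /\
  (forall z, Close y0 z kappa -> near_identity (fun b c => \sum_t alpha c t * u t b z)) /\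
  forall z, Close y0 z kappa ->
   (forall t b, Rabs (u t b z) <= L) /\ (forall t b c, Rabs (U t b c z) <= L) /\
   (forall z', Close y0 z' kappa ->
      forall t b h, Close z z' h -> Rabs (u t b z' - u t b z) <= L * h).
Proof.
have [alpha Halpha] := ClassicalEpsilon.choice _ (Span y0).
have [Al [Al0 HAl]] := finite_bound (fun p : 'I_N * T => alpha p.1 p.2).
have [B1 [B10 HB1]] := finite_bound (fun p : T * 'I_N => u p.1 p.2 y0).
have [B2 [B20 HB2]] := finite_bound (fun p : T * 'I_N * 'I_N => U p.1.1 p.1.2 p.2 y0).
have [d1 [d10 Hd1]] : exists d, 0 < d /\ forall p : T * 'I_N, forall z z' h,
    Close y0 z d -> Close y0 z' d -> Close z z' h ->
    Rabs (u p.1 p.2 z' - u p.1 p.2 z - \sum_c U p.1 p.2 c y0 * (z' c - z c)) <= 1 * h.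
  apply: finite_radius => [p|p d d' H d'0 dd z z' h /Close_le h1 /Close_le h2 h3].
    by apply: SD; lra.
  by apply: H => //; [exact: h1|exact: h2].
have [d2 [d20 Hd2]] : exists d, 0 < d /\ forall p : T * 'I_N * 'I_N, forall z,
    Close y0 z d -> Rabs (U p.1.1 p.1.2 p.2 z - U p.1.1 p.1.2 p.2 y0) <= 1.
  apply: finite_radius => [p|p d d' H d'0 dd z /Close_le h1].
    by apply: UC; lra.
  by apply: H; exact: h1.
pose L1 := 1 + n * B2.
have L10 : 0 < L1 by rewrite /L1; have := Rmult_lt_0_compat n B2; lra.
(* A displacement of at most [e] changes each matrix entry by at most
   [tau * Al * L1 * e <= / (2 * n)]; the added 1 keeps the denominator positive. *)
pose e := / (2 * n * (1 + tau * Al * L1)).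
have tAL : 0 <= tau * Al * L1.
  by apply: Rmult_le_pos; [apply: Rmult_le_pos; lra|lra].
have e0 : 0 < e by apply: Rinv_0_lt_compat; apply: Rmult_lt_0_compat; lra.
pose kappa := Rmin (Rmin d1 d2) (Rmin 1 e).
have k0 : 0 < kappa by do !apply: Rmin_glb_lt => //; lra.
have kd1 : kappa <= d1 by apply: Rle_trans (Rmin_l _ _) (Rmin_l _ _).
have kd2 : kappa <= d2 by apply: Rle_trans (Rmin_l _ _) (Rmin_r _ _).
have k1 : kappa <= 1 by apply: Rle_trans (Rmin_r _ _) (Rmin_l _ _).
have ke : kappa <= e by apply: Rle_trans (Rmin_r _ _) (Rmin_r _ _).
have Lip z z' t b h : Close y0 z kappa -> Close y0 z' kappa -> Close z z' h ->
    Rabs (u t b z' - u t b z) <= L1 * h.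
  move=> h1 h2 h3.
  have h4 := Hd1 (t, b) z z' h (Close_le h1 kd1) (Close_le h2 kd1) h3.
  have h5 : Rabs (\sum_c U t b c y0 * (z' c - z c)) <= INR #|'I_N| * (B2 * h).
    apply: Rabs_rsum_le => c; rewrite Rabs_mult.
    by apply: Rmult_le_compat; [exact: Rabs_pos|exact: Rabs_pos|exact: (HB2 (t, b, c))|exact: h3].
  rewrite card_ord -/n /= in h4 h5.
  set x := \sum_c _ in h4 h5.
  have := Rabs_triang (u t b z' - u t b z - x) x.
  have -> : u t b z' - u t b z - x + x = u t b z' - u t b z by lra.
  by rewrite /L1; lra.
exists kappa, (B1 + B2 + 1 + L1), Al, alpha; split=> //; split; first by lra.
split=> //; split; first by move=> c t; exact: (HAl (c, t)).
have self := @Close_refl _ y0 kappa (Rlt_le _ _ k0).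
split=> [z hz b c|z hz].
  rewrite -(Halpha c b) -rsumB.
  apply: Rle_trans (@Rabs_rsum_le _ _ (Al * (L1 * kappa)) _) _.
    move=> t; have -> : alpha c t * u t b z - alpha c t * u t b y0 =
      alpha c t * (u t b z - u t b y0) by lra.
    rewrite Rabs_mult; apply: Rmult_le_compat; try exact: Rabs_pos.
      exact: (HAl (c, t)).
    exact: Lip.
  rewrite -/tau -/n; have := Rmult_le_compat_l _ _ _ tAL ke.
  suff : tau * Al * L1 * e <= / (2 * n) by lra.
  rewrite /e; apply: (Rmult_le_reg_l (2 * n * (1 + tau * Al * L1))).
    by apply: Rmult_lt_0_compat; lra.
  have -> : 2 * n * (1 + tau * Al * L1) * / (2 * n) = 1 + tau * Al * L1 by field; lra.
  have -> : 2 * n * (1 + tau * Al * L1) * (tau * Al * L1 * / (2 * n * (1 + tau * Al * L1)))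
    = tau * Al * L1 by field; lra.
  lra.
split=> [t b|]; last split=> [t b c|z' hz' t b h hh].
- have := Lip y0 z t b kappa self hz hz; have := HB1 (t, b); rewrite /=.
  have := Rabs_triang (u t b z - u t b y0) (u t b y0).
  have -> : u t b z - u t b y0 + u t b y0 = u t b z by lra.
  have := Rmult_le_compat_l L1 _ _ (Rlt_le _ _ L10) k1; lra.
- have := Hd2 (t, b, c) z (Close_le hz kd2); have := HB2 (t, b, c); rewrite /=.
  have := Rabs_triang (U t b c z - U t b c y0) (U t b c y0).
  have -> : U t b c z - U t b c y0 + U t b c y0 = U t b c z by lra.
  lra.
- apply: Rle_trans (Lip _ _ t b _ hz hz' hh) _.
  have h0 : 0 <= h by have := hh ord0; have := Rabs_pos (z' ord0 - z ord0); lra.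
  by have := Rmult_le_compat_r h L1 (B1 + B2 + 1 + L1) h0; lra.
Qed.

(** A Lebesgue number argument. Half of [eps] comes from strict differentiability at a tag [y], half
    from replacing [U] at [y] by [U] at [z]; halving the radii at the tags leaves room for [z']. *)
Lemma uniform_differentiability y0 kappa eps : 0 < eps ->
  exists eta, 0 < eta /\ forall z z' h, Close y0 z kappa -> h <= eta -> Close z z' h ->
    forall t b, Rabs (u t b z' - u t b z - \sum_c U t b c z * (z' c - z c)) <= eps * h.
Proof.
move=> eps0.
have [delta Hdelta] : exists delta : vec -> R, forall y, 0 < delta y /\
    forall p : T * 'I_N,
    (forall z z' h, Close y z (delta y) -> Close y z' (delta y) -> Close z z' h ->
    Rabs (u p.1 p.2 z' - u p.1 p.2 z - \sum_c U p.1 p.2 c y * (z' c - z c)) <= (eps / 2) * h) /\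
    (forall c z, Close y z (delta y) -> Rabs (U p.1 p.2 c z - U p.1 p.2 c y) <= eps / (2 * n)).
  apply: (ClassicalEpsilon.choice (fun y d => 0 < d /\ forall p : T * 'I_N,
    (forall z z' h, Close y z d -> Close y z' d -> Close z z' h ->
    Rabs (u p.1 p.2 z' - u p.1 p.2 z - \sum_c U p.1 p.2 c y * (z' c - z c)) <= (eps / 2) * h) /\
    (forall c z, Close y z d -> Rabs (U p.1 p.2 c z - U p.1 p.2 c y) <= eps / (2 * n)))) => y.
  apply: finite_radius => [[t b]|[t b] d d' [H1 H2] d'0 dd] /=; last first.
    split=> [z z' h /Close_le h1 /Close_le h2 h3|c z /Close_le h].
      by apply: H1 => //; [exact: h1|exact: h2].
    by apply: H2; exact: h.
  have e2 : 0 < eps / 2 by lra.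
  have en : 0 < eps / (2 * n) by apply: Rdiv_lt_0_compat; lra.
  have [d1 [d10 H1]] := SD t b y e2.
  have [d2 [d20 H2]] : exists d, 0 < d /\ forall c : 'I_N, forall z, Close y z d ->
      Rabs (U t b c z - U t b c y) <= eps / (2 * n).
    apply: finite_radius => [c|c d d' H d'0 dd z /Close_le h]; first exact: UC.
    by apply: H; exact: h.
  exists (Rmin d1 d2); split; first exact: Rmin_glb_lt.
  split=> [z z' h /Close_le h1 /Close_le h2 h3|c z /Close_le h].
    by apply: H1 => //; [apply: h1|apply: h2]; exact: Rmin_l.
  by apply: H2; apply: h; exact: Rmin_r.
have dp y : 0 < delta y / 2 by have [] := Hdelta y; lra.
have [l Hl] := cube_compact y0 kappa dp.
have [eta [eta0 Heta]] := list_min_pos l dp.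
exists eta; split=> // z z' h hz he hh t b.
have [y [yl [_ cy]]] := Hl z hz.
have [_ /(_ (t, b)) /= [H1 H2]] := Hdelta y.
have dy := dp y.
have cz : Close y z (delta y) by apply: Close_le cy _; lra.
have cz' : Close y z' (delta y).
  apply: Close_le (Close_trans cy hh) _; have := Heta y yl; lra.
have := H1 z z' h cz cz' hh.
have : Rabs (\sum_c (U t b c z - U t b c y) * (z' c - z c)) <= INR #|'I_N| * (eps / (2 * n) * h).
  apply: Rabs_rsum_le => c; rewrite Rabs_mult.
  by apply: Rmult_le_compat; [exact: Rabs_pos|exact: Rabs_pos|exact: H2|exact: hh].
rewrite card_ord -/n; have -> : n * (eps / (2 * n) * h) = eps / 2 * h by field; lra.
have -> : \sum_c (U t b c z - U t b c y) * (z' c - z c) =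
   \sum_c U t b c z * (z' c - z c) - \sum_c U t b c y * (z' c - z c).
  by rewrite -rsumB; apply: eq_bigr => c _; lra.
set A := \sum_c _; set B := \sum_c _ => h1 h2.
have := Rabs_triang (u t b z' - u t b z - B) (- (A - B)); rewrite Rabs_Ropp.
have -> : u t b z' - u t b z - B + - (A - B) = u t b z' - u t b z - A by lra.
lra.
Qed.

Definition grad (a : T -> R) b y := \sum_t a t * u t b y.
Definition hess (a : T -> R) b c y := \sum_t a t * U t b c y.

(* The tolerance [delta] makes the complement open in the parameter [a] without any compactness
   argument; the normalisation of [v] is that of the maximum norm. *)
Definition near_degenerate delta a y v :=
  (forall b, Rabs (grad a b y) <= delta) /\ (exists b, v b = 1) /\
  (forall b, Rabs (v b) <= 1) /\ forall c, Rabs (\sum_b v b * hess a b c y) <= delta.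

Section Pair.
Variables (y0 : vec) (kappa L Al A : R) (alpha : 'I_N -> T -> R) (a0 : T -> R).
Hypothesis (L0 : 0 < L) (Al0 : 0 < Al) (A0 : 0 < A).
Hypothesis HAl : forall c t, Rabs (alpha c t) <= Al.
Hypothesis Lip : forall z z', Close y0 z kappa -> Close y0 z' kappa ->
      forall t b h, Close z z' h -> Rabs (u t b z' - u t b z) <= L * h.

Let M z b c := \sum_t alpha c t * u t b z.
Hypothesis HM : forall z, Close y0 z kappa -> near_identity (M z).

(** An affine slice of dimension [N] through [a0]. Along it the gradient at a fixed point has the
    near-identity matrix [M] as derivative in [s], so the count takes place in equal dimensions. *)
Definition slice (s : 'I_N -> R) t := a0 t + \sum_c s c * alpha c t.

(** [lip_const] is the factor 2 of [near_identity_inj] applied to [2 * eta + tau * A * L * eta]. The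
    terms of [err_const] bound, in order, [X1] and [X3] together, [X4], and [X2] in
    [pair_estimate]. *)
Definition lip_const := 2 * (2 + tau * A * L).
Definition err_const := 3 * n + n * n * tau * lip_const * Al * L + n * tau * A.

Lemma slice_sub s s' t : slice s' t - slice s t = \sum_c (s' c - s c) * alpha c t.
Proof.
rewrite /slice; have -> : \sum_c (s' c - s c) * alpha c t =
  \sum_c s' c * alpha c t - \sum_c s c * alpha c t; last by lra.
by rewrite -rsumB; apply: eq_bigr => c _; lra.
Qed.

Lemma grad_slice_sub s s' b z :
  grad (slice s') b z - grad (slice s) b z = \sum_c (s' c - s c) * M z b c.
Proof.
rewrite /grad -rsumB.
transitivity (\sum_t \sum_c (s' c - s c) * (alpha c t * u t b z)).
  apply: eq_bigr => t _; rewrite -Rmult_minus_distr_r slice_sub -rsumZr.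
  by apply: eq_bigr => c _; lra.
by rewrite rsum_exch; apply: eq_bigr => c _; rewrite rsumZ.
Qed.

(* The vector [v] is a left null vector of the Hessian at [z0], so pairing the difference of the
   gradients with [v] leaves only a remainder of order [eps * eta]: this is the slab. *)
Lemma pair_estimate eps eta delta s0 s1 z0 z1 v :
  0 < eta -> eta <= eps -> eps <= 1 -> delta <= eps * eta ->
  (forall t, Rabs (slice s0 t) <= A) -> (forall t, Rabs (slice s1 t) <= A) ->
  (forall t b, Rabs (u t b z1 - u t b z0 - \sum_c U t b c z0 * (z1 c - z0 c)) <= eps * eta) ->
  Close y0 z0 kappa -> Close y0 z1 kappa -> Close z0 z1 eta ->
  near_degenerate delta (slice s0) z0 v ->
  (forall b, Rabs (grad (slice s1) b z1) <= delta) ->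
  (forall c, Rabs (s1 c - s0 c) <= lip_const * eta) /\
  Rabs (\sum_c (s1 c - s0 c) * \sum_b v b * M z0 b c) <= err_const * eps * eta.
Proof.
move=> eta0 etae e1 de A0s A1s UD k0 k1 kk [G0 [_ [v1 H0]]] G1.
have d_eta : delta <= eta by apply: Rle_trans de _; have := Rmult_le_compat_r eta eps 1; lra.
have est1 c : Rabs (s1 c - s0 c) <= lip_const * eta.
  have -> : lip_const * eta = 2 * (2 * eta + tau * (A * (L * eta))) by rewrite /lip_const; lra.
  apply: (near_identity_inj (w := fun c => s1 c - s0 c) (HM k0)) => b; rewrite -grad_slice_sub.
  have h : Rabs (grad (slice s1) b z1 - grad (slice s1) b z0) <= tau * (A * (L * eta)).
    rewrite /grad -rsumB; apply: Rabs_rsum_le => t; rewrite -Rmult_minus_distr_l Rabs_mult.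
    by apply: Rmult_le_compat; [exact: Rabs_pos|exact: Rabs_pos|exact: A1s|exact: Lip].
  have := Rabs_le_elim h; have := Rabs_le_elim (G0 b); have := Rabs_le_elim (G1 b).
  by move=> *; apply: Rabs_le; lra.
split=> //.
have C10 : 0 < lip_const by rewrite /lip_const; have := Rmult_le_pos _ _ (Rmult_le_pos _ _ tau0 (Rlt_le _ _ A0)) (Rlt_le _ _ L0); lra.
have -> : \sum_c (s1 c - s0 c) * \sum_b v b * M z0 b c =
   \sum_b v b * (grad (slice s1) b z0 - grad (slice s0) b z0).
  under eq_bigr => c _ do rewrite -rsumZ.
  rewrite rsum_exch; apply: eq_bigr => b _; rewrite grad_slice_sub -rsumZ.
  by apply: eq_bigr => c _; lra.
(* [X1] is the change of gradient between the two nearly critical pairs, [X2] the Taylor remainder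
   at the parameter [s0], [X3] the linear part, which [v] almost annihilates, and [X4] the mixed
   second difference, quadratic in [eta]. *)
pose lin b := \sum_c hess (slice s0) b c z0 * (z1 c - z0 c).
pose X1 := \sum_b v b * (grad (slice s1) b z1 - grad (slice s0) b z0).
pose X2 := \sum_b v b * (grad (slice s0) b z1 - grad (slice s0) b z0 - lin b).
pose X3 := \sum_b v b * lin b.
pose X4 := \sum_b v b * ((grad (slice s1) b z1 - grad (slice s0) b z1)
                         - (grad (slice s1) b z0 - grad (slice s0) b z0)).
have -> : \sum_b v b * (grad (slice s1) b z0 - grad (slice s0) b z0) = X1 - X2 - X3 - X4.
  rewrite /X1 /X2 /X3 /X4 -!rsumB; apply: eq_bigr => b _; lra.
have bX (f : 'I_N -> R) B : (forall b, Rabs (f b) <= B) -> Rabs (\sum_b v b * f b) <= n * B.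
  move=> Hf; rewrite /n -[N in INR N]card_ord; apply: Rabs_rsum_le => b.
  rewrite Rabs_mult -[B]Rmult_1_l.
  by apply: Rmult_le_compat; [exact: Rabs_pos|exact: Rabs_pos|exact: v1|exact: Hf].
have b1 : Rabs X1 <= n * (2 * (eps * eta)).
  apply: bX => b; have := Rabs_le_elim (G0 b); have := Rabs_le_elim (G1 b).
  by move=> *; apply: Rabs_le; lra.
have b2 : Rabs X2 <= n * (tau * (A * (eps * eta))).
  apply: bX => b.
  have -> : grad (slice s0) b z1 - grad (slice s0) b z0 - lin b =
    \sum_t slice s0 t * (u t b z1 - u t b z0 - \sum_c U t b c z0 * (z1 c - z0 c)).
    have -> : lin b = \sum_t slice s0 t * \sum_c U t b c z0 * (z1 c - z0 c).
      rewrite /lin /hess; under eq_bigr => c _ do rewrite -rsumZr.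
      rewrite rsum_exch; apply: eq_bigr => t _; rewrite -rsumZ.
      by apply: eq_bigr => c _; lra.
    by rewrite /grad -!rsumB; apply: eq_bigr => t _; lra.
  apply: Rabs_rsum_le => t; rewrite Rabs_mult.
  by apply: Rmult_le_compat; [exact: Rabs_pos|exact: Rabs_pos|exact: A0s|exact: UD].
have b3 : Rabs X3 <= n * (eps * eta).
  have -> : X3 = \sum_c (\sum_b v b * hess (slice s0) b c z0) * (z1 c - z0 c).
    rewrite /X3 /lin; under eq_bigr => b _ do rewrite -rsumZ.
    rewrite rsum_exch; apply: eq_bigr => c _; rewrite -rsumZr.
    by apply: eq_bigr => b _; lra.
  rewrite /n -[N in INR N]card_ord; apply: Rabs_rsum_le => c.
  rewrite Rabs_mult; apply: Rmult_le_compat; try exact: Rabs_pos; last exact: kk.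
  by apply: Rle_trans (H0 c) _; lra.
have b4 : Rabs X4 <= n * (tau * (n * (lip_const * eta * Al) * (L * eta))).
  apply: bX => b.
  have -> : (grad (slice s1) b z1 - grad (slice s0) b z1)
                         - (grad (slice s1) b z0 - grad (slice s0) b z0) =
    \sum_t (\sum_c (s1 c - s0 c) * alpha c t) * (u t b z1 - u t b z0).
    by rewrite /grad -!rsumB; apply: eq_bigr => t _; rewrite -slice_sub; lra.
  apply: Rabs_rsum_le => t; rewrite Rabs_mult.
  apply: Rmult_le_compat; [exact: Rabs_pos|exact: Rabs_pos| |exact: Lip].
  rewrite /n -[N in INR N]card_ord; apply: Rabs_rsum_le => c.
  by rewrite Rabs_mult; apply: Rmult_le_compat; [exact: Rabs_pos|exact: Rabs_pos|exact: est1|exact: HAl].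
have -> : err_const * eps * eta = n * (2 * (eps * eta)) + n * (tau * (A * (eps * eta)))
    + n * (eps * eta) + (n * tau * n * lip_const * Al * L * eta) * eps by rewrite /err_const; lra.
(* Here [eta <= eps] turns the quadratic term into one of order [eps * eta]. *)
have b5 : n * (tau * (n * (lip_const * eta * Al) * (L * eta))) <= (n * tau * n * lip_const * Al * L * eta) * eps.
  have -> : n * (tau * (n * (lip_const * eta * Al) * (L * eta))) = (n * tau * n * lip_const * Al * L * eta) * eta by lra.
  apply: Rmult_le_compat_l => //.
  by do 6!(apply: Rmult_le_pos; last by lra); lra.
move: b1 b2 b3 b4 => /Rabs_le_elim ? /Rabs_le_elim ? /Rabs_le_elim ? /Rabs_le_elim ?.
by apply: Rabs_le; lra.
Qed.

End Pair.

(** Exact degeneracy at [a] becomes approximate degeneracy at any [a1] within [rho]; excluding the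
    latter at one [a1] therefore excludes the former on a whole ball. The factor [n] comes from the
    sum over the rows of the Hessian. *)
Lemma near_degenerate_robust L delta rho a a1 y v :
  (forall t b, Rabs (u t b y) <= L) -> (forall t b c, Rabs (U t b c y) <= L) ->
  near_param a1 a rho -> n * tau * (rho * L) <= delta ->
  near_degenerate 0 a y v -> near_degenerate delta a1 y v.
Proof.
move=> HL HU near le [G [ex [v1 H]]].
have rL : 0 <= tau * (rho * L).
  rewrite /tau -rsum_const; elim/big_ind: _ => [|*|t _]; [lra|lra|].
  apply: Rmult_le_pos.
    by have := near t; have := Rabs_pos (a t - a1 t); lra.
  by have := HL t ord0; have := Rabs_pos (u t ord0 y); lra.
split=> [b|]; last split=> //; last split=> // c.
  have g0 : grad a b y = 0 by have := Rabs_le_elim (G b); lra.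
  have -> : grad a1 b y = - (\sum_t (a t - a1 t) * u t b y).
    under eq_bigr => t _ do rewrite Rmult_minus_distr_r.
    by rewrite rsumB -/(grad a b y) g0 /grad; lra.
  rewrite Rabs_Ropp; apply: Rle_trans (_ : tau * (rho * L) <= _).
    apply: Rabs_rsum_le => t; rewrite Rabs_mult.
    by apply: Rmult_le_compat; [exact: Rabs_pos|exact: Rabs_pos|exact: near|exact: HL].
  by have := Rmult_le_compat_r _ _ _ rL n1; lra.
have h0 : \sum_b v b * hess a b c y = 0 by have := Rabs_le_elim (H c); lra.
have -> : \sum_b v b * hess a1 b c y = - (\sum_b v b * \sum_t (a t - a1 t) * U t b c y).
  have -> : \sum_b v b * (\sum_t (a t - a1 t) * U t b c y) =
     \sum_b v b * hess a b c y - \sum_b v b * hess a1 b c y; last by lra.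
  rewrite -rsumB; apply: eq_bigr => b _.
  under eq_bigr => t _ do rewrite Rmult_minus_distr_r.
  by rewrite rsumB /hess; lra.
rewrite Rabs_Ropp; apply: Rle_trans (_ : n * (1 * (tau * (rho * L))) <= _); last by lra.
rewrite /n -[N in INR N]card_ord; apply: Rabs_rsum_le => b; rewrite Rabs_mult.
apply: Rmult_le_compat; try exact: Rabs_pos; first exact: v1.
apply: Rabs_rsum_le => t; rewrite Rabs_mult.
by apply: Rmult_le_compat; [exact: Rabs_pos|exact: Rabs_pos|exact: near|exact: HU].
Qed.

(** If every grid point of the slice had a nearly degenerate critical point in the cube, then by
    [pair_estimate] the grid points sharing a cell of side [eta] would lie in a slab too thin to
    hold two points of one grid line along a suitable axis, and [grid_pigeonhole] would contradict
    [grid_count]. *)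
Lemma local_nowhere_dense y0 : exists kappa, 0 < kappa /\
  nowhere_dense (fun a => exists y v, Close y0 y kappa /\ near_degenerate 0 a y v).
Proof.
have [kappa [L [Al [alpha [k0 [L0 [Al0 [HAl [HM Hb]]]]]]]]] := local_bounds y0.
exists kappa; split=> // a0 rho rho0.
have [Ba [Ba0 HBa]] := finite_bound a0.
pose A := Ba + rho.
have A0 : 0 < A by rewrite /A; lra.
have Lip z z' : Close y0 z kappa -> Close y0 z' kappa ->
      forall t b h, Close z z' h -> Rabs (u t b z' - u t b z) <= L * h.
  by move=> h1 h2; have [_ [_ H]] := Hb z h1; exact: H.
pose c1 := lip_const L A; pose c2 := err_const L Al A.
have tAL : 0 <= tau * A * L by do 2!(apply: Rmult_le_pos; last by lra).
have c11 : 1 <= c1 by rewrite /c1 /lip_const; lra.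
have c21 : 1 <= c2.
  rewrite /c2 /err_const -/c1.
  have : 0 <= n * n * tau * c1 * Al * L by do 5!(apply: Rmult_le_pos; last by lra); lra.
  have : 0 <= n * tau * A by do 2!(apply: Rmult_le_pos; last by lra); lra.
  lra.
pose sigma := rho / (2 * n * Al).
have nAl : 0 < 2 * n * Al by apply: Rmult_lt_0_compat; lra.
have sigma0 : 0 < sigma by apply: Rdiv_lt_0_compat.
have Hslice s : (forall c, Rabs (s c) <= sigma) -> near_param a0 (slice alpha a0 s) (rho / 2).
  move=> Hs t; rewrite /slice; have -> : forall x y, x + y - x = y by move=> *; lra.
  have -> : rho / 2 = n * (sigma * Al) by rewrite /sigma; field; lra.
  rewrite /n -[N in INR N]card_ord; apply: Rabs_rsum_le => c; rewrite Rabs_mult.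
  by apply: Rmult_le_compat; [exact: Rabs_pos|exact: Rabs_pos|exact: Hs|exact: HAl].
have HsliceA s : (forall c, Rabs (s c) <= sigma) -> forall t, Rabs (slice alpha a0 s t) <= A.
  move=> /Hslice Hs t; have := Hs t; have := HBa t.
  have := Rabs_triang (slice alpha a0 s t - a0 t) (a0 t).
  have -> : slice alpha a0 s t - a0 t + a0 t = slice alpha a0 s t by lra.
  by rewrite /A; lra.
(* [q] is such that the whole grid, of extent [gamma * k * e = 10 * c2 * kappa / q], stays within
   [sigma]. *)
have [q [q0 Hq]] := exists_nat_ge (10 * c2 * kappa / sigma).
have [D [D0 HD]] := exists_nat_ge c1.
(* [q] and [D] are fixed before [e], and [e] before [k]; so the fineness [k] of the cells can be
   chosen in terms of [eps = / e]. *)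
pose e := ((2 * q) ^ N * (3 * D) ^ N').+1.
have e1 : 1 <= INR e by rewrite /e S_INR; have := pos_INR ((2 * q) ^ N * (3 * D) ^ N'); lra.
pose eps := / INR e.
have eps0 : 0 < eps by apply: Rinv_0_lt_compat; lra.
have eps1 : eps <= 1 by rewrite -Rinv_1; apply: Rinv_le_contravar; lra.
have [eta0 [eta00 UD]] := uniform_differentiability y0 kappa eps0.
pose etam := Rmin eps eta0.
have etam0 : 0 < etam by apply: Rmin_glb_lt.
have [k [kp Hk]] := exists_nat_ge (2 * kappa / etam).
have q1 : 1 <= INR q by apply: (le_INR 1); apply/leP.
have k1 : 1 <= INR k by apply: (le_INR 1); apply/leP.
pose eta := 2 * kappa / (INR q * INR k).
have qk0 : 0 < INR q * INR k by apply: Rmult_lt_0_compat; lra.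
have eta_pos : 0 < eta by apply: Rdiv_lt_0_compat; lra.
have eta_le : eta <= etam.
  have h : 2 * kappa <= INR k * etam.
    have -> : 2 * kappa = 2 * kappa / etam * etam by field; lra.
    by apply: Rmult_le_compat_r; lra.
  apply: (Rmult_le_reg_l (INR q * INR k)) => //.
  have -> : INR q * INR k * eta = 2 * kappa by rewrite /eta; field; lra.
  have ke0 : 0 < INR k * etam by apply: Rmult_lt_0_compat; lra.
  have := Rmult_le_compat_r (INR k * etam) _ _ (Rlt_le _ _ ke0) q1.
  lra.
have eta_eps : eta <= eps by apply: Rle_trans eta_le (Rmin_l _ _).
have eta_eta0 : eta <= eta0 by apply: Rle_trans eta_le (Rmin_r _ _).
have UDe z z' : Close y0 z kappa -> Close z z' eta -> forall t b,
    Rabs (u t b z' - u t b z - \sum_c U t b c z * (z' c - z c)) <= eps * eta.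
  by move=> h1 h2; apply: (UD z z' eta).
(* The grid step. Two grid points of one cell that agree off the coordinate [i] turn out to be at
   most [4 * c2 * eps * eta] apart, hence equal. *)
pose gamma := 5 * c2 * eta * eps.
have ee0 : 0 < eta * eps by apply: Rmult_lt_0_compat.
have cee0 : 0 < c2 * (eta * eps) by apply: Rmult_lt_0_compat; lra.
have gamma0 : 0 < gamma by rewrite /gamma; lra.
pose s (f : {ffun 'I_N -> 'I_(k * e)}) (c : 'I_N) := gamma * INR (f c).
have Hs f c : Rabs (s f c) <= sigma.
  have g0 : 0 <= INR (f c) by exact: pos_INR.
  rewrite Rabs_right; last by apply: Rle_ge; apply: Rmult_le_pos; lra.
  have : INR (f c) <= INR k * INR e by rewrite -mult_INR; apply: le_INR; apply/leP; exact: ltnW.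
  move/(Rmult_le_compat_l gamma _ _ (Rlt_le _ _ gamma0)).
  suff : gamma * (INR k * INR e) <= sigma by rewrite /s; lra.
  have -> : gamma * (INR k * INR e) = 10 * c2 * kappa / INR q.
    by rewrite /gamma /eta /eps; field; lra.
  apply: (Rmult_le_reg_l (INR q)); first lra.
  have -> : INR q * (10 * c2 * kappa / INR q) = 10 * c2 * kappa / sigma * sigma by field; lra.
  by apply: Rmult_le_compat_r; lra.
pose delta := eps * eta.
have delta0 : 0 < delta by rewrite /delta; lra.
have [f Hf] : exists f, forall y v, Close y0 y kappa ->
    ~ near_degenerate delta (slice alpha a0 (s f)) y v.
  apply: NNPP => H.
  have [yv Hyv] : exists yv : {ffun 'I_N -> 'I_(k * e)} -> vec * vec, forall f,
      Close y0 (yv f).1 kappa /\ near_degenerate delta (slice alpha a0 (s f)) (yv f).1 (yv f).2.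
    apply: (ClassicalEpsilon.choice (fun f (yv : vec * vec) => Close y0 yv.1 kappa /\
       near_degenerate delta (slice alpha a0 (s f)) yv.1 yv.2)) => f.
    apply: NNPP => H'; apply: H; exists f => y v h1 h2; apply: H'.
    by exists (y, v).
  (* A cube of side [2 * kappa] has [q * k] cells of side [eta] per axis; the extra index catches
     points on the upper faces. *)
  have [cell Hcell] : exists cell : {ffun 'I_N -> 'I_(k * e)} -> {ffun 'I_N -> 'I_(q * k).+1},
      forall f c, INR (cell f c) <= ((yv f).1 c - (y0 c - kappa)) / eta < INR (cell f c) + 1.
    suff [g Hg] : exists g : {ffun 'I_N -> 'I_(k * e)} * 'I_N -> 'I_(q * k).+1,
      forall p, INR (g p) <= ((yv p.1).1 p.2 - (y0 p.2 - kappa)) / eta < INR (g p) + 1.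
      by exists (fun f => [ffun c => g (f, c)]) => f c; rewrite ffunE; exact: (Hg (f, c)).
    apply: (ClassicalEpsilon.choice (fun p (i : 'I_(q * k).+1) =>
      INR i <= ((yv p.1).1 p.2 - (y0 p.2 - kappa)) / eta < INR i + 1)) => -[f c] /=.
    have [/(_ c) /Rabs_le_elim Hc _] := Hyv f.
    have x0 : 0 <= ((yv f).1 c - (y0 c - kappa)) / eta.
      by apply: Rle_mult_inv_pos; lra.
    have [m Hm] := Rcomplements.nfloor_ex _ x0.
    suff lt : (m < (q * k).+1)%N by exists (Ordinal lt).
    rewrite ltnS; apply/leP; apply: INR_le; rewrite mult_INR.
    apply: Rle_trans (proj1 Hm) _.
    apply: (Rmult_le_reg_r eta) => //.
    have -> : INR q * INR k * eta = 2 * kappa by rewrite /eta; field; lra.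
    by rewrite /Rdiv Rmult_assoc Rinv_l; lra.
  have Hclose f f' : cell f = cell f' -> Close (yv f).1 (yv f').1 eta.
    move=> ec c; have := Hcell f c; have := Hcell f' c; rewrite ec.
    set r := _ / eta; set r' := _ / eta.
    have -> : (yv f').1 c - (yv f).1 c = (r - r') * eta by rewrite /r /r'; field; lra.
    move=> h1 h2; rewrite Rabs_mult (Rabs_right eta); last lra.
    rewrite -{2}[eta]Rmult_1_l; apply: Rmult_le_compat_r; first lra.
    by apply: Rabs_le; lra.
  apply: (negP (grid_count q0 kp D0 (erefl e))).
  apply: (@grid_pigeonhole _ _ _ _ cell) => f0.
  have [K0 ND0] := Hyv f0.
  have [_ [[i vi] [v1 _]]] := ND0.
  have P f : cell f = cell f0 -> (forall c, Rabs (s f c - s f0 c) <= c1 * eta) /\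
      Rabs (\sum_c (s f c - s f0 c) *
        \sum_b (yv f0).2 b * \sum_t alpha c t * u t b (yv f0).1) <= c2 * eps * eta.
    move=> ef; have [K1 [G1 _]] := Hyv f.
    have cl := Hclose _ _ (esym ef).
    apply: (pair_estimate L0 Al0 A0 HAl Lip HM (eps := eps) (eta := eta) (delta := delta) (z1 := (yv f).1)) => //.
    - by rewrite /delta; lra.
    - exact: HsliceA.
    - exact: HsliceA.
    - exact: UDe.
    - exact: ND0.
  exists i; split=> [f j ef|f1 f2 ef1 ef2 eq12].
    apply: nat_dist_le; have [/(_ j) + _] := P f ef.
    rewrite /s -Rmult_minus_distr_l Rabs_mult (Rabs_right gamma); last lra.
    set x := Rabs _ => h; rewrite mult_INR.
    apply: (Rmult_le_reg_l gamma) => //; apply: Rle_trans h _.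
    have -> : gamma * (INR D * INR e) = 5 * (c2 * INR D) * eta by rewrite /gamma /eps; field; lra.
    apply: Rmult_le_compat_r; first lra.
    have := Rmult_le_compat_r (INR D) 1 c2 (pos_INR D) c21; lra.
  apply/ffunP => j; have [->|ne] := eqVneq j i; last exact: eq12.
  have [_ h1] := P f1 ef1; have [_ h2] := P f2 ef2.
  set w := fun c => \sum_b (yv f0).2 b * \sum_t alpha c t * u t b (yv f0).1.
  have wi : 1 / 2 <= w i by apply: near_identity_row (HM _ K0) vi v1.
  have dw : (s f1 i - s f2 i) * w i = \sum_c (s f1 c - s f0 c) * w c - \sum_c (s f2 c - s f0 c) * w c.
    rewrite -rsumB (@rsum_pick _ _ i) => [|c ci]; first by lra.
    have -> : s f1 c = s f2 c by rewrite /s eq12.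
    by rewrite Rminus_diag.
  have : Rabs ((s f1 i - s f2 i) * w i) <= 2 * (c2 * eps * eta).
    rewrite dw; move: h1 h2 => /Rabs_le_elim ? /Rabs_le_elim ?; apply: Rabs_le.
    rewrite /w; lra.
  rewrite Rabs_mult (Rabs_right (w i)); last lra.
  rewrite /s -Rmult_minus_distr_l Rabs_mult (Rabs_right gamma); last lra.
  set x := Rabs _ => h.
  have x0 : 0 <= x by exact: Rabs_pos.
  have h' : gamma * x * (1 / 2) <= 2 * (c2 * eps * eta).
    apply: Rle_trans h; apply: Rmult_le_compat_l => //; apply: Rmult_le_pos; lra.
  have x1 : x < 1.
    apply: (Rmult_lt_reg_l gamma) => //.
    have e1' : gamma = 5 * (c2 * (eta * eps)) by rewrite /gamma; lra.
    by rewrite {2}e1'; lra.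
  by apply/val_inj; exact: INR_close_eq x1.
have tL0 : 0 <= tau * L by apply: Rmult_le_pos; lra.
have ntL : 0 < n * (1 + tau * L) by apply: Rmult_lt_0_compat; lra.
(* The slice point is within [rho / 2] of [a0], so [rho / 2] more stays in the given ball; the other
   bound is what [near_degenerate_robust] requires. *)
pose rho1 := Rmin (rho / 2) (delta / (n * (1 + tau * L))).
have rho10 : 0 < rho1 by apply: Rmin_glb_lt; [lra|apply: Rdiv_lt_0_compat].
exists (slice alpha a0 (s f)), rho1; split=> // a Ha; split.
  move=> t; have h1 := Ha t; have h2 := Hslice (s f) (Hs f) t.
  have h3 : rho1 <= rho / 2 by exact: Rmin_l.
  have := Rabs_triang (a t - slice alpha a0 (s f) t) (slice alpha a0 (s f) t - a0 t).
  have -> : a t - slice alpha a0 (s f) t + (slice alpha a0 (s f) t - a0 t) = a t - a0 t by lra.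
  lra.
move=> [y [v [ky nd]]]; apply: (Hf y v ky).
have [Hu [HU _]] := Hb y ky.
apply: (near_degenerate_robust Hu HU Ha) nd.
have h3 : rho1 <= delta / (n * (1 + tau * L)) by exact: Rmin_r.
have := Rmult_le_compat_l _ _ _ (Rlt_le _ _ ntL) h3.
have -> : n * (1 + tau * L) * (delta / (n * (1 + tau * L))) = delta by field; lra.
have : 0 <= n * rho1 by apply: Rmult_le_pos; lra.
lra.
Qed.

Lemma cube_nowhere_dense r :
  nowhere_dense (fun a => exists y v, Close (fun _ => 0) y r /\ near_degenerate 0 a y v).
Proof.
have [kappa Hk] := ClassicalEpsilon.choice _ local_nowhere_dense.
have [l Hl] := cube_compact (fun _ : 'I_N => 0) r (fun y => proj1 (Hk y)).
apply: (nowhere_dense_sub _ (nowhere_dense_list l (fun y => proj2 (Hk y)))) => a [y [v [cy nd]]].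
have [t [tl [_ ct]]] := Hl y cy.
by exists t; split=> //; exists y, v.
Qed.

(** Baire's theorem over cubes of integer size. A nonzero null vector, divided by an entry of
    largest modulus, has the normalisation of [near_degenerate]. *)
Lemma nondegenerate_parameter a0 rho : 0 < rho -> exists a, near_param a0 a rho /\
  forall y v, (forall b, grad a b y = 0) -> (forall c, \sum_b v b * hess a b c y = 0) ->
    forall b, v b = 0.
Proof.
move=> rho0.
have [a [near Ha]] := baire (fun m => cube_nowhere_dense (INR m)) a0 rho0.
exists a; split=> // y v G H b.
have [b0 Hb0] := exists_argmax (fun b => Rabs (v b)) b.
apply: NNPP => vb.
have v0 : v b0 <> 0.
  move=> e; apply: vb; have := Hb0 b; rewrite e Rabs_R0 => /Rabs_le_elim; lra.
have [B [B0 HB]] := finite_bound y.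
have [m [_ Hm]] := exists_nat_ge B.
apply: (Ha m); exists y, (fun b => v b / v b0); split.
  by move=> c; rewrite Rminus_0_r; have := HB c; lra.
split=> [c|]; first by rewrite G Rabs_R0; lra.
split; first by exists b0; rewrite /Rdiv Rinv_r.
split=> [c|c].
  rewrite /Rdiv Rabs_mult Rabs_inv.
  apply: (Rmult_le_reg_r (Rabs (v b0))); first exact: Rabs_pos_lt.
  by rewrite Rmult_assoc Rinv_l ?Rmult_1_r ?Rmult_1_l; [exact: Hb0|exact: Rabs_no_R0].
have -> : \sum_b1 v b1 / v b0 * hess a b1 c y = / v b0 * \sum_b v b * hess a b c y.
  by rewrite -rsumZ; apply: eq_bigr => b1 _; rewrite /Rdiv; lra.
by rewrite H Rmult_0_r Rabs_R0; lra.
Qed.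

End Transversality.

(** * Partial derivatives on [I -> R] *)

Section Partials.
Variable I : Type.
Implicit Types (F G : (I -> R) -> R) (x y z : I -> R).

Lemma upd_same x i t : upd x i t i = x i + t.
Proof. by rewrite /upd; case: excluded_middle_informative. Qed.

Lemma upd_other x i t k : k <> i -> upd x i t k = x k.
Proof. by rewrite /upd; case: excluded_middle_informative. Qed.

Lemma upd0 x i : upd x i 0 = x.
Proof.
apply: functional_extensionality => k; rewrite /upd.
by case: excluded_middle_informative => // _; rewrite Rplus_0_r.
Qed.

Lemma upd_upd x i s t : upd (upd x i s) i t = upd x i (s + t).
Proof.
apply: functional_extensionality => k; rewrite /upd.
by case: excluded_middle_informative => // _; rewrite Rplus_assoc.
Qed.

Lemma Partial_uniq F x i l l' : Partial F x i l -> Partial F x i l' -> l = l'.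
Proof. exact: uniqueness_limite. Qed.

(** [Partial2] quantifies over the first derivative; uniqueness of limits identifies it with the
    given [D k]. *)
Lemma Partial2_of F (D : I -> (I -> R) -> R) x i k l :
  (forall y k, Partial F y k (D k y)) -> Partial2 F x i k l -> Partial (D k) x i l.
Proof.
move=> HD [g [Hg Hl]]; have <- // : g = D k.
by apply: functional_extensionality => y; apply: Partial_uniq (Hg y) (HD y k).
Qed.

Lemma Partial2_uniq F x i k l l' : Partial2 F x i k l -> Partial2 F x i k l' -> l = l'.
Proof.
move=> [g [Hg Hl]] [g' [Hg' Hl']]; have e : g = g'.
  by apply: functional_extensionality => y; apply: Partial_uniq (Hg y) (Hg' y).
by rewrite e in Hl; exact: Partial_uniq Hl Hl'.
Qed.

Lemma Partial_const c x i : Partial (fun _ => c) x i 0.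
Proof. exact: derivable_pt_lim_const. Qed.

Lemma Partial_add F G x i a b :
  Partial F x i a -> Partial G x i b -> Partial (fun x => F x + G x) x i (a + b).
Proof. exact: derivable_pt_lim_plus. Qed.

Lemma Partial_scal c F x i a : Partial F x i a -> Partial (fun x => c * F x) x i (c * a).
Proof. exact: derivable_pt_lim_scal. Qed.

Lemma Partial_mul F G x i a b : Partial F x i a -> Partial G x i b ->
  Partial (fun x => F x * G x) x i (a * G x + F x * b).
Proof.
move=> HF HG; have := derivable_pt_lim_mult _ _ _ _ _ HF HG.
by rewrite upd0.
Qed.

Lemma Partial_comp (f : R -> R) F x i a b : derivable_pt_lim f (F x) b ->
  Partial F x i a -> Partial (fun x => f (F x)) x i (b * a).
Proof.
move=> Hf HF; apply: (derivable_pt_lim_comp _ f _ _ _ HF).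
by rewrite upd0.
Qed.

Lemma Partial_coord x i k : Partial (fun x => x k) x i
  (if excluded_middle_informative (k = i) then 1 else 0).
Proof.
rewrite /Partial /upd; case: excluded_middle_informative => h /=.
  have -> : 1 = 0 + 1 by lra.
  by apply: derivable_pt_lim_plus; [exact: derivable_pt_lim_const|exact: derivable_pt_lim_id].
exact: derivable_pt_lim_const.
Qed.

Lemma ContP_const c : ContP (fun _ : I -> R => c).
Proof.
move=> x eps e0; exists 1; split; first lra.
by exists nil => y _; rewrite Rminus_diag Rabs_R0.
Qed.

Lemma ContP_coord k : ContP (fun x : I -> R => x k).
Proof.
by move=> x eps e0; exists eps; split=> //; exists (k :: nil) => y; apply; left.
Qed.

Lemma ContP_comp2 (f : R -> R -> R) F G x eps :
  (exists delta, 0 < delta /\ forall a b, Rabs (a - F x) < delta -> Rabs (b - G x) < delta ->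
     Rabs (f a b - f (F x) (G x)) < eps) -> ContP F -> ContP G ->
  exists delta, 0 < delta /\ exists L : list I,
    forall y, (forall k, In k L -> Rabs (y k - x k) < delta) ->
      Rabs (f (F y) (G y) - f (F x) (G x)) < eps.
Proof.
move=> [d [d0 H]] HF HG.
have [d1 [d10 [L1 H1]]] := HF x d d0; have [d2 [d20 [L2 H2]]] := HG x d d0.
exists (Rmin d1 d2); split; first exact: Rmin_glb_lt.
exists (L1 ++ L2)%list => y Hy; apply: H.
  by apply: H1 => k kL; apply: Rlt_le_trans (Hy k _) (Rmin_l _ _); apply/in_or_app; left.
by apply: H2 => k kL; apply: Rlt_le_trans (Hy k _) (Rmin_r _ _); apply/in_or_app; right.
Qed.

Lemma ContP_add F G : ContP F -> ContP G -> ContP (fun x => F x + G x).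
Proof.
move=> HF HG x eps e0; apply: (ContP_comp2 (f := Rplus)) => //.
exists (eps / 2); split; first lra.
move=> a b h1 h2; have -> : a + b - (F x + G x) = (a - F x) + (b - G x) by lra.
by apply: Rle_lt_trans (Rabs_triang _ _) _; lra.
Qed.

Lemma ContP_mul F G : ContP F -> ContP G -> ContP (fun x => F x * G x).
Proof.
move=> HF HG x eps e0; apply: (ContP_comp2 (f := Rmult)) => //.
pose m := 1 + Rabs (F x) + Rabs (G x).
have m0 : 0 < m by rewrite /m; have := Rabs_pos (F x); have := Rabs_pos (G x); lra.
pose d := Rmin 1 (eps / m / 2).
have em : 0 < eps / m by apply: Rdiv_lt_0_compat.
have d0 : 0 < d by apply: Rmin_glb_lt; lra.
exists d; split=> // a b h1 h2.
have d1 : d <= 1 by exact: Rmin_l.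
have -> : a * b - F x * G x = (a - F x) * (b - G x) + (a - F x) * G x + F x * (b - G x) by lra.
have h3 : Rabs ((a - F x) * (b - G x) + (a - F x) * G x + F x * (b - G x)) <=
  Rabs (a - F x) * Rabs (b - G x) + Rabs (a - F x) * Rabs (G x) + Rabs (F x) * Rabs (b - G x).
  rewrite -!Rabs_mult; apply: Rle_trans (Rabs_triang _ _) _.
  by apply: Rplus_le_compat_r; exact: Rabs_triang.
have pa := Rabs_pos (a - F x); have pb := Rabs_pos (b - G x).
have pF := Rabs_pos (F x); have pG := Rabs_pos (G x).
have h4 : Rabs (a - F x) * Rabs (b - G x) <= d * 1 by apply: Rmult_le_compat; lra.
have h5 : Rabs (a - F x) * Rabs (G x) <= d * Rabs (G x) by apply: Rmult_le_compat_r; lra.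
have h6 : Rabs (F x) * Rabs (b - G x) <= Rabs (F x) * d by apply: Rmult_le_compat_l; lra.
have h7 : d * m <= eps / 2.
  have -> : eps / 2 = eps / m / 2 * m by field; lra.
  by apply: Rmult_le_compat_r; [lra|exact: Rmin_r].
have -> : eps = eps / 2 + eps / 2 by lra.
by move: h7; rewrite /m; lra.
Qed.

Lemma ContP_comp (f : R -> R) F : (forall a, continuity_pt f a) -> ContP F -> ContP (fun x => f (F x)).
Proof.
move=> Hf HF x eps e0.
have [d [d0 Hd]] := Hf (F x) eps e0.
have [d1 [d10 [L H]]] := HF x d d0.
exists d1; split=> //; exists L => y /H h.
have [->|ne] := Req_dec (F y) (F x); first by rewrite Rminus_diag Rabs_R0.
by apply: (Hd (F y)); split=> //; split=> // e; apply: ne.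
Qed.

Definition depends_on F (L : list I) :=
  forall x y, (forall k, In k L -> x k = y k) -> F x = F y.

(** [C2] with its derivatives exhibited, so that their signs and bounds can be followed through sums
    and scalings. *)
Definition C2_with F (D1 : I -> (I -> R) -> R) (D2 : I -> I -> (I -> R) -> R) :=
  (forall x k, Partial F x k (D1 k x)) /\
  (forall x i k, Partial (D1 k) x i (D2 i k x)) /\
  forall i k, ContP (D2 i k).

Lemma C2_withP F : C2 F -> exists D1 D2, C2_with F D1 D2.
Proof.
move=> [H1 H2].
have [D1 HD1] := ClassicalEpsilon.choice _ (fun p : (I -> R) * I => H1 p.1 p.2).
have [D2 HD2] := ClassicalEpsilon.choice _ (fun p : I * I => H2 p.1 p.2).
exists (fun k x => D1 (x, k)), (fun i k => D2 (i, k)); split=> [x k|]; first exact: (HD1 (x, k)).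
split=> [x i k|i k]; last by have [_] := HD2 (i, k).
apply: (Partial2_of (D := fun k x => D1 (x, k))) (proj1 (HD2 (i, k)) x).
by move=> y j; exact: (HD1 (y, j)).
Qed.

Lemma C2_with_C2 F D1 D2 : C2_with F D1 D2 -> C2 F.
Proof.
move=> [H1 [H2 H3]]; split=> [x i|i k]; first by exists (D1 i x).
by exists (D2 i k); split=> // x; exists (D1 k); split.
Qed.

Lemma C2_with_Partial2 F D1 D2 x i k : C2_with F D1 D2 -> Partial2 F x i k (D2 i k x).
Proof. by move=> [H1 [H2 _]]; exists (D1 k); split. Qed.

Lemma C2_with_add F G D1 D2 E1 E2 : C2_with F D1 D2 -> C2_with G E1 E2 ->
  C2_with (fun x => F x + G x) (fun k x => D1 k x + E1 k x) (fun i k x => D2 i k x + E2 i k x).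
Proof.
move=> [a1 [a2 a3]] [b1 [b2 b3]]; split=> [x k|]; first exact: Partial_add.
by split=> [x i k|i k]; [exact: Partial_add|exact: ContP_add].
Qed.

Lemma C2_with_scal c F D1 D2 : C2_with F D1 D2 ->
  C2_with (fun x => c * F x) (fun k x => c * D1 k x) (fun i k x => c * D2 i k x).
Proof.
move=> [a1 [a2 a3]]; split=> [x k|]; first exact: Partial_scal.
split=> [x i k|i k]; first exact: Partial_scal.
by apply: ContP_mul => //; exact: ContP_const.
Qed.

Lemma C2_with_const c : C2_with (fun _ : I -> R => c) (fun _ _ => 0) (fun _ _ _ => 0).
Proof.
by split=> [x k|]; [|split=> [x i k|i k]]; [exact: Partial_const|exact: Partial_const|exact: ContP_const].
Qed.

Lemma C2_add F G : C2 F -> C2 G -> C2 (fun x => F x + G x).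
Proof.
move=> /C2_withP [D1 [D2 H]] /C2_withP [E1 [E2 H']].
exact: C2_with_C2 (C2_with_add H H').
Qed.

Lemma C2_scal c F : C2 F -> C2 (fun x => c * F x).
Proof. by move=> /C2_withP [D1 [D2 H]]; exact: C2_with_C2 (C2_with_scal c H). Qed.

Lemma C2_const c : C2 (fun _ : I -> R => c).
Proof. exact: C2_with_C2 (C2_with_const c). Qed.

(** Finite dependence is what turns continuity of the partial derivatives, for the product topology,
    into genuine differentiability. *)
Definition smooth F := C2 F /\ exists L, depends_on F L.

Lemma smooth_add F G : smooth F -> smooth G -> smooth (fun x => F x + G x).
Proof.
move=> [a [L HL]] [b [L' HL']]; split; first exact: C2_add.
exists (L ++ L')%list => x y H; congr (_ + _).
  by apply: HL => k kL; apply/H/in_or_app; left.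
by apply: HL' => k kL; apply/H/in_or_app; right.
Qed.

Lemma smooth_scal c F : smooth F -> smooth (fun x => c * F x).
Proof.
move=> [a [L HL]]; split; first exact: C2_scal.
by exists L => x y /HL ->.
Qed.

Lemma smooth_const c : smooth (fun _ : I -> R => c).
Proof. by split; [exact: C2_const|exists nil]. Qed.

Lemma smooth_sumL A (F : A -> (I -> R) -> R) (L : list A) :
  (forall a, smooth (F a)) -> smooth (fun x => sumL (fun a => F a x) L).
Proof.
move=> H; elim: L => [|a L IH] /=; first exact: smooth_const.
exact: smooth_add.
Qed.

End Partials.

(** * Relabelling of sites and restriction to a ball *)

Section Relabel.
Variables (I J : Type) (sigma : I -> J).
Hypothesis inj : forall i i', sigma i = sigma i' -> i = i'.

Definition pullb (y : J -> R) : I -> R := fun i => y (sigma i).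

Lemma pullb_upd y i t : pullb (upd y (sigma i) t) = upd (pullb y) i t.
Proof.
apply: functional_extensionality => k; rewrite /pullb /upd.
by do 2 case: excluded_middle_informative => //; [move=> ne /inj|move=> -> ].
Qed.

Lemma pullb_upd_out y j t : (forall i, sigma i <> j) -> pullb (upd y j t) = pullb y.
Proof. by move=> H; apply: functional_extensionality => k; rewrite /pullb upd_other. Qed.

Lemma Partial_pullb (F : (I -> R) -> R) y i l :
  Partial F (pullb y) i l -> Partial (fun y => F (pullb y)) y (sigma i) l.
Proof.
rewrite /Partial; have -> // : (fun t => F (upd (pullb y) i t)) = fun t => F (pullb (upd y (sigma i) t)).
by apply: functional_extensionality => t; rewrite pullb_upd.
Qed.

Lemma Partial_pullb_out (F : (I -> R) -> R) y j :
  (forall i, sigma i <> j) -> Partial (fun y => F (pullb y)) y j 0.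
Proof.
move=> H; rewrite /Partial.
have -> : (fun t => F (pullb (upd y j t))) = fun _ => F (pullb y).
  by apply: functional_extensionality => t; rewrite pullb_upd_out.
exact: derivable_pt_lim_const.
Qed.

Lemma ContP_pullb (F : (I -> R) -> R) : ContP F -> ContP (fun y => F (pullb y)).
Proof.
move=> H y eps e0; have [d [d0 [L HL]]] := H (pullb y) eps e0.
exists d; split=> //; exists (List.map sigma L) => z Hz; apply: HL => k kL.
by apply: Hz; apply: in_map.
Qed.

Lemma C2_pullb (F : (I -> R) -> R) : C2 F -> C2 (fun y => F (pullb y)).
Proof.
move=> /C2_withP [D1 [D2 [H1 [H2 H3]]]].
have dec (j : J) : (exists i, sigma i = j) \/ forall i, sigma i <> j.
  by case: (classic (exists i, sigma i = j)) => h; [left|right=> i e; apply: h; exists i].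
split=> [x j|j1 j2].
  have [[i <-]|out] := dec j; first by exists (D1 i (pullb x)); exact: Partial_pullb.
  by exists 0; exact: Partial_pullb_out.
have [[i2 <-]|out] := dec j2; last first.
  exists (fun _ => 0); split; last exact: ContP_const.
  move=> x; exists (fun _ => 0); split; last exact: Partial_const.
  by move=> y; exact: Partial_pullb_out.
have [[i1 <-]|out] := dec j1.
  exists (fun y => D2 i1 i2 (pullb y)); split; last exact: ContP_pullb.
  move=> x; exists (fun y => D1 i2 (pullb y)); split=> [y|]; exact: Partial_pullb.
exists (fun _ => 0); split; last exact: ContP_const.
move=> x; exists (fun y => D1 i2 (pullb y)); split; first by move=> y; exact: Partial_pullb.
exact: Partial_pullb_out.
Qed.

Lemma smooth_pullb (F : (I -> R) -> R) : smooth F -> smooth (fun y => F (pullb y)).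
Proof.
move=> [a [L HL]]; split; first exact: C2_pullb.
by exists (List.map sigma L) => x y H; apply: HL => k kL; apply: H; apply: in_map.
Qed.

End Relabel.

Section Extension.
Variables (J : Type) (P : J -> Prop).

(** Restriction to [P] undoes this extension, so a potential that ignores the sites outside [P] can
    be read as a function on restricted configurations. *)
Definition extend0 (y : sig P -> R) (k : J) : R :=
  match excluded_middle_informative (P k) with left h => y (exist _ k h) | right _ => 0 end.

Lemma extend0_in y k (h : P k) : extend0 y k = y (exist _ k h).
Proof.
rewrite /extend0; case: excluded_middle_informative => // h'.
by rewrite (proof_irrelevance _ h' h).
Qed.

Lemma extend0_upd y i t : extend0 (upd y i t) = upd (extend0 y) (proj1_sig i) t.
Proof.
apply: functional_extensionality => k.
have [[h ->]|ne] : {h : P k & i = exist _ k h} + {proj1_sig i <> k}.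
- case: (excluded_middle_informative (proj1_sig i = k)) => e; [left|by right].
  by case: i e => k' h /= e; move: h; rewrite e => h; exists h.
- by rewrite /= upd_same !extend0_in upd_same.
rewrite upd_other; last by move=> e; apply: ne.
rewrite /extend0; case: excluded_middle_informative => // h.
by rewrite upd_other // => e; apply: ne; rewrite -e.
Qed.

Lemma C2_extend0 (F : (J -> R) -> R) : C2 F -> C2 (fun y => F (extend0 y)).
Proof.
move=> /C2_withP [D1 [D2 [H1 [H2 H3]]]].
have PP G x (i : sig P) l : Partial G (extend0 x) (proj1_sig i) l ->
    Partial (fun y => G (extend0 y)) x i l.
  rewrite /Partial; have -> // : (fun t => G (upd (extend0 x) (proj1_sig i) t)) =
    fun t => G (extend0 (upd x i t)).
  by apply: functional_extensionality => t; rewrite extend0_upd.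
apply: (C2_with_C2 (D1 := fun i y => D1 (proj1_sig i) (extend0 y))
                   (D2 := fun i k y => D2 (proj1_sig i) (proj1_sig k) (extend0 y))).
split=> [x k|]; first exact: PP.
split=> [x i k|i k x eps e0]; first exact: (PP (D1 (proj1_sig k))).
have [d [d0 [L HL]]] := H3 (proj1_sig i) (proj1_sig k) (extend0 x) eps e0.
exists d; split=> //.
have [L' HL'] : exists L' : list (sig P), forall k (h : P k), In k L -> In (exist _ k h) L'.
  elim: (L) => [|a l [L' IH]]; first by exists nil.
  case: (excluded_middle_informative (P a)) => ha.
    exists (exist _ a ha :: L') => j h /= [e|/IH]; last by right.
    by left; subst j; rewrite (proof_irrelevance _ h ha).
  by exists L' => j h /= [e|/IH //]; subst j.
exists L' => y Hy; apply: HL => j jL; rewrite /extend0.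
case: excluded_middle_informative => h; first by apply: Hy; exact: HL'.
by rewrite Rminus_diag Rabs_R0.
Qed.

End Extension.

Lemma fin_case d (P : Fin.t d.+1 -> Prop) : P Fin.F1 -> (forall m, P (Fin.FS m)) -> forall m, P m.
Proof. by move=> h1 h2 m; exact: (Fin.caseS' m P). Qed.

Lemma fsumZ_ge d (f : Fin.t d -> Z) : (forall m, (0 <= f m)%Z) -> forall m, (f m <= fsumZ d f)%Z.
Proof.
elim: d f => [|d IH] f Hf m; first by inversion m.
have H0 : (0 <= fsumZ d (fun m => f (Fin.FS m)))%Z.
  elim: d f Hf {IH m} => [|d IH] f Hf /=; first lia.
  have := Hf (Fin.FS Fin.F1); have := IH (fun m => f (Fin.FS m)) (fun m => Hf (Fin.FS m)); rewrite /=; lia.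
rewrite /=; move: m; apply: fin_case => [|m]; first by lia.
have := IH (fun m => f (Fin.FS m)) (fun m => Hf (Fin.FS m)) m; have := Hf Fin.F1; lia.
Qed.

Lemma finite_box d (M : nat) :
  exists L : list (site d), forall k : site d, (forall m, (Z.abs (k m) <= Z.of_nat M)%Z) -> In k L.
Proof.
elim: d => [|d [L IH]].
  exists ((fun _ => 0%Z) :: nil) => k _; left.
  by apply: functional_extensionality => m; inversion m.
pose cons z (k : site d) : site d.+1 := fun m => Fin.caseS' m (fun _ => Z) z k.
pose rng := List.map (fun i => (Z.of_nat i - Z.of_nat M)%Z) (List.seq 0 (Nat.add (Nat.add M M) 1)).
exists (List.flat_map (fun z => List.map (cons z) L) rng) => k Hk.
apply/in_flat_map; exists (k Fin.F1); split.
  apply/in_map_iff; exists (Z.to_nat (k Fin.F1 + Z.of_nat M)); have := Hk Fin.F1 => h.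
  by split; [|apply/in_seq]; move: (k Fin.F1) h => a h; lia.
apply/in_map_iff; exists (fun m => k (Fin.FS m)); split; last by apply: IH => m; exact: Hk.
by apply: functional_extensionality; apply: fin_case.
Qed.

Lemma finite_ball d (j : site d) r :
  exists L : list (site d), forall k, IZR (snorm (ssub k j)) <= r -> In k L.
Proof.
pose M := Z.to_nat (up r).
have [L HL] := finite_box d M.
exists (List.map (fun k => sadd k j) L) => k Hk; apply/in_map_iff; exists (ssub k j); split.
  by apply: functional_extensionality => m; rewrite /sadd /ssub; lia.
apply: HL => m; have h : (snorm (ssub k j) <= up r)%Z.
  apply: le_IZR; have [? _] := archimed r; lra.
have := @fsumZ_ge d (fun m => Z.abs (ssub k j m)) (fun m => Z.abs_nonneg _) m.
rewrite -/(snorm (ssub k j)) /M; lia.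
Qed.

Definition depends_ball d (F : config d -> R) (j : site d) r :=
  forall x y : config d, (forall k, IZR (snorm (ssub k j)) <= r -> x k = y k) -> F x = F y.

(** Removes the auxiliary [s] on each ball: it is pulled back along the inclusion in one direction
    and recovered through extension by zero in the other. *)
Lemma condA_iff d (S : Pot d) r :
  condA S r <-> 0 < r /\ forall j, C2 (S j) /\ depends_ball (S j) j r.
Proof.
split=> -[r0 H]; split=> // j.
  have [s [Hs e]] := H j; split.
    have -> : S j = fun x => s (pullb (@proj1_sig _ _) x) by apply: functional_extensionality.
    apply: C2_pullb => // -[i hi] [k hk] /= eik; subst k.
    by rewrite (proof_irrelevance _ hi hk).
  move=> x y Hxy; rewrite !e; congr s; apply: functional_extensionality => -[k hk] /=.
  exact: Hxy.
have [HC HD] := H j.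
exists (fun y => S j (extend0 y)); split; first exact: C2_extend0.
move=> x; apply: HD => k hk; by rewrite extend0_in.
Qed.

Lemma smooth_of_ball d (F : config d -> R) j r : C2 F -> depends_ball F j r -> smooth F.
Proof.
move=> HF HD; split=> //; have [L HL] := finite_ball j r.
by exists L => x y Hxy; apply: HD => k /HL; exact: Hxy.
Qed.

Lemma sumL_ext A (f g : A -> R) (L : list A) : (forall a, In a L -> f a = g a) -> sumL f L = sumL g L.
Proof.
elim: L => [|a L IH] //= H; rewrite H ?IH //; last by left.
by move=> b bL; apply: H; right.
Qed.

Lemma sumL_le A (f g : A -> R) (L : list A) : (forall a, In a L -> f a <= g a) -> sumL f L <= sumL g L.
Proof.
elim: L => [|a L IH] /= H; first by lra.
have := H a (or_introl (erefl _)); have := IH (fun b bL => H b (or_intror bL)); lra.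
Qed.

Lemma sumL_const A c (L : list A) : sumL (fun _ => c) L = INR (length L) * c.
Proof. by elim: L => [|a L IH]; rewrite ?[length _]/= ?S_INR /= ?IH; lra. Qed.

Lemma sumL_add A (f g : A -> R) (L : list A) : sumL (fun a => f a + g a) L = sumL f L + sumL g L.
Proof. by elim: L => [|a L IH] /=; rewrite ?IH; lra. Qed.

Lemma sumL_scal A c (f : A -> R) (L : list A) : sumL (fun a => c * f a) L = c * sumL f L.
Proof. by elim: L => [|a L IH] /=; rewrite ?IH; lra. Qed.

Lemma Rabs_sumL A (f : A -> R) (L : list A) : Rabs (sumL f L) <= sumL (fun a => Rabs (f a)) L.
Proof.
elim: L => [|a L IH] /=; first by rewrite Rabs_R0; lra.
by apply: Rle_trans (Rabs_triang _ _) _; lra.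
Qed.

(** * Differentiability from continuous partial derivatives *)

Section Strict.
Variable I : Type.
Implicit Types (F : (I -> R) -> R) (x y z : I -> R) (L : list I).

Lemma partial_mvt F (D : (I -> R) -> R) k : (forall x, Partial F x k (D x)) ->
  forall x t, exists s, Rmin 0 t <= s <= Rmax 0 t /\ F (upd x k t) - F x = D (upd x k s) * t.
Proof.
move=> HD x t.
have der s : derivable_pt_lim (fun t => F (upd x k t)) s (D (upd x k s)).
  move=> eps e0; have [d Hd] := HD (upd x k s) eps e0.
  exists d => h h0 hd; have := Hd h h0 hd.
  by rewrite !upd_upd Rplus_0_l Rplus_0_r.
have [s [Hs e]] := Derive.MVT_gen (fun t => F (upd x k t)) 0 t (fun s => D (upd x k s))
  (fun s _ => proj2 (Derive.is_derive_Reals _ _ _) (der s))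
  (fun s _ => derivable_continuous_pt _ _ (exist _ _ (der s))).
by exists s; split=> //; move: e; rewrite upd0 Rminus_0_r.
Qed.

Lemma depends_on_partial F (D : I -> (I -> R) -> R) L :
  (forall x k, Partial F x k (D k x)) -> depends_on F L -> forall k, depends_on (D k) L.
Proof.
move=> HD HF k x y Hxy; apply: (Partial_uniq (HD x k)).
rewrite /Partial; have -> : (fun t => F (upd x k t)) = fun t => F (upd y k t); last exact: HD.
apply: functional_extensionality => t; apply: HF => j jL; rewrite /upd.
by rewrite Hxy.
Qed.

Lemma depends_on_partial0 F (D : I -> (I -> R) -> R) L :
  (forall x k, Partial F x k (D k x)) -> depends_on F L -> forall k x, ~ In k L -> D k x = 0.
Proof.
move=> HD HF k x kL; apply: (Partial_uniq (HD x k)).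
rewrite /Partial; have -> : (fun t => F (upd x k t)) = fun _ => F x; last exact: derivable_pt_lim_const.
apply: functional_extensionality => t; apply: HF => j jL; rewrite upd_other // => e.
by apply: kL; rewrite -e.
Qed.

Lemma strict_diff F (D : I -> (I -> R) -> R) L : NoDup L -> depends_on F L ->
  (forall x k, Partial F x k (D k x)) -> (forall k, ContP (D k)) ->
  forall x eps, 0 < eps -> exists delta, 0 < delta /\ forall y z h, 0 <= h ->
    (forall k, In k L -> Rabs (y k - x k) <= delta) ->
    (forall k, In k L -> Rabs (z k - x k) <= delta) ->
    (forall k, In k L -> Rabs (z k - y k) <= h) ->
    Rabs (F z - F y - sumL (fun k => D k x * (z k - y k)) L) <= eps * h.
Proof.
move=> nd dep HD HC x eps e0.
have n0 : 0 < INR (length L) + 1 by have := pos_INR (length L); lra.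
pose e1 := eps / (INR (length L) + 1).
have e10 : 0 < e1 by apply: Rdiv_lt_0_compat.
have [d [d0 Hd]] : exists d, 0 < d /\ forall w, (forall j, Rabs (w j - x j) <= d) ->
    forall k, In k L -> Rabs (D k w - D k x) <= e1.
  elim: (L) => [|k l [d [d0 IH]]]; first by exists 1; split=> //; lra.
  have [d' [d'0 [L' H']]] := HC k x e1 e10.
  exists (Rmin d (d' / 2)); split; first by apply: Rmin_glb_lt; lra.
  move=> w Hw j /= [<-|jl].
    apply: Rlt_le; apply: H' => i _; have := Hw i; have := Rmin_r d (d' / 2); lra.
  by apply: IH jl => i; apply: Rle_trans (Hw i) (Rmin_l _ _).
exists d; split=> // y z h h0 Hy Hz Hzy.
(* Coordinates outside [L] are frozen at [x]: closeness is assumed on [L] only, while the bound on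
   [D] asks for it at every site. *)
pose cut (w : I -> R) (j : I) := if excluded_middle_informative (In j L) then w j else x j.
have cutin w j : In j L -> cut w j = w j.
  by move=> jL; rewrite /cut; case: excluded_middle_informative.
have cutout w j : ~ In j L -> cut w j = x j.
  by move=> jL; rewrite /cut; case: excluded_middle_informative.
have -> : F z = F (cut z) by apply: dep => k kL; rewrite cutin.
have -> : F y = F (cut y) by apply: dep => k kL; rewrite cutin.
have -> : sumL (fun k => D k x * (z k - y k)) L = sumL (fun k => D k x * (cut z k - cut y k)) L.
  by apply: sumL_ext => k kL; rewrite !cutin.
have near w : (forall k, In k L -> Rabs (w k - x k) <= d) -> forall k, Rabs (cut w k - x k) <= d.
  move=> Hw k; case: (classic (In k L)) => kL; first by rewrite cutin //; exact: Hw.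
  by rewrite cutout // Rminus_diag Rabs_R0; lra.
have gen : forall L' y z, (forall k, In k L' -> In k L) -> NoDup L' ->
    (forall k, Rabs (y k - x k) <= d) -> (forall k, Rabs (z k - x k) <= d) ->
    (forall k, In k L' -> Rabs (z k - y k) <= h) -> (forall k, ~ In k L' -> z k = y k) ->
    Rabs (F z - F y - sumL (fun k => D k x * (z k - y k)) L') <= INR (length L') * (e1 * h).
  elim=> [|k L' IH] {Hy Hz Hzy}y {}z sub nd' Hy Hz Hzy off.
    have -> : z = y by apply: functional_extensionality => k; exact: off.
    by rewrite /= !Rminus_diag Rabs_R0; lra.
  have kL' : ~ In k L' by move/NoDup_cons_iff: nd' => [].
  have nd'' : NoDup L' by move/NoDup_cons_iff: nd' => [].
  pose w := upd y k (z k - y k).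
  have wk : w k = z k by rewrite /w upd_same; lra.
  have wo j : j <> k -> w j = y j by move=> ne; rewrite /w upd_other.
  have Hw j : Rabs (w j - x j) <= d.
    by case: (classic (j = k)) => [->|ne]; [rewrite wk|rewrite wo].
  have h1 : Rabs (F z - F w - sumL (fun j => D j x * (z j - w j)) L') <= INR (length L') * (e1 * h).
    apply: IH => //; first by move=> j jL; apply: sub; right.
      move=> j jL; rewrite wo; first by apply: Hzy; right.
      by move=> e; apply: kL'; rewrite -e.
    move=> j jL; case: (classic (j = k)) => [->|ne]; first by rewrite wk.
    by rewrite wo //; apply: off => /= -[e|//]; apply: ne.
  have [s [Hs Fs]] := partial_mvt (fun x => HD x k) y (z k - y k).
  rewrite -/w in Fs.
  have h2 : Rabs (D k (upd y k s) - D k x) <= e1.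
    apply: Hd; last by apply: sub; left.
    move=> j; case: (classic (j = k)) => [->|ne]; last by rewrite upd_other.
    rewrite upd_same; move: (Rabs_le_elim (Hy k)) (Rabs_le_elim (Hz k)) Hs.
    by rewrite /Rmin /Rmax; case: Rle_dec => _ *; apply: Rabs_le; lra.
  have h3 : sumL (fun j => D j x * (z j - y j)) L' = sumL (fun j => D j x * (z j - w j)) L'.
    by apply: sumL_ext => j jL; rewrite wo // => e; apply: kL'; rewrite -e.
  rewrite [sumL _ _]/= h3 [length _]/= S_INR.
  have -> : F z - F y - (D k x * (z k - y k) + sumL (fun j => D j x * (z j - w j)) L') =
    (F z - F w - sumL (fun j => D j x * (z j - w j)) L') +
    (D k (upd y k s) - D k x) * (z k - y k) by lra.
  apply: Rle_trans (Rabs_triang _ _) _; rewrite Rabs_mult.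
  have := Rmult_le_compat _ _ _ _ (Rabs_pos _) (Rabs_pos _) h2 (Hzy k (or_introl (erefl _))); lra.
apply: Rle_trans (gen L _ _ _ nd (near y Hy) (near z Hz) _ _) _ => //.
- by move=> k kL; rewrite !cutin //; exact: Hzy.
- by move=> k kL; rewrite !cutout.
have -> : eps * h = (INR (length L) + 1) * (e1 * h) by rewrite /e1; field; lra.
have := Rmult_le_pos _ _ (Rlt_le _ _ e10) h0; lra.
Qed.

End Strict.

(** * Passage to finitely many coordinates *)

Lemma nodup_list I (L : list I) : exists L', NoDup L' /\ forall k, In k L <-> In k L'.
Proof.
elim: L => [|k L [L' [nd H]]]; first by exists nil; split; [constructor|].
case: (classic (In k L')) => kL'.
  by exists L'; split=> // j; split=> [[<-//|/H//]|/H jL]; right.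
by exists (k :: L'); split; [constructor|move=> j; split=> -[->|/H h]; [left|right|left|right]].
Qed.

(** Serves for the first derivatives, since [C2_with] records continuity of the second ones only. *)
Lemma ContP_of_partials I (F : (I -> R) -> R) D L : NoDup L -> depends_on F L ->
  (forall x k, Partial F x k (D k x)) -> (forall k, ContP (D k)) -> ContP F.
Proof.
move=> nd dep HD HC x eps e0.
have [d [d0 H]] := strict_diff nd dep HD HC x Rlt_0_1.
pose B := sumL (fun k => Rabs (D k x)) L.
have B0 : 0 <= B.
  by have := sumL_le (fun a (_ : In a L) => Rabs_pos (D a x)); rewrite sumL_const -/B; lra.
pose h := Rmin d (eps / (2 * (1 + B))).
have h0 : 0 < h by apply: Rmin_glb_lt => //; apply: Rdiv_lt_0_compat; lra.
exists h; split=> //; exists L => z Hz.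
have hd : h <= d by exact: Rmin_l.
have := H x z h (Rlt_le _ _ h0).
have near k : In k L -> Rabs (z k - x k) <= d by move=> /Hz; lra.
have self k : In k L -> Rabs (x k - x k) <= d by move=> _; rewrite Rminus_diag Rabs_R0; lra.
move=> /(_ self near (fun k kL => Rlt_le _ _ (Hz k kL))).
set s := sumL _ _ => h1.
have h2 : Rabs s <= B * h.
  apply: Rle_trans (Rabs_sumL _ _) _; rewrite /B [_ * h]Rmult_comm -sumL_scal.
  apply: sumL_le => k kL; rewrite Rabs_mult Rmult_comm; apply: Rmult_le_compat_r; first exact: Rabs_pos.
  exact: Rlt_le (Hz k kL).
have h3 : (1 + B) * h <= eps / 2.
  have -> : eps / 2 = (1 + B) * (eps / (2 * (1 + B))) by field; lra.
  by apply: Rmult_le_compat_l; [lra|exact: Rmin_r].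
have -> : F z - F x = (F z - F x - s) + s by lra.
by apply: Rle_lt_trans (Rabs_triang _ _) _; lra.
Qed.

Lemma ContP_sumL I A (F : A -> (I -> R) -> R) (L : list A) :
  (forall a, ContP (F a)) -> ContP (fun x => sumL (fun a => F a x) L).
Proof.
by move=> H; elim: L => [|a L IH] /=; [exact: ContP_const|exact: ContP_add].
Qed.

Section Coordinates.
Variables (N' : nat) (I : Type).
Let N := N'.+1.
Variables (cls : I -> 'I_N) (o : I -> R).
Implicit Types (y z v w : 'I_N -> R).

(** Coordinates on [X_{p,q}]: [cls] will be the class of a site modulo periods, and [o] the fixed
    difference between the values at a site and at the representative of its class. *)
Definition affine y : I -> R := fun k => y (cls k) + o k.

Lemma ContP_continuous_at (g : ('I_N -> R) -> R) y : ContP g -> continuous_at g y.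
Proof.
move=> H eps e0; have [d [d0 [L HL]]] := H y eps e0.
exists (d / 2); split; first lra.
move=> z Hz; apply: Rlt_le; apply: HL => k _; have := Hz k; lra.
Qed.

Lemma ContP_affine (F : (I -> R) -> R) : ContP F -> ContP (fun y => F (affine y)).
Proof.
move=> H y eps e0; have [d [d0 [L HL]]] := H (affine y) eps e0.
exists d; split=> //; exists (List.map cls L) => z Hz; apply: HL => k kL.
have -> : affine z k - affine y k = z (cls k) - y (cls k) by rewrite /affine; lra.
by apply: Hz; apply: in_map.
Qed.

Lemma strictly_differentiable_add (f g : ('I_N -> R) -> R) F G :
  strictly_differentiable f F -> strictly_differentiable g G ->
  strictly_differentiable (fun y => f y + g y) (fun c y => F c y + G c y).
Proof.
move=> Hf Hg y eps e0.
have e2 : 0 < eps / 2 by lra.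
have [d [d0 H]] := Hf y _ e2; have [d' [d'0 H']] := Hg y _ e2.
exists (Rmin d d'); split; first exact: Rmin_glb_lt.
move=> z z' h /Close_le hz /Close_le hz' hh.
have h1 := H z z' h (hz _ (Rmin_l _ _)) (hz' _ (Rmin_l _ _)) hh.
have h2 := H' z z' h (hz _ (Rmin_r _ _)) (hz' _ (Rmin_r _ _)) hh.
have -> : \sum_c (F c y + G c y) * (z' c - z c) =
  \sum_c F c y * (z' c - z c) + \sum_c G c y * (z' c - z c).
  by rewrite -rsumD; apply: eq_bigr => c _; lra.
move: h1 h2 => /Rabs_le_elim ? /Rabs_le_elim ?; apply: Rabs_le; lra.
Qed.

Lemma strictly_differentiable_const a :
  strictly_differentiable (fun _ : 'I_N -> R => a) (fun _ _ => 0).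
Proof.
move=> y eps e0; exists 1; split; first lra.
move=> z z' h _ _ hh.
have -> : \sum_c 0 * (z' c - z c) = 0.
  by rewrite -[RHS](@rsum0 'I_N); apply: eq_bigr => c _; lra.
rewrite !Rminus_diag Rabs_R0; apply: Rmult_le_pos; first lra.
by apply: Rle_trans (hh ord0); exact: Rabs_pos.
Qed.

Lemma strictly_differentiable_sumL A (f : A -> ('I_N -> R) -> R) F (L : list A) :
  (forall a, strictly_differentiable (f a) (F a)) ->
  strictly_differentiable (fun y => sumL (fun a => f a y) L)
    (fun c y => sumL (fun a => F a c y) L).
Proof.
move=> H; elim: L => [|a L IH] /=; first exact: strictly_differentiable_const.
exact: strictly_differentiable_add.
Qed.

Lemma sumL_classes (f : I -> R) v L :
  \sum_c sumL (fun k => if cls k == c then f k else 0) L * v c = sumL (fun k => f k * v (cls k)) L.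
Proof.
elim: L => [|k L IH] /=; first by rewrite -[RHS](@rsum0 'I_N); apply: eq_bigr => c _; lra.
rewrite -IH; set T := \sum_c _ * _ in IH *.
transitivity (\sum_c ((if cls k == c then f k else 0) * v c +
   sumL (fun k => if cls k == c then f k else 0) L * v c)); first by apply: eq_bigr => c _; lra.
rewrite rsumD -/T (@rsum_pick _ _ (cls k)) ?eqxx //.
by move=> c; rewrite eq_sym => /negbTE ->; lra.
Qed.

Lemma strictly_differentiable_affine (F : (I -> R) -> R) D L : NoDup L -> depends_on F L ->
  (forall x k, Partial F x k (D k x)) -> (forall k, ContP (D k)) ->
  strictly_differentiable (fun y => F (affine y))
    (fun c y => sumL (fun k => if cls k == c then D k (affine y) else 0) L).
Proof.
move=> nd dep HD HC y eps e0.
have [d [d0 H]] := strict_diff nd dep HD HC (affine y) e0.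
exists d; split=> // z z' h hz hz' hh.
have h0 : 0 <= h by apply: Rle_trans (hh ord0); exact: Rabs_pos.
have aff w w' k : affine w k - affine w' k = w (cls k) - w' (cls k) by rewrite /affine; lra.
rewrite sumL_classes.
have := H (affine z) (affine z') h h0.
have -> : sumL (fun k => D k (affine y) * (affine z' k - affine z k)) L =
  sumL (fun k => D k (affine y) * (z' (cls k) - z (cls k))) L.
  by apply: sumL_ext => k _; rewrite aff.
by apply=> k _; rewrite aff; [exact: hz|exact: hz'|exact: hh].
Qed.

Lemma strictly_differentiable_dir g G y v : strictly_differentiable g G ->
  derivable_pt_lim (fun t => g (fun c => y c + t * v c)) 0 (\sum_c G c y * v c).
Proof.
move=> H eps e0.
have [B [B0 HB]] := finite_bound v.
have [d [d0 Hd]] := H y (eps / (2 * B)) (ltac:(apply: Rdiv_lt_0_compat; lra)).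
have dB : 0 < d / B by apply: Rdiv_lt_0_compat.
exists (mkposreal _ dB) => t t0 /= ht; rewrite Rplus_0_l.
have y0 : (fun c => y c + 0 * v c) = y by apply: functional_extensionality => c; lra.
rewrite y0; have at0 : 0 < Rabs t by exact: Rabs_pos_lt.
have st : Close y (fun c => y c + t * v c) (Rabs t * B).
  move=> c; have -> : y c + t * v c - y c = t * v c by lra.
  by rewrite Rabs_mult; apply: Rmult_le_compat_l; [lra|exact: HB].
have tB : Rabs t * B <= d.
  have -> : d = d / B * B by field; lra.
  by apply: Rmult_le_compat_r; lra.
have := Hd _ _ _ (Close_refl y (Rlt_le _ _ d0)) (Close_le st tB) st.
have -> : \sum_c G c y * (y c + t * v c - y c) = t * \sum_c G c y * v c.
  by rewrite -rsumZ; apply: eq_bigr => c _; lra.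
have -> : eps / (2 * B) * (Rabs t * B) = eps / 2 * Rabs t by field; lra.
set s := \sum_c _ => h1.
have -> : (g (fun c => y c + t * v c) - g y) / t - s = (g (fun c => y c + t * v c) - g y - t * s) / t.
  by field.
rewrite /Rdiv Rabs_mult Rabs_inv; apply: (Rmult_lt_reg_r (Rabs t)) => //.
rewrite Rmult_assoc Rinv_l ?Rmult_1_r; last lra.
by apply: Rle_lt_trans h1 _; have := Rmult_lt_0_compat _ _ e0 at0; lra.
Qed.

(** Chain rule along [affine]: gradient and Hessian in class coordinates collect partial derivatives
    over the sites of a class. They are the data [u], [U] of the transversality argument. *)
Lemma smooth_coordinates (F : (I -> R) -> R) : smooth F -> exists u U,
  (forall b, strictly_differentiable (u b) (U b)) /\
  (forall b c y, continuous_at (U b c) y) /\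
  forall y v, derivable_pt_lim (fun t => F (affine (fun c => y c + t * v c))) 0 (\sum_b v b * u b y).
Proof.
move=> [/C2_withP [D1 [D2 [H1 [H2 H3]]]] [L0 dep0]].
have [L [nd HL]] := nodup_list L0.
have dep : depends_on F L by move=> x y Hxy; apply: dep0 => k /HL; exact: Hxy.
have dep1 k : depends_on (D1 k) L by exact: (depends_on_partial H1 dep).
have cont1 k : ContP (D1 k).
  by apply: (ContP_of_partials nd (dep1 k)) => [x i|i]; [exact: H2|exact: H3].
exists (fun b y => sumL (fun k => if cls k == b then D1 k (affine y) else 0) L).
exists (fun b c y => sumL (fun k => if cls k == b then
   sumL (fun i => if cls i == c then D2 i k (affine y) else 0) L else 0) L).
split=> [b|].
  apply: (@strictly_differentiable_sumL _ (fun k y => if cls k == b then D1 k (affine y) else 0)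
    (fun k c y => if cls k == b then
      sumL (fun i => if cls i == c then D2 i k (affine y) else 0) L else 0)) => k.
  case: (cls k == b); last exact: strictly_differentiable_const.
  exact: (@strictly_differentiable_affine (D1 k) (fun i => D2 i k)).
split=> [b c y|y v].
  apply: ContP_continuous_at.
  apply: (@ContP_sumL _ _ (fun k y => if cls k == b then
    sumL (fun i => if cls i == c then D2 i k (affine y) else 0) L else 0)) => k.
  case: (cls k == b); last exact: ContP_const.
  apply: (@ContP_sumL _ _ (fun i y => if cls i == c then D2 i k (affine y) else 0)) => i.
  by case: (cls i == c); [exact: ContP_affine|exact: ContP_const].
have := strictly_differentiable_dir y v (strictly_differentiable_affine nd dep H1 cont1).
congr (derivable_pt_lim _ _ _); apply: eq_bigr => c _; lra.
Qed.

End Coordinates.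

(** * The perturbing potentials *)

Lemma exp_le_mono x y : x <= y -> exp x <= exp y.
Proof. by case=> [/exp_increasing|->]; lra. Qed.

(** From [1 + s <= m * exp (s / m)] with [m = n + 1], raised to the power [n]; taking [n + 1]
    instead of [n] avoids a division by 0. *)
Lemma one_plus_pow_exp (n : nat) : exists C, 0 < C /\ forall s, 0 <= s -> (1 + s) ^ n * exp (- s) <= C.
Proof.
have m0 : 0 < INR n + 1 by have := pos_INR n; lra.
exists ((INR n + 1) ^ n); split=> [|s s0]; first exact: pow_lt.
have expn x k : exp x ^ k = exp (INR k * x).
  elim: k => [|k IH]; first by rewrite Rmult_0_l exp_0.
  by rewrite -tech_pow_Rmult IH S_INR -exp_plus; congr exp; lra.
have h1 : (1 + s) ^ n <= ((INR n + 1) * exp (s / (INR n + 1))) ^ n.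
  apply: pow_incr; split; first lra.
  have := exp_ineq1_le (s / (INR n + 1)) => /(Rmult_le_compat_l _ _ _ (Rlt_le _ _ m0)).
  have -> : (INR n + 1) * (1 + s / (INR n + 1)) = INR n + 1 + s by field; lra.
  have := pos_INR n; lra.
have h2 : exp (s / (INR n + 1)) ^ n <= exp s.
  rewrite expn; apply: exp_le_mono; have -> : s = (INR n + 1) * (s / (INR n + 1)) by field; lra.
  have -> : (INR n + 1) * (s / (INR n + 1)) / (INR n + 1) = s / (INR n + 1) by field; lra.
  by apply: Rmult_le_compat_r; [apply: Rle_mult_inv_pos; lra|lra].
rewrite Rpow_mult_distr in h1.
have p0 : 0 < (INR n + 1) ^ n by exact: pow_lt.
have h3 : (1 + s) ^ n <= (INR n + 1) ^ n * exp s.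
  by apply: Rle_trans h1 _; apply: Rmult_le_compat_l; lra.
have := Rmult_le_compat_r _ _ _ (Rlt_le _ _ (exp_pos (- s))) h3.
by rewrite Rmult_assoc -exp_plus Rplus_opp_r exp_0 Rmult_1_r.
Qed.

Section Gaussian.
Variables (d : nat) (l : list (site d)).
Hypothesis l0 : In szero l.

Definition spread (x : config d) := sumL (fun k => (x k - x szero) * (x k - x szero)) l.

(** An algebra invariant under integer shifts, stable under partial derivatives and of polynomial
    growth in [spread]; multiplied by the Gaussian, its elements have bounded derivatives of the
    same form. *)
Inductive pol : (config d -> R) -> Prop :=
| pol_const c : pol (fun _ => c)
| pol_cos : pol (fun x => cos (2 * PI * x szero))
| pol_sin : pol (fun x => sin (2 * PI * x szero))
| pol_diff k : In k l -> pol (fun x => x k - x szero)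
| pol_add F G : pol F -> pol G -> pol (fun x => F x + G x)
| pol_mul F G : pol F -> pol G -> pol (fun x => F x * G x).

Lemma pol_sumL A (F : A -> config d -> R) L :
  (forall a, In a L -> pol (F a)) -> pol (fun x => sumL (fun a => F a x) L).
Proof.
elim: L => [|a L IH] H /=; first exact: pol_const.
by apply: pol_add; [apply: H; left|apply: IH => b bL; apply: H; right].
Qed.

Lemma pol_spread : pol spread.
Proof. by apply: pol_sumL => k kl; apply: pol_mul; exact: pol_diff. Qed.

Lemma spread_ge0 x : 0 <= spread x.
Proof.
have := @sumL_le _ (fun _ => 0) (fun k => (x k - x szero) * (x k - x szero)) l.
by rewrite sumL_const Rmult_0_r; apply=> a _; exact: Rle_0_sqr.
Qed.

Lemma spread_ge k x : In k l -> (x k - x szero) * (x k - x szero) <= spread x.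
Proof.
rewrite /spread; elim: (l) => [|j L IH] //= [->|/IH h].
  have := @sumL_le _ (fun _ => 0) (fun k => (x k - x szero) * (x k - x szero)) L.
  rewrite sumL_const Rmult_0_r => /(_ (fun a _ => Rle_0_sqr (x a - x szero))); lra.
have := Rle_0_sqr (x j - x szero); rewrite /Rsqr; lra.
Qed.

Lemma pol_partial F : pol F -> forall k, exists F', pol F' /\ forall x, Partial F x k (F' x).
Proof.
have scal a : derivable_pt_lim (fun y => 2 * PI * y) a (2 * PI).
  have := derivable_pt_lim_scal id (2 * PI) a 1 (derivable_pt_lim_id a); by rewrite Rmult_1_r.
elim=> {F} [c|||j jl|F G _ IF _ IG|F G pF IF pG IG] k.
- by exists (fun _ => 0); split; [exact: pol_const|move=> x; exact: Partial_const].
- exists (fun x => - sin (2 * PI * x szero) * (2 * PI) *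
     (if excluded_middle_informative (szero = k) then 1 else 0)); split.
    have -> : (fun x : config d => - sin (2 * PI * x szero) * (2 * PI) *
     (if excluded_middle_informative (szero = k) then 1 else 0)) = fun x => (- (2 * PI) *
     (if excluded_middle_informative (szero = k) then 1 else 0)) * sin (2 * PI * x szero).
      by apply: functional_extensionality => x; lra.
    by apply: pol_mul; [exact: pol_const|exact: pol_sin].
  move=> x; apply: (Partial_comp (f := fun a => cos (2 * PI * a)) _ (Partial_coord x k szero)).
  exact: (derivable_pt_lim_comp (fun a => 2 * PI * a) cos) (scal _) (derivable_pt_lim_cos _).
- exists (fun x => cos (2 * PI * x szero) * (2 * PI) *
     (if excluded_middle_informative (szero = k) then 1 else 0)); split.
    have -> : (fun x : config d => cos (2 * PI * x szero) * (2 * PI) *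
     (if excluded_middle_informative (szero = k) then 1 else 0)) = fun x => ((2 * PI) *
     (if excluded_middle_informative (szero = k) then 1 else 0)) * cos (2 * PI * x szero).
      by apply: functional_extensionality => x; lra.
    by apply: pol_mul; [exact: pol_const|exact: pol_cos].
  move=> x; apply: (Partial_comp (f := fun a => sin (2 * PI * a)) _ (Partial_coord x k szero)).
  exact: (derivable_pt_lim_comp (fun a => 2 * PI * a) sin) (scal _) (derivable_pt_lim_sin _).
- exists (fun _ => (if excluded_middle_informative (j = k) then 1 else 0) +
     (-1) * (if excluded_middle_informative (szero = k) then 1 else 0)).
  split; first exact: pol_const.
  move=> x; have -> : (fun x : config d => x j - x szero) = (fun x => x j + (-1) * x szero).
    by apply: functional_extensionality => y; lra.
  by apply: Partial_add; [exact: Partial_coord|apply: Partial_scal; exact: Partial_coord].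
- have [F' [pF' HF']] := IF k; have [G' [pG' HG']] := IG k.
  exists (fun x => F' x + G' x); split; first exact: pol_add.
  by move=> x; exact: Partial_add.
- have [F' [pF' HF']] := IF k; have [G' [pG' HG']] := IG k.
  exists (fun x => F' x * G x + F x * G' x); split; first by apply: pol_add; exact: pol_mul.
  by move=> x; exact: Partial_mul.
Qed.

Lemma pol_cont F : pol F -> ContP F.
Proof.
elim=> {F} [c|||j jl|F G _ IF _ IG|F G pF IF pG IG].
- exact: ContP_const.
- apply: (ContP_comp (f := fun a => cos (2 * PI * a))); last exact: ContP_coord.
  by move=> a; apply: (continuity_pt_comp (fun a => 2 * PI * a) cos); [reg|exact: continuity_cos].
- apply: (ContP_comp (f := fun a => sin (2 * PI * a))); last exact: ContP_coord.
  by move=> a; apply: (continuity_pt_comp (fun a => 2 * PI * a) sin); [reg|exact: continuity_sin].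
- have -> : (fun x : config d => x j - x szero) = (fun x => x j + (-1) * x szero).
    by apply: functional_extensionality => y; lra.
  by apply: ContP_add; [exact: ContP_coord|apply: ContP_mul; [exact: ContP_const|exact: ContP_coord]].
- exact: ContP_add.
- exact: ContP_mul.
Qed.

Lemma pol_depends F : pol F -> depends_on F l.
Proof.
elim=> {F} [c|||j jl|F G _ IF _ IG|F G pF IF pG IG] x y H; rewrite ?(H szero l0) ?(H j jl) //.
  by rewrite (IF x y H) (IG x y H).
by rewrite (IF x y H) (IG x y H).
Qed.

Lemma pol_shift F : pol F -> forall x m, F (fun i => x i + IZR m) = F x.
Proof.
have per (f : R -> R) : (forall a n, f (a + 2 * INR n * PI) = f a) ->
    forall a m, f (2 * PI * (a + IZR m)) = f (2 * PI * a).
  move=> Hf a m; have [m0|m0] := Z_le_gt_dec 0 m.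
    rewrite -[m]Z2Nat.id // -INR_IZR_INZ.
    by have -> : 2 * PI * (a + INR (Z.to_nat m)) = 2 * PI * a + 2 * INR (Z.to_nat m) * PI by lra.
  rewrite -(Hf (2 * PI * (a + IZR m)) (Z.to_nat (- m))) INR_IZR_INZ Z2Nat.id; last lia.
  by rewrite opp_IZR; congr f; lra.
elim=> {F} [c|||j jl|F G _ IF _ IG|F G pF IF pG IG] x m //.
- by apply: (per cos) => a n; exact: cos_period.
- by apply: (per sin) => a n; exact: sin_period.
- by lra.
- by rewrite IF IG.
- by rewrite IF IG.
Qed.

Lemma pol_bound F : pol F -> exists C n, 0 <= C /\ forall x, Rabs (F x) <= C * (1 + spread x) ^ n.
Proof.
have mono a b x : (a <= b)%N -> (1 + spread x) ^ a <= (1 + spread x) ^ b.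
  by move=> /leP ab; apply: Rle_pow => //; have := spread_ge0 x; lra.
elim=> {F} [c|||j jl|F G _ [C [n [C0 HC]]] _ [C' [n' [C'0 HC']]]|F G _ [C [n [C0 HC]]] _ [C' [n' [C'0 HC']]]].
- by exists (Rabs c), 0%N; split=> [|x]; [exact: Rabs_pos|rewrite /=; lra].
- exists 1, 0%N; split=> [|x]; first lra.
  by rewrite /=; have := COS_bound (2 * PI * x szero); move=> ?; apply: Rabs_le; lra.
- exists 1, 0%N; split=> [|x]; first lra.
  by rewrite /=; have := SIN_bound (2 * PI * x szero); move=> ?; apply: Rabs_le; lra.
- exists 1, 1%N; split=> [|x]; first lra.
  have := spread_ge x jl; set t := x j - x szero; rewrite pow_1 Rmult_1_l => h.
  have h1 := Rle_0_sqr (t - 1); have h2 := Rle_0_sqr (t + 1); rewrite /Rsqr in h1 h2.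
  by have := spread_ge0 x; move=> ?; apply: Rabs_le; lra.
- exists (C + C'), (n + n')%N; split=> [|x]; first lra.
  apply: Rle_trans (Rabs_triang _ _) _.
  have := Rmult_le_compat_l C _ _ C0 (mono _ _ x (leq_addr n' n)).
  have := Rmult_le_compat_l C' _ _ C'0 (mono _ _ x (leq_addl n n')).
  by have := HC x; have := HC' x; lra.
- exists (C * C'), (n + n')%N; split=> [|x]; first exact: Rmult_le_pos.
  rewrite Rabs_mult pow_add.
  have -> : C * C' * ((1 + spread x) ^ n * (1 + spread x) ^ n') =
    (C * (1 + spread x) ^ n) * (C' * (1 + spread x) ^ n') by lra.
  by apply: Rmult_le_compat; try exact: Rabs_pos.
Qed.

Definition gau (p : config d -> R) (x : config d) := exp (- spread x) * p x.

Lemma gau_depends p : pol p -> depends_on (gau p) l.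
Proof.
by move=> pp x y H; rewrite /gau (pol_depends pp H) (pol_depends pol_spread H).
Qed.

Lemma gau_shift p x m : pol p -> gau p (fun i => x i + IZR m) = gau p x.
Proof. by move=> pp; rewrite /gau (pol_shift pp) (pol_shift pol_spread). Qed.

Lemma gau_cont p : pol p -> ContP (gau p).
Proof.
move=> pp; apply: ContP_mul; last exact: pol_cont.
apply: (ContP_comp (f := fun a => exp (- a))); last exact: pol_cont pol_spread.
by move=> a; apply: derivable_continuous_pt; reg.
Qed.

Lemma gau_partial p : pol p -> forall k, exists q, pol q /\ forall x, Partial (gau p) x k (gau q x).
Proof.
move=> pp k; have [p' [pp' Hp']] := pol_partial pp k.
have [s' [ps' Hs']] := pol_partial pol_spread k.
exists (fun x => p' x + (-1) * s' x * p x); split.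
  by apply: pol_add => //; apply: pol_mul => //; apply: pol_mul => //; exact: pol_const.
move=> x; have He : Partial (fun x => exp (- spread x)) x k (exp (- spread x) * -1 * s' x).
  apply: (Partial_comp (f := fun a => exp (- a))) => //.
  apply: (derivable_pt_lim_comp (fun a => - a) exp); last exact: derivable_pt_lim_exp.
  have -> : -1 = - (1) by lra.
  exact: derivable_pt_lim_opp (derivable_pt_lim_id _).
have := Partial_mul He (Hp' x).
by congr Partial; rewrite /gau; lra.
Qed.

(** The weight [(1 + spread x) ^ 2] is, up to a constant, the inverse of the lower bound for the
    mixed derivatives of [background] that have to dominate these functions. *)
Lemma gau_bound p : pol p -> exists C, 0 < C /\ forall x, Rabs (gau p x) * (1 + spread x) ^ 2 <= C.
Proof.
move=> pp; have [C [n [C0 HC]]] := pol_bound pp.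
have [K [K0 HK]] := one_plus_pow_exp (n + 2).
exists (C * K + 1); split=> [|x]; first by have := Rmult_le_pos _ _ C0 (Rlt_le _ _ K0); lra.
have s0 := spread_ge0 x; have p2 : 0 <= (1 + spread x) ^ 2 by apply: pow_le; lra.
rewrite /gau Rabs_mult (Rabs_right (exp _)); last by apply: Rle_ge; left; exact: exp_pos.
have e0 := exp_pos (- spread x).
have h := Rmult_le_compat_l _ _ _ (Rlt_le _ _ e0) (HC x).
have h' := Rmult_le_compat_r _ _ _ p2 h.
have := Rmult_le_compat_l _ _ _ C0 (HK _ s0); rewrite pow_add; lra.
Qed.

(** One constant serves all [i] and [k] because derivatives vanish off [l] and finitely many
    remain. *)
Lemma gau_C2 p : pol p -> exists D1 D2, C2_with (gau p) D1 D2 /\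
  exists C, 0 < C /\ forall x, Rabs (gau p x) <= C /\ (forall k, Rabs (D1 k x) <= C) /\
    forall i k, Rabs (D2 i k x) * (1 + spread x) ^ 2 <= C.
Proof.
move=> pp.
have [q Hq] := ClassicalEpsilon.choice _ (gau_partial pp).
have [r Hr] := ClassicalEpsilon.choice _
  (fun ik : site d * site d => gau_partial (proj1 (Hq ik.2)) ik.1).
pose D1 k := gau (q k); pose D2 i k := gau (r (i, k)).
have HC : C2_with (gau p) D1 D2.
  split=> [x k|]; first exact: (proj2 (Hq k)).
  split=> [x i k|i k]; first exact: (proj2 (Hr (i, k)) x).
  exact: gau_cont (proj1 (Hr (i, k))).
exists D1, D2; split=> //.
have z1 k x : ~ In k l -> D1 k x = 0.
  exact: (depends_on_partial0 (proj1 HC) (gau_depends pp)).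
have d1 k : depends_on (D1 k) l by exact: (depends_on_partial (proj1 HC) (gau_depends pp)).
have z2 i k x : ~ In i l \/ ~ In k l -> D2 i k x = 0.
  case=> h; first exact: (@depends_on_partial0 _ (D1 k) (fun i => D2 i k) l (fun y j => proj1 (proj2 HC) y j k) (d1 k) i x h).
  apply: Partial_uniq (proj1 (proj2 HC) x i k) _.
  have -> : D1 k = fun _ => 0 by apply: functional_extensionality => y; exact: z1.
  exact: Partial_const.
have unif A (F : A -> config d -> R) L : (forall a, pol (F a)) ->
    exists C, 0 < C /\ forall a x, In a L -> Rabs (gau (F a) x) * (1 + spread x) ^ 2 <= C.
  move=> HF; elim: L => [|a L [C [C0 IH]]]; first by exists 1; split=> //; lra.
  have [C' [C'0 H']] := gau_bound (HF a).
  exists (C + C'); split; first lra.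
  by move=> b x /= [<-|/(IH b x)]; [have := H' x|]; lra.
have ge1 x : 1 <= (1 + spread x) ^ 2 by apply: pow_R1_Rle; have := spread_ge0 x; lra.
have drop a x C : Rabs a * (1 + spread x) ^ 2 <= C -> Rabs a <= C.
  by have := Rmult_le_compat_l _ _ _ (Rabs_pos a) (ge1 x); lra.
have [C0 [C00 H0]] := gau_bound pp.
have [C1 [C10 H1]] := unif _ q l (fun k => proj1 (Hq k)).
have [C2 [C20 H2]] := unif _ r (list_prod l l) (fun k => proj1 (Hr k)).
exists (C0 + C1 + C2); split; first lra.
move=> x; split; first by have := drop _ _ _ (H0 x); lra.
split=> [k|i k].
  case: (classic (In k l)) => kl; first by have := drop _ _ _ (H1 k x kl); rewrite /D1; lra.
  by rewrite z1 // Rabs_R0; lra.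
case: (classic (In i l /\ In k l)) => [[il kl]|h].
  by have := H2 (i, k) x (in_prod _ _ _ _ il kl); rewrite /D2; lra.
rewrite z2; first by rewrite Rabs_R0; lra.
by case: (classic (In i l)) => il; [right=> kl; apply: h|left].
Qed.

End Gaussian.

Lemma C2_with_sumL I A (F : A -> (I -> R) -> R) D1 D2 (L : list A) :
  (forall a, C2_with (F a) (D1 a) (D2 a)) ->
  C2_with (fun x => sumL (fun a => F a x) L) (fun k x => sumL (fun a => D1 a k x) L)
    (fun i k x => sumL (fun a => D2 a i k x) L).
Proof.
by move=> H; elim: L => [|a L IH] /=; [exact: C2_with_const|exact: C2_with_add (H a) IH].
Qed.

Lemma C2_with_bigsum I (T : finType) (F : T -> (I -> R) -> R) D1 D2 :
  (forall t, C2_with (F t) (D1 t) (D2 t)) ->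
  C2_with (fun x => \sum_t F t x) (fun k x => \sum_t D1 t k x) (fun i k x => \sum_t D2 t i k x).
Proof.
have e (f : T -> R) : \sum_t f t = sumL f (index_enum T).
  by elim: (index_enum T) => [|t s IH] /=; rewrite ?big_nil ?big_cons ?IH.
move=> H; have := C2_with_sumL (index_enum T) H.
congr C2_with; first by apply: functional_extensionality => x; rewrite e.
  by do 2 (apply: functional_extensionality => ?); rewrite e.
by do 3 (apply: functional_extensionality => ?); rewrite e.
Qed.

Lemma sumL_le_term A (f : A -> R) (L : list A) a0 :
  (forall a, In a L -> f a <= 0) -> In a0 L -> sumL f L <= f a0.
Proof.
elim: L => [|a L IH] //= H [<-|aL].
  have := @sumL_le _ f (fun _ => 0) L (fun b bL => H b (or_intror bL)).
  by rewrite sumL_const; lra.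
have := IH (fun b bL => H b (or_intror bL)) aL; have := H a (or_introl (erefl _)); lra.
Qed.

Lemma Rabs_sumL_le A (f : A -> R) (L : list A) B :
  (forall a, In a L -> Rabs (f a) <= B) -> Rabs (sumL f L) <= INR (length L) * B.
Proof.
by move=> H; apply: Rle_trans (Rabs_sumL _ _) _; rewrite -sumL_const; exact: sumL_le.
Qed.

(** Convex with linear growth: the first derivative is bounded, as the gradient norm demands, and
    the second is positive with only polynomial decay, slower than the Gaussian. *)
Definition bend t := sqrt (1 + t * t).

Lemma bend_pos t : 0 < 1 + t * t.
Proof. by have := Rle_0_sqr t; rewrite /Rsqr; lra. Qed.

Lemma bend_sq t : bend t * bend t = 1 + t * t.
Proof. by apply: sqrt_sqrt; have := bend_pos t; lra. Qed.

Lemma bend_ge1 t : 1 <= bend t.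
Proof. by rewrite -sqrt_1; apply: sqrt_le_1; have := bend_pos t; have := Rle_0_sqr t; rewrite /Rsqr; lra. Qed.

Lemma bend_le t : bend t <= 1 + t * t.
Proof. by have := bend_ge1 t; have := bend_sq t; have := Rle_0_sqr (bend t - 1); rewrite /Rsqr; nra. Qed.

Lemma bend_ge_abs t : Rabs t <= bend t.
Proof.
apply: Rsqr_incr_0_var; last by have := bend_ge1 t; lra.
by rewrite -Rsqr_abs /Rsqr bend_sq; lra.
Qed.

Lemma bend_derive t : derivable_pt_lim bend t (t / bend t).
Proof.
have h : derivable_pt_lim (fun t => 1 + t * t) t (0 + (1 * t + t * 1)).
  apply: derivable_pt_lim_plus; first exact: derivable_pt_lim_const.
  exact: derivable_pt_lim_mult (derivable_pt_lim_id _) (derivable_pt_lim_id _).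
have := derivable_pt_lim_comp _ sqrt _ _ _ h (derivable_pt_lim_sqrt _ (bend_pos t)).
rewrite -/(bend t); congr derivable_pt_lim.
by have := bend_ge1 t; move=> ?; field; lra.
Qed.

Definition bend2 t := / ((1 + t * t) * bend t).

Lemma bend_derive2 t : derivable_pt_lim (fun t => t / bend t) t (bend2 t).
Proof.
have b1 := bend_ge1 t.
have ne : bend t <> 0 by lra.
have := derivable_pt_lim_div _ _ _ _ _ (derivable_pt_lim_id t) (bend_derive t) ne.
congr derivable_pt_lim; rewrite /id /Rsqr /bend2 -bend_sq.
have -> : 1 * bend t - t / bend t * t = (bend t * bend t - t * t) / bend t by field.
have -> : bend t * bend t - t * t = 1 by rewrite bend_sq; lra.
by field.
Qed.

(** The exact power of [1 + t * t] is -3/2; it is replaced by -2 so that it matches the weight of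
    the Gaussian terms. *)
Lemma bend2_ge t : / ((1 + t * t) ^ 2) <= bend2 t.
Proof.
have := bend_pos t; have := bend_le t; have := bend_ge1 t => *.
apply: Rinv_le_contravar; first by apply: Rmult_lt_0_compat; lra.
by rewrite /= Rmult_1_r; apply: Rmult_le_compat_l; lra.
Qed.

Lemma bend2_pos t : 0 < bend2 t.
Proof. by apply: Rinv_0_lt_compat; apply: Rmult_lt_0_compat; [exact: bend_pos|have := bend_ge1 t; lra]. Qed.

Lemma bend2_le1 t : bend2 t <= 1.
Proof.
rewrite -Rinv_1; apply: Rinv_le_contravar; first lra.
have := bend_ge1 t; have := Rle_0_sqr t; rewrite /Rsqr => ? ?.
by rewrite -{1}[1]Rmult_1_r; apply: Rmult_le_compat; lra.
Qed.

Lemma bend1_le1 t : Rabs (t / bend t) <= 1.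
Proof.
have := bend_ge1 t => b1; rewrite /Rdiv Rabs_mult Rabs_inv (Rabs_right (bend t)); last lra.
apply: (Rmult_le_reg_r (bend t)); first lra.
by rewrite Rmult_assoc Rinv_l; [have := bend_ge_abs t; lra|lra].
Qed.

Lemma bend_cont2 : forall t, continuity_pt bend2 t.
Proof.
move=> t; have b1 := bend_ge1 t; have p := bend_pos t.
apply: continuity_pt_inv; last by apply: Rgt_not_eq; apply: Rmult_lt_0_compat; lra.
apply: continuity_pt_mult; first by reg.
by apply: derivable_continuous_pt; exists (t / bend t); exact: bend_derive.
Qed.

(** * The background potential and the perturbation built on it *)

Section Background.
Variables (d : nat) (l : list (site d)).
Hypothesis l0 : In szero l.

Definition ind (u k : site d) : R := if excluded_middle_informative (u = k) then 1 else 0.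
Definition edge (u w k : site d) := ind u k + (-1) * ind w k.

Lemma edge_abs u w k : Rabs (edge u w k) <= 1.
Proof. by rewrite /edge /ind; do 2 case: excluded_middle_informative => ? /=; apply: Rabs_le; lra. Qed.

(** [edge u w] is the gradient of [x u - x w]. At distinct sites its entries are opposite or one of
    them vanishes, so convex functions of [x u - x w] have nonpositive mixed derivatives. *)
Lemma edge_mul u w i k : i <> k -> edge u w i * edge u w k <= 0.
Proof.
by move=> ne; rewrite /edge /ind; do 4 case: excluded_middle_informative => ? /=; subst => //; lra.
Qed.

Lemma edge_self i k : i <> k -> edge i k i * edge i k k = -1.
Proof.
by move=> ne; rewrite /edge /ind; do 4 case: excluded_middle_informative => ? //=; try lra; subst.
Qed.

Definition background (x : config d) := sumL (fun u => sumL (fun w => bend (x u - x w)) l) l.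
Definition background1 k (x : config d) :=
  sumL (fun u => sumL (fun w => (x u - x w) / bend (x u - x w) * edge u w k) l) l.
Definition background2 i k (x : config d) :=
  sumL (fun u => sumL (fun w => bend2 (x u - x w) * edge u w i * edge u w k) l) l.

Lemma background_C2 : C2_with background background1 background2.
Proof.
apply: (C2_with_sumL (D1 := fun u k x => sumL (fun w => (x u - x w) / bend (x u - x w) * edge u w k) l)
  (D2 := fun u i k x => sumL (fun w => bend2 (x u - x w) * edge u w i * edge u w k) l)) => u.
apply: (C2_with_sumL (D1 := fun w k x => (x u - x w) / bend (x u - x w) * edge u w k)
  (D2 := fun w i k x => bend2 (x u - x w) * edge u w i * edge u w k)) => w.
have He x k : Partial (fun x : config d => x u - x w) x k (edge u w k).
  have -> : (fun x : config d => x u - x w) = (fun x => x u + (-1) * x w).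
    by apply: functional_extensionality => y; lra.
  by apply: Partial_add; [exact: Partial_coord|apply: Partial_scal; exact: Partial_coord].
split=> [x k|]; first exact: Partial_comp (bend_derive _) (He x k).
split=> [x i k|i k].
  have := Partial_scal (edge u w k) (Partial_comp (bend_derive2 _) (He x i)).
  congr Partial; last by lra.
  by apply: functional_extensionality => y; lra.
apply: ContP_mul; last exact: ContP_const.
apply: ContP_mul; last exact: ContP_const.
apply: (ContP_comp (f := bend2)); first exact: bend_cont2.
have -> : (fun x : config d => x u - x w) = (fun x => x u + (-1) * x w).
  by apply: functional_extensionality => y; lra.
by apply: ContP_add; [exact: ContP_coord|apply: ContP_mul; [exact: ContP_const|exact: ContP_coord]].
Qed.

Lemma background_depends : depends_on background l.
Proof.
by move=> x y H; apply: sumL_ext => u ul; apply: sumL_ext => w wl; rewrite (H u ul) (H w wl).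
Qed.

Lemma background_ge0 x : 0 <= background x.
Proof.
have := @sumL_le _ (fun _ => 0) (fun u => sumL (fun w => bend (x u - x w)) l) l.
rewrite sumL_const Rmult_0_r; apply=> u _.
have := @sumL_le _ (fun _ => 0) (fun w => bend (x u - x w)) l.
by rewrite sumL_const Rmult_0_r; apply=> w _; have := bend_ge1 (x u - x w); lra.
Qed.

Lemma background1_abs k x : Rabs (background1 k x) <= INR (length l) * (INR (length l) * 1).
Proof.
apply: Rabs_sumL_le => u _; apply: Rabs_sumL_le => w _; rewrite Rabs_mult -[1]Rmult_1_l.
by apply: Rmult_le_compat; [exact: Rabs_pos|exact: Rabs_pos|exact: bend1_le1|exact: edge_abs].
Qed.

Lemma background2_abs i k x : Rabs (background2 i k x) <= INR (length l) * (INR (length l) * 1).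
Proof.
apply: Rabs_sumL_le => u _; apply: Rabs_sumL_le => w _; rewrite Rmult_assoc !Rabs_mult.
rewrite (Rabs_right (bend2 _)); last by apply: Rle_ge; left; exact: bend2_pos.
rewrite -[1]Rmult_1_l; apply: Rmult_le_compat; [by left; exact: bend2_pos| |exact: bend2_le1|].
  by apply: Rmult_le_pos; exact: Rabs_pos.
rewrite -[1]Rmult_1_l.
by apply: Rmult_le_compat; [exact: Rabs_pos|exact: Rabs_pos|exact: edge_abs|exact: edge_abs].
Qed.

Lemma background2_le i k x : i <> k -> background2 i k x <= 0.
Proof.
move=> ne; have := @sumL_le _ (fun u => sumL (fun w => bend2 (x u - x w) * edge u w i * edge u w k) l) (fun _ => 0) l.
rewrite sumL_const Rmult_0_r; apply=> u _.
have := @sumL_le _ (fun w => bend2 (x u - x w) * edge u w i * edge u w k) (fun _ => 0) l.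
rewrite sumL_const Rmult_0_r; apply=> w _.
have := edge_mul u w ne; have := bend2_pos (x u - x w); nra.
Qed.

(** All terms are nonpositive and only the pair [(i, k)] is kept. The squared deviations of [x i]
    and [x k] from [x szero] are at most [spread], so [1 + (x i - x k)^2 <= 4 * (1 + spread)];
    squaring gives 16. *)
Lemma background2_neg i k x : i <> k -> In i l -> In k l ->
  background2 i k x <= - / (16 * (1 + spread l x) ^ 2).
Proof.
move=> ne il kl.
have tle u w : bend2 (x u - x w) * edge u w i * edge u w k <= 0.
  by have := edge_mul u w ne; have := bend2_pos (x u - x w); nra.
have h1 : background2 i k x <= sumL (fun w => bend2 (x i - x w) * edge i w i * edge i w k) l.
  apply: (@sumL_le_term _ (fun u => sumL (fun w => bend2 (x u - x w) * edge u w i * edge u w k) l)) => // u _.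
  have := @sumL_le _ (fun w => bend2 (x u - x w) * edge u w i * edge u w k) (fun _ => 0) l.
  by rewrite sumL_const Rmult_0_r; apply=> w _; exact: tle.
have h2 := @sumL_le_term _ (fun w => bend2 (x i - x w) * edge i w i * edge i w k) l k
  (fun w _ => tle i w) kl.
rewrite /= Rmult_assoc edge_self // in h2.
have h3 := bend2_ge (x i - x k).
suff : / (16 * (1 + spread l x) ^ 2) <= / (1 + (x i - x k) * (x i - x k)) ^ 2 by lra.
have p := bend_pos (x i - x k).
apply: Rinv_le_contravar; first exact: pow_lt.
have -> : 16 * (1 + spread l x) ^ 2 = (4 * (1 + spread l x)) ^ 2 by lra.
apply: pow_incr; split; first lra.
have s1 := spread_ge x il; have s2 := spread_ge x kl.
have := Rle_0_sqr ((x i - x szero) + (x k - x szero)); rewrite /Rsqr; lra.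
Qed.

Section Perturbation.
Variables (T : finType) (p : T -> config d -> R).
Hypothesis pp : forall t, pol l (p t).

Definition pert (a : T -> R) (x : config d) := background x + \sum_t a t * gau l (p t) x.

Lemma pert_depends a : depends_on (pert a) l.
Proof.
move=> x y H; rewrite /pert (background_depends H); congr (_ + _).
by apply: eq_bigr => t _; rewrite (gau_depends l0 (pp t) H).
Qed.

Lemma pert_shift a x m : pert a (fun i => x i + IZR m) = pert a x.
Proof.
rewrite /pert; congr (_ + _).
  by apply: sumL_ext => u _; apply: sumL_ext => w _; congr bend; lra.
by apply: eq_bigr => t _; rewrite gau_shift.
Qed.

(** The bounds concern the perturbation before multiplication by [eps], so [rho] and [K] serve all
    [eps] at once. Values are compared with [background], which may itself be unbounded. *)
Lemma pert_estimates : exists rho K, 0 < rho /\ 0 < K /\ forall a, (forall t, Rabs (a t) <= rho) ->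
  exists D1 D2, C2_with (pert a) D1 D2 /\ forall x,
    Rabs (pert a x - background x) <= K /\ (forall k, Rabs (D1 k x) <= K) /\
    (forall i k, Rabs (D2 i k x) <= K) /\ forall i k, i <> k -> D2 i k x <= 0.
Proof.
have [E HE] := ClassicalEpsilon.choice _ (fun t => gau_C2 l0 (pp t)).
have [E2 HE2] := ClassicalEpsilon.choice _ HE.
have {}HE2 t := HE2 t.
have [C HC] := ClassicalEpsilon.choice _ (fun t => proj2 (HE2 t)).
have [M [M0 HM]] := finite_bound C.
have CM t : C t <= M by have := Rle_abs (C t); have := HM t; lra.
pose tau := INR #|T|; have tau0 : 0 <= tau by exact: pos_INR.
(* Makes the weighted sum of the Gaussian terms at most [/ 16], the constant of [background2_neg];
   [tau + 1] covers an empty [T]. *)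
pose rho := / (16 * M * (tau + 1)).
have rho0 : 0 < rho by apply: Rinv_0_lt_compat; apply: Rmult_lt_0_compat; lra.
have rM : tau * (rho * M) <= / 16.
  have -> : tau * (rho * M) = / 16 * (tau / (tau + 1)) by rewrite /rho; field; lra.
  rewrite -[X in _ <= X]Rmult_1_r; apply: Rmult_le_compat_l; first lra.
  apply: (Rmult_le_reg_r (tau + 1)); first lra.
  by rewrite /Rdiv Rmult_assoc Rinv_l; lra.
pose n2 := INR (length l) * (INR (length l) * 1).
have n20 : 0 <= n2 by apply: Rmult_le_pos; [|rewrite Rmult_1_r]; exact: pos_INR.
exists rho, (n2 + 1); split=> //; split; first lra.
move=> a Ha.
exists (fun k x => background1 k x + \sum_t a t * E t k x),
       (fun i k x => background2 i k x + \sum_t a t * E2 t i k x); split.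
  apply: C2_with_add; first exact: background_C2.
  apply: (C2_with_bigsum (D1 := fun t k x => a t * E t k x) (D2 := fun t i k x => a t * E2 t i k x)) => t.
  exact: C2_with_scal (proj1 (HE2 t)).
move=> x.
have bsum (f : T -> R) : (forall t, Rabs (f t) <= M) -> Rabs (\sum_t a t * f t) <= / 16.
  move=> Hf; apply: Rle_trans rM; apply: Rabs_rsum_le => t; rewrite Rabs_mult.
  by apply: Rmult_le_compat; [exact: Rabs_pos|exact: Rabs_pos|exact: Ha|exact: Hf].
have ge1 : 1 <= (1 + spread l x) ^ 2 by apply: pow_R1_Rle; have := spread_ge0 l x; lra.
have E2M t i k : Rabs (E2 t i k x) * (1 + spread l x) ^ 2 <= M.
  by apply: Rle_trans (CM t); have [_ /(_ x)[_ []]] := HC t.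
have E2M' t i k : Rabs (E2 t i k x) <= M.
  have := E2M t i k; have := Rmult_le_compat_l _ _ _ (Rabs_pos (E2 t i k x)) ge1; lra.
split.
  have -> : pert a x - background x = \sum_t a t * gau l (p t) x by rewrite /pert; lra.
  apply: Rle_trans (bsum _ _) _; last by lra.
  by move=> t; apply: Rle_trans (CM t); have [_ /(_ x)[]] := HC t.
split=> [k|].
  apply: Rle_trans (Rabs_triang _ _) _.
  have := background1_abs k x; rewrite -/n2.
  have := bsum (fun t => E t k x) (fun t => Rle_trans _ _ _ (proj1 (proj2 (proj2 (HC t) x)) k) (CM t)); lra.
split=> [i k|i k ne].
  apply: Rle_trans (Rabs_triang _ _) _.
  have := background2_abs i k x; rewrite -/n2.
  have := bsum (fun t => E2 t i k x) (fun t => E2M' t i k); lra.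
case: (classic (In i l /\ In k l)) => [[il kl]|out].
  have neg := background2_neg x ne il kl.
  have s0 := spread_ge0 l x; have q0 : 0 < (1 + spread l x) ^ 2 by lra.
  have : Rabs (\sum_t a t * E2 t i k x) * (1 + spread l x) ^ 2 <= / 16.
    rewrite -(Rabs_right ((1 + spread l x) ^ 2)); last lra.
    rewrite -Rabs_mult -rsumZr.
    have -> : \sum_i0 a i0 * E2 i0 i k x * (1 + spread l x) ^ 2 =
      \sum_t a t * (E2 t i k x * (1 + spread l x) ^ 2) by apply: eq_bigr => t _; rewrite Rmult_assoc.
    apply: bsum => t; rewrite Rabs_mult (Rabs_right ((1 + spread l x) ^ 2)); last lra.
    exact: E2M.
  move=> h; have h' : Rabs (\sum_t a t * E2 t i k x) <= / (16 * (1 + spread l x) ^ 2).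
    apply: (Rmult_le_reg_r ((1 + spread l x) ^ 2)) => //.
    by have -> : / (16 * (1 + spread l x) ^ 2) * (1 + spread l x) ^ 2 = / 16 by field; lra.
  by have := Rle_abs (\sum_t a t * E2 t i k x); lra.
have -> : \sum_t a t * E2 t i k x = 0.
  rewrite -[RHS](@rsum0 T); apply: eq_bigr => t _.
  have -> : E2 t i k x = 0; last by lra.
  have CC := proj1 (HE2 t); have dd := gau_depends l0 (pp t).
  case: (classic (In k l)) => kl.
    have il : ~ In i l by move=> il; apply: out.
    exact: (@depends_on_partial0 _ (E t k) (fun i => E2 t i k) l
      (fun y j => proj1 (proj2 CC) y j k) (@depends_on_partial _ _ _ _ (proj1 CC) dd k) i x il).
  apply: Partial_uniq (proj1 (proj2 CC) x i k) _.
  have -> : E t k = fun _ => 0.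
    by apply: functional_extensionality => y; exact: (depends_on_partial0 (proj1 CC) dd).
  exact: Partial_const.
by have := background2_le x ne; lra.
Qed.

End Perturbation.
End Background.

(** * The lattice of periods *)

Section FinSums.
Implicit Types d : nat.

Lemma fsumZ_ext d (f g : Fin.t d -> Z) : (forall m, f m = g m) -> fsumZ d f = fsumZ d g.
Proof. by move=> H; congr fsumZ; exact: functional_extensionality. Qed.

Lemma fsumZ_add d (f g : Fin.t d -> Z) : fsumZ d (fun m => f m + g m)%Z = (fsumZ d f + fsumZ d g)%Z.
Proof. by elim: d f g => [|d IH] f g //=; rewrite IH; lia. Qed.

Lemma fsumZ_scal d c (f : Fin.t d -> Z) : fsumZ d (fun m => c * f m)%Z = (c * fsumZ d f)%Z.
Proof. by elim: d f => [|d IH] f /=; rewrite ?IH; lia. Qed.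

Lemma fsumR_add d (f g : Fin.t d -> R) : fsumR d (fun m => f m + g m) = fsumR d f + fsumR d g.
Proof. by elim: d f g => [|d IH] f g /=; rewrite ?IH; lra. Qed.

Lemma fsumR_scal d c (f : Fin.t d -> R) : fsumR d (fun m => c * f m) = c * fsumR d f.
Proof. by elim: d f => [|d IH] f /=; rewrite ?IH; lra. Qed.

Lemma fsumR_ext d (f g : Fin.t d -> R) : (forall m, f m = g m) -> fsumR d f = fsumR d g.
Proof. by move=> H; congr fsumR; exact: functional_extensionality. Qed.

Lemma IZR_fsumZ d (f : Fin.t d -> Z) : IZR (fsumZ d f) = fsumR d (fun m => IZR (f m)).
Proof. by elim: d f => [|d IH] f //=; rewrite plus_IZR IH. Qed.

(** Rationality of [omega] enters here: multiplication by [n] carries every site into the projection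
    of [I_omega]. *)
Lemma common_denominator d (omega : Fin.t d -> Q) :
  exists n, (0 < n)%Z /\ forall k : site d, exists z, IZR n * inner k omega = IZR z.
Proof.
rewrite /inner; elim: d omega => [|d IH] omega.
  by exists 1%Z; split=> // k; exists 0%Z; rewrite /=; lra.
have [n [n0 Hn]] := IH (fun m => omega (Fin.FS m)).
pose a := omega Fin.F1.
exists (Z.pos (Qden a) * n)%Z; split=> [|k]; first lia.
have [z Hz] := Hn (fun m => k (Fin.FS m)).
exists (n * k Fin.F1 * Qnum a + Z.pos (Qden a) * z)%Z.
rewrite plus_IZR !mult_IZR -Hz /= -/a /Q2R.
have p0 : IZR (Z.pos (Qden a)) <> 0 by apply: not_0_IZR; lia.
by field.
Qed.

End FinSums.

Section Lattice.
Variables (d : nat) (omega : Fin.t d -> Q) (p : Fin.t d -> site d) (q : Fin.t d -> Z).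
Hypothesis PP : PrincipalPeriods omega p q.
Implicit Types (i k : site d) (x v : config d).

Lemma inner_add i k : inner (sadd i k) omega = inner i omega + inner k omega.
Proof.
rewrite /inner -fsumR_add; apply: fsumR_ext => m.
by rewrite /sadd plus_IZR; lra.
Qed.

Lemma inner_scal n k : inner (fun m => n * k m)%Z omega = IZR n * inner k omega.
Proof.
rewrite /inner -fsumR_scal; apply: fsumR_ext => m.
by rewrite mult_IZR; lra.
Qed.

Lemma sadd_ssub i k : sadd k (ssub i k) = i.
Proof. by apply: functional_extensionality => m; rewrite /sadd /ssub; lia. Qed.

Lemma ssub_sadd i k : ssub (sadd i k) i = k.
Proof. by apply: functional_extensionality => m; rewrite /sadd /ssub; lia. Qed.

Lemma saddC i k : sadd i k = sadd k i.
Proof. by apply: functional_extensionality => m; rewrite /sadd; lia. Qed.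

Lemma saddA i j k : sadd i (sadd j k) = sadd (sadd i j) k.
Proof. by apply: functional_extensionality => m; rewrite /sadd; lia. Qed.

Lemma sadd0 k : sadd k szero = k.
Proof. by apply: functional_extensionality => m; rewrite /sadd /szero; lia. Qed.

Lemma inner_sub i k : inner (ssub i k) omega = inner i omega - inner k omega.
Proof. by have := inner_add k (ssub i k); rewrite sadd_ssub; lra. Qed.

Lemma inner_zero : inner szero omega = 0.
Proof. by have := inner_add szero szero; rewrite sadd0; lra. Qed.

(** Induction over the subgroup generated by the pairs [(p' j, q' j)]; the behaviour of periodic
    configurations and membership in [I_omega] are both instances. *)
Lemma combination_ind (P : site d -> Z -> Prop) n (p' : Fin.t n -> site d) q' c :
  P szero 0%Z ->
  (forall k l k' l', P k l -> P k' l' -> P (sadd k k') (l + l')%Z) ->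
  (forall k l, P k l -> P (fun m => - k m)%Z (- l)%Z) ->
  (forall j, P (p' j) (q' j)) ->
  P (fun m => fsumZ n (fun j => c j * p' j m)%Z) (fsumZ n (fun j => c j * q' j)%Z).
Proof.
move=> P0 Padd Popp.
have PnatM k l (a : nat) : P k l -> P (fun m => Z.of_nat a * k m)%Z (Z.of_nat a * l)%Z.
  move=> Pk; elim: a => [|a IH]; first exact: P0.
  have := Padd _ _ _ _ Pk IH; congr P; last lia.
  by apply: functional_extensionality => m; rewrite /sadd; lia.
have PM k l z : P k l -> P (fun m => z * k m)%Z (z * l)%Z.
  move=> Pk; case: (Z_le_gt_dec 0 z) => z0.
    by have := PnatM k l (Z.to_nat z) Pk; rewrite Z2Nat.id.
  have := Popp _ _ (PnatM k l (Z.to_nat (- z)) Pk); congr P; last lia.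
  by apply: functional_extensionality => m; lia.
elim: n p' q' c => [|n IH] p' q' c Hp /=; first exact: P0.
exact: (Padd _ _ _ _ (PM _ _ (c Fin.F1) (Hp Fin.F1))
  (IH (fun j => p' (Fin.FS j)) (fun j => q' (Fin.FS j)) (fun j => c (Fin.FS j)) (fun j => Hp (Fin.FS j)))).
Qed.

(** The projection of [I_omega] to sites; [z] is determined by [k]. *)
Definition lat k := exists z, InIomega omega k z.

Definition eqv i k := lat (ssub i k).

Lemma InIomega_add k l k' l' : InIomega omega k l -> InIomega omega k' l' ->
  InIomega omega (sadd k k') (l + l')%Z.
Proof. by rewrite /InIomega inner_add plus_IZR; lra. Qed.

Lemma InIomega_opp k l : InIomega omega k l -> InIomega omega (fun m => - k m)%Z (- l)%Z.
Proof.
rewrite /InIomega opp_IZR; have -> : (fun m => - k m)%Z = (fun m => -1 * k m)%Z.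
  by apply: functional_extensionality => m; lia.
by rewrite inner_scal; lra.
Qed.

Lemma eqv_refl k : eqv k k.
Proof. by exists 0%Z; rewrite /InIomega inner_sub; lra. Qed.

Lemma eqv_sym i k : eqv i k -> eqv k i.
Proof. by move=> [z Hz]; exists (- z)%Z; move: Hz; rewrite /InIomega !inner_sub opp_IZR; lra. Qed.

Lemma eqv_trans i j k : eqv i j -> eqv j k -> eqv i k.
Proof.
move=> [z Hz] [z' Hz']; exists (z + z')%Z.
by move: Hz Hz'; rewrite /InIomega !inner_sub plus_IZR; lra.
Qed.

Lemma InX_lat x : InX p q x -> forall k z, InIomega omega k z -> forall i, x (sadd i k) + IZR z = x i.
Proof.
move=> Hx k z Hk; have [_ [/(_ k z Hk) [c [ck cz]] _]] := PP.
have -> : k = (fun m => fsumZ d (fun j => c j * p j m)%Z) by exact: functional_extensionality.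
rewrite cz; apply: (@combination_ind (fun k z => forall i, x (sadd i k) + IZR z = x i)).
- by move=> i; rewrite sadd0; lra.
- move=> a l a' l' h h' i; rewrite saddA plus_IZR.
  by have := h i; have := h' (sadd i a); lra.
- move=> a l h i; have := h (sadd i (fun m => - a m)%Z).
  have -> : sadd (sadd i (fun m => - a m)%Z) a = i.
    by apply: functional_extensionality => m; rewrite /sadd; lia.
  by rewrite opp_IZR; lra.
- by move=> j i; have := equal_f (Hx j) i.
Qed.

Lemma InV_lat v : InV p v -> forall k, lat k -> forall i, v (sadd i k) = v i.
Proof.
move=> Hv k [z Hk]; have [_ [/(_ k z Hk) [c [ck cz]] _]] := PP.
have -> : k = (fun m => fsumZ d (fun j => c j * p j m)%Z) by exact: functional_extensionality.
apply: (@combination_ind (fun k z => forall i, v (sadd i k) = v i) d p q c).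
- by move=> i; rewrite sadd0.
- by move=> a _ a' _ h h' i; rewrite saddA h' h.
- move=> a _ h i; rewrite -(h (sadd i (fun m => - a m)%Z)); congr v.
  by apply: functional_extensionality => m; rewrite /sadd; lia.
- by move=> j i; have := equal_f (Hv j) i; rewrite /tau Rplus_0_r.
Qed.

Lemma Bp_zero : InBp p szero.
Proof.
exists (fun _ => 0); split=> [j|m]; first lra.
rewrite /szero; have -> : (fun j => 0 * IZR (p j m)) = (fun j => 0 * 1).
  by apply: functional_extensionality => j; lra.
by rewrite (fsumR_scal 0); lra.
Qed.

(** [n * k] is an integer combination of the periods. Dividing its coefficients by [n] with
    remainder splits [k] into a lattice vector and the point of the fundamental cell with
    coordinates [(c j mod n) / n]. *)
Lemma Bp_cover k : exists b, InBp p b /\ eqv k b.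
Proof.
have [n [n0 Hn]] := common_denominator omega.
have [z Hz] := Hn k.
have [_ [/(_ (fun m => n * k m)%Z (- z)%Z) H _]] := PP.
have [|c [ck _]] := H.
  by rewrite /InIomega inner_scal opp_IZR Hz; lra.
pose s m := fsumZ d (fun j => (c j / n) * p j m)%Z.
exists (fun m => k m - s m)%Z; split; last first.
  exists (fsumZ d (fun j => (c j / n) * q j)%Z).
  have -> : ssub k (fun m => k m - s m)%Z = s.
    by apply: functional_extensionality => m; rewrite /ssub; lia.
  apply: (@combination_ind (InIomega omega)).
  - by rewrite /InIomega inner_zero; lra.
  - exact: InIomega_add.
  - exact: InIomega_opp.
  - by have [] := PP.
exists (fun j => IZR (c j mod n) / IZR n).
have nR : 0 < IZR n by exact: (IZR_lt 0).
split=> [j|m].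
  have [h1 h2] := Z.mod_pos_bound (c j) n n0.
  split; first by apply: Rle_mult_inv_pos => //; exact: IZR_le.
  by apply: (Rmult_lt_reg_r (IZR n)) => //; rewrite /Rdiv Rmult_assoc Rinv_l; [have := IZR_lt _ _ h2; lra|lra].
apply: (Rmult_eq_reg_l (IZR n)); last lra.
rewrite -fsumR_scal -mult_IZR.
have -> : (fun j => IZR n * (IZR (c j mod n) / IZR n * IZR (p j m))) =
    (fun j => IZR ((c j mod n) * p j m)%Z).
  by apply: functional_extensionality => j; rewrite mult_IZR; field; lra.
rewrite -IZR_fsumZ; congr IZR; rewrite Z.mul_sub_distr_l (ck m).
have -> : fsumZ d (fun j => c j * p j m)%Z =
    (fsumZ d (fun j => (c j mod n) * p j m) + n * s m)%Z; last by lia.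
rewrite /s -fsumZ_scal -fsumZ_add; apply: fsumZ_ext => j.
have e : c j = (n * (c j / n) + c j mod n)%Z by apply: Z.div_mod; lia.
by rewrite {1}e; lia.
Qed.

End Lattice.

(** The covering list is thinned greedily to one element per class; the index type ['I_n.+1] records
    that some class exists. *)
Lemma representatives A (E : A -> A -> Prop) (a0 : A) (l : list A) :
  (forall a, E a a) -> (forall a b, E a b -> E b a) -> (forall a b c, E a b -> E b c -> E a c) ->
  (forall a, exists b, In b l /\ E a b) ->
  exists n (r : 'I_n.+1 -> A) (cls : A -> 'I_n.+1),
    (forall i, In (r i) l) /\ (forall a, E a (r (cls a))) /\
    (forall a b, E a b -> cls a = cls b) /\ forall i, cls (r i) = i.
Proof.
move=> refl sym trans cover.
have [l' [sub [cov sep]]] : exists l', (forall b, In b l' -> In b l) /\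
    (forall b, In b l -> exists b', In b' l' /\ E b b') /\
    forall i j, (i < length l')%coq_nat -> (j < length l')%coq_nat ->
      E (List.nth i l' a0) (List.nth j l' a0) -> i = j.
  elim: (l) => [|b L [l' [sub [cov sep]]]]; first by exists nil; split=> //; split=> // i j /=; lia.
  case: (classic (exists b', In b' l' /\ E b b')) => [ex|nex].
    exists l'; split=> [c /sub|]; first by right.
    by split=> // c /= [<-|/cov].
  exists (b :: l'); split=> [c /= [->|/sub h]|]; [by left|by right|].
  split=> [c /= [<-|/cov [c' [h1 h2]]]|]; [by exists b; split=> //; left|by exists c'; split=> //; right|].
  move=> [|i] [|j] //= hi hj e.
  - by case: nex; exists (List.nth j l' a0); split=> //; apply: nth_In; lia.
  - by case: nex; exists (List.nth i l' a0); split; [apply: nth_In; lia|exact: sym].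
  - by congr S; apply: sep => //; lia.
have cov' a : exists i, (i < length l')%coq_nat /\ E a (List.nth i l' a0).
  have [b [bl ab]] := cover a; have [c [cl bc]] := cov b bl.
  have [i [hi e]] := In_nth l' c a0 cl.
  by exists i; rewrite e; split=> //; exact: trans ab bc.
case E' : (length l') => [|n].
  by exfalso; have [i [hi _]] := cov' a0; lia.
pose r (i : 'I_n.+1) := List.nth i l' a0.
have ltr (i : 'I_n.+1) : (i < length l')%coq_nat by rewrite E'; apply/ltP.
have [cls Hcls] : exists cls : A -> 'I_n.+1, forall a, E a (r (cls a)).
  apply: (ClassicalEpsilon.choice (fun a i => E a (r i))) => a.
  have [i [hi e]] := cov' a; have lt : (i < n.+1)%N by apply/ltP; lia.
  by exists (Ordinal lt).
have rinj i j : E (r i) (r j) -> i = j by move=> h; apply/val_inj; exact: sep (ltr _) (ltr _) h.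
exists n, r, cls; split=> [i|]; first by apply: sub; exact: nth_In.
split=> //; split=> [a b ab|i].
  by apply: (rinj); exact: trans (trans _ _ _ (sym _ _ (Hcls a)) ab) (Hcls b).
by apply: rinj; apply: sym.
Qed.

(** * Separation of the orbits of translations *)

Lemma sq_sum_eq0 a b : 0 <= a -> 0 <= b -> a + b = 0 -> a = 0 /\ b = 0.
Proof. by lra. Qed.

Lemma cos_sin_eq_mod1 a b : cos (2 * PI * a) = cos (2 * PI * b) ->
  sin (2 * PI * a) = sin (2 * PI * b) -> exists z, a = b + IZR z.
Proof.
move=> hc hs.
have h1 : cos (2 * (PI * (a - b))) = 1.
  have -> : 2 * (PI * (a - b)) = 2 * PI * a - 2 * PI * b by lra.
  by rewrite cos_minus hc hs; have := sin2_cos2 (2 * PI * b); rewrite /Rsqr; lra.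
have s0 : sin (PI * (a - b)) = 0.
  by rewrite cos_2a_sin in h1; apply: Rsqr_0_uniq; rewrite /Rsqr; lra.
have [z Hz] := sin_eq_0_0 _ s0; exists z.
have := PI_RGT_0 => pi0; apply: (Rmult_eq_reg_l PI); last lra.
by lra.
Qed.

Lemma rsum_sumL_exch (T : finType) A (a : T -> R) (F : T -> A -> R) (L : list A) :
  \sum_t a t * sumL (F t) L = sumL (fun j => \sum_t a t * F t j) L.
Proof.
elim: L => [|j L IH] /=; first by rewrite -[RHS](@rsum0 T); apply: eq_bigr => f _; lra.
by rewrite -IH -rsumD; apply: eq_bigr => f _; lra.
Qed.

Section LinearCombinations.
Variables (d g : nat) (G : 'I_g -> config d -> R).

Definition lincomb (F : config d -> R) := exists c : 'I_g -> R, forall x, F x = \sum_i c i * G i x.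

Lemma lincomb_gen i : lincomb (G i).
Proof.
exists (fun j => if j == i then 1 else 0) => x.
by rewrite (@rsum_pick _ _ i) ?eqxx; [lra|move=> j /negbTE ->; lra].
Qed.

Lemma lincomb_add F H : lincomb F -> lincomb H -> lincomb (fun x => F x + H x).
Proof.
move=> [c Hc] [e He]; exists (fun i => c i + e i) => x.
by rewrite Hc He -rsumD; apply: eq_bigr => i _; lra.
Qed.

Lemma lincomb_scal a F : lincomb F -> lincomb (fun x => a * F x).
Proof.
move=> [c Hc]; exists (fun i => a * c i) => x.
by rewrite Hc -rsumZ; apply: eq_bigr => i _; lra.
Qed.

Lemma lincomb_sumL A (F : A -> config d -> R) L : lincomb (fun _ => 0) ->
  (forall a, In a L -> lincomb (F a)) -> lincomb (fun x => sumL (fun a => F a x) L).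
Proof.
move=> z; elim: L => [|a L IH] H //=.
by apply: lincomb_add; [apply: H; left|apply: IH => b bL; apply: H; right].
Qed.

(** Expanding the product moves all dependence on a chosen configuration into the coefficients of a
    fixed finite family of monomials, so one parameter space serves every point. *)
Lemma lincomb_prod n (F : 'I_n -> config d -> R) : (forall i, lincomb (F i)) ->
  exists alpha : {ffun 'I_n -> 'I_g} -> R,
    forall x, \prod_i F i x = \sum_f alpha f * \prod_i G (f i) x.
Proof.
move=> H; have [c Hc] := ClassicalEpsilon.choice _ H.
exists (fun f => \prod_i c i (f i)) => x.
under eq_bigr => i _ do rewrite Hc.
by rewrite bigA_distr_bigA; apply: eq_bigr => f _; rewrite -big_split.
Qed.

End LinearCombinations.

Section DirectionalDerivatives.
Variable d : nat.
Implicit Types (F H : config d -> R) (x v : config d).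

Lemma DirD_uniq F x v a b : DirD F x v a -> DirD F x v b -> a = b.
Proof. exact: uniqueness_limite. Qed.

Lemma line0 x v : (fun i => x i + 0 * v i) = x.
Proof. by apply: functional_extensionality => i; lra. Qed.

Lemma DirD_add F H x v a b : DirD F x v a -> DirD H x v b -> DirD (fun x => F x + H x) x v (a + b).
Proof. exact: derivable_pt_lim_plus. Qed.

Lemma DirD_const c x v : DirD (fun _ => c) x v 0.
Proof. exact: derivable_pt_lim_const. Qed.

Lemma DirD_scal c F x v a : DirD F x v a -> DirD (fun x => c * F x) x v (c * a).
Proof. exact: derivable_pt_lim_scal. Qed.

Lemma DirD_mul F H x v a b : DirD F x v a -> DirD H x v b ->
  DirD (fun x => F x * H x) x v (a * H x + F x * b).
Proof. by move=> hF hH; have := derivable_pt_lim_mult _ _ _ _ _ hF hH; rewrite line0. Qed.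

Lemma DirD_comp (f : R -> R) F x v a b : derivable_pt_lim f (F x) b -> DirD F x v a ->
  DirD (fun x => f (F x)) x v (b * a).
Proof. by move=> hf hF; apply: (derivable_pt_lim_comp _ f _ _ _ hF); rewrite line0. Qed.

Lemma DirD_coord k x v : DirD (fun x => x k) x v (v k).
Proof.
have h : derivable_pt_lim (fun t => x k + t * v k) 0 (0 + (1 * v k + id 0 * 0)).
  apply: derivable_pt_lim_plus; first exact: derivable_pt_lim_const.
  exact: (derivable_pt_lim_mult id (fun _ => v k) 0 1 0 (derivable_pt_lim_id _) (derivable_pt_lim_const _ _)).
by move: h; congr derivable_pt_lim; rewrite /id; lra.
Qed.

Lemma DirD_sumL A (F : A -> config d -> R) (D : A -> R) L x v :
  (forall a, In a L -> DirD (F a) x v (D a)) -> DirD (fun x => sumL (fun a => F a x) L) x v (sumL D L).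
Proof.
elim: L => [|a L IH] H /=; first exact: DirD_const.
by apply: DirD_add; [apply: H; left|apply: IH => b bL; apply: H; right].
Qed.

Lemma DirD_bigsum (T : finType) (F : T -> config d -> R) (D : T -> R) x v :
  (forall a, DirD (F a) x v (D a)) -> DirD (fun x => \sum_t F t x) x v (\sum_t D t).
Proof.
have e (f : T -> R) : \sum_t f t = sumL f (index_enum T).
  by elim: (index_enum T) => [|t s IH] /=; rewrite ?big_nil ?big_cons ?IH.
move=> H; have := @DirD_sumL _ F D (index_enum T) x v (fun a _ => H a).
by rewrite e; congr DirD; apply: functional_extensionality => y; rewrite e.
Qed.

Lemma DirD_sq F x v a c : DirD F x v a -> F x = c ->
  DirD (fun x => (F x - c) * (F x - c)) x v 0.
Proof.
move=> hF e; have h : DirD (fun x => F x + (- c)) x v (a + 0) by apply: DirD_add => //; exact: DirD_const.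
have := DirD_mul h h; congr DirD; rewrite e; lra.
Qed.

Lemma DirD_phase_cos x v : DirD (fun x => cos (2 * PI * x szero)) x v (- sin (2 * PI * x szero) * (2 * PI * v szero)).
Proof.
apply: (DirD_comp (F := fun x => 2 * PI * x szero)); first exact: derivable_pt_lim_cos.
by apply: DirD_scal; exact: DirD_coord.
Qed.

Lemma DirD_phase_sin x v : DirD (fun x => sin (2 * PI * x szero)) x v (cos (2 * PI * x szero) * (2 * PI * v szero)).
Proof.
apply: (DirD_comp (F := fun x => 2 * PI * x szero)); first exact: derivable_pt_lim_sin.
by apply: DirD_scal; exact: DirD_coord.
Qed.

Lemma DirD_diff k x v : DirD (fun x => x k - x szero) x v (v k - v szero).
Proof. exact: derivable_pt_lim_minus (DirD_coord k x v) (DirD_coord szero x v). Qed.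

Lemma pol_DirD l F x v : pol l F -> exists a, DirD F x v a.
Proof.
elim=> {F} [c|||k _|F H _ [a ha] _ [b hb]|F H _ [a ha] _ [b hb]].
- by exists 0; exact: DirD_const.
- by eexists; exact: DirD_phase_cos.
- by eexists; exact: DirD_phase_sin.
- by eexists; exact: DirD_diff.
- by eexists; exact: DirD_add ha hb.
- by eexists; exact: DirD_mul ha hb.
Qed.

Lemma gau_DirD l F x v : pol l F -> exists a, DirD (gau l F) x v a.
Proof.
move=> pF; have [a ha] := pol_DirD x v pF.
have [b hb] := pol_DirD x v (pol_spread l).
eexists; apply: (DirD_mul _ ha).
apply: (DirD_comp (f := fun s => exp (- s)) _ hb).
apply: (derivable_pt_lim_comp (fun s => - s) exp); last exact: derivable_pt_lim_exp.
exact: derivable_pt_lim_opp (derivable_pt_lim_id _).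
Qed.

End DirectionalDerivatives.

(** * Iterated translations and bounds for Birkhoff configurations *)

Section Orbits.
Variables (d : nat) (omega : Fin.t d -> Q) (p : Fin.t d -> site d) (q : Fin.t d -> Z).
Hypothesis PP : PrincipalPeriods omega p q.
Implicit Types x : config d.

Lemma iterate_shift x j c : (forall k, x (sadd k j) = x k + c) ->
  forall (m : nat) k, x (sadd k (fun a => Z.of_nat m * j a)%Z) = x k + INR m * c.
Proof.
move=> H m k; elim: m => [|m IH].
  have -> : sadd k (fun a => Z.of_nat 0 * j a)%Z = k.
    by apply: functional_extensionality => a; rewrite /sadd; lia.
  by rewrite /=; lra.
have -> : sadd k (fun a => Z.of_nat m.+1 * j a)%Z = sadd (sadd k (fun a => Z.of_nat m * j a)%Z) j.
  by apply: functional_extensionality => a; rewrite /sadd; lia.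
by rewrite H IH S_INR; lra.
Qed.

(** In each direction a periodic configuration has average slope [inner j omega], attained exactly
    after [m] steps. *)
Lemma lat_multiple (j : site d) : exists m : nat, (0 < m)%N /\
  forall x, InX p q x -> forall k, x (sadd k (fun a => Z.of_nat m * j a)%Z) = x k + INR m * inner j omega.
Proof.
have [n [n0 Hn]] := common_denominator omega.
have [z Hz] := Hn j.
exists (Z.to_nat n); split=> [|x Hx k]; first by apply/ltP; lia.
rewrite INR_IZR_INZ !Z2Nat.id ?Hz; try lia.
have h : InIomega omega (fun a => n * j a)%Z (- z)%Z.
  by rewrite /InIomega inner_scal opp_IZR Hz; lra.
by have := InX_lat PP Hx h k; rewrite opp_IZR; lra.
Qed.

(** An inequality between [x] and a translate holds at all sites, so it can be iterated and compared
    with the exact value after [m] steps; this excludes one alternative for integers on either side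
    of [inner k omega]. *)
Lemma birkhoff_bound x : Birkhoff x -> InX p q x -> forall k i,
  Rabs (x (sadd i k) - x i) <= Rabs (inner k omega) + 2.
Proof.
move=> HB Hx k i.
pose c := inner k omega.
have [m [m0 Hm]] := lat_multiple k.
have mR : 0 < INR m by apply: (lt_INR 0); apply/ltP.
have per : x (sadd i (fun a => Z.of_nat m * k a)%Z) = x i + INR m * c by exact: Hm.
have up_it C : (forall s, x s + C <= x (sadd s k)) -> C <= c.
  move=> H; have h (a : nat) : x i + INR a * C <= x (sadd i (fun b => Z.of_nat a * k b)%Z).
    elim: a => [|a IH].
      have -> : sadd i (fun b => Z.of_nat 0 * k b)%Z = i.
        by apply: functional_extensionality => b; rewrite /sadd; lia.
      by rewrite /=; lra.
    have -> : sadd i (fun b => Z.of_nat a.+1 * k b)%Z = sadd (sadd i (fun b => Z.of_nat a * k b)%Z) k.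
      by apply: functional_extensionality => b; rewrite /sadd; lia.
    by have := H (sadd i (fun b => Z.of_nat a * k b)%Z); rewrite S_INR; lra.
  by apply: (Rmult_le_reg_l (INR m)) => //; have := h m; rewrite per; lra.
have down_it C : (forall s, x (sadd s k) <= x s + C) -> c <= C.
  move=> H; have h (a : nat) : x (sadd i (fun b => Z.of_nat a * k b)%Z) <= x i + INR a * C.
    elim: a => [|a IH].
      have -> : sadd i (fun b => Z.of_nat 0 * k b)%Z = i.
        by apply: functional_extensionality => b; rewrite /sadd; lia.
      by rewrite /=; lra.
    have -> : sadd i (fun b => Z.of_nat a.+1 * k b)%Z = sadd (sadd i (fun b => Z.of_nat a * k b)%Z) k.
      by apply: functional_extensionality => b; rewrite /sadd; lia.
    by have := H (sadd i (fun b => Z.of_nat a * k b)%Z); rewrite S_INR; lra.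
  by apply: (Rmult_le_reg_l (INR m)) => //; have := h m; rewrite per; lra.
have [u1 u2] := archimed c.
have hi : x (sadd i k) - x i <= IZR (up c).
  have [H|H] := HB k (- up c)%Z; last by have := H i; rewrite /tau opp_IZR; lra.
  by have := up_it (IZR (up c)) (fun s => ltac:(have := H s; rewrite /tau opp_IZR; lra)); lra.
(* The shift is [up c - 2] because [up c - 1] may equal [c], which would leave no contradiction. *)
have lo : IZR (up c) - 2 <= x (sadd i k) - x i.
  have [H|H] := HB k (- (up c - 2))%Z.
    by have := H i; rewrite /tau opp_IZR minus_IZR; lra.
  have := down_it (IZR (up c) - 2) (fun s => ltac:(have := H s; rewrite /tau opp_IZR minus_IZR; lra)).
  lra.
have := Rle_abs c; have := Rle_abs (- c); rewrite Rabs_Ropp => ? ?.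
by apply: Rabs_le; rewrite -/c; lra.
Qed.

End Orbits.

(** * Functions spanning the cotangent space at a periodic configuration *)

Section Spanning.
Variables (d : nat) (omega : Fin.t d -> Q) (p : Fin.t d -> site d) (q : Fin.t d -> Z).
Variables (l : list (site d)).
Hypotheses (PP : PrincipalPeriods omega p q) (l0 : In szero l).
Hypothesis cover : forall k, exists b, In b l /\ eqv omega k b.
Implicit Types (x v : config d).

Definition translate (j : site d) x : config d := fun i => x (sadd i j).

(** Chosen so that the span contains every [dist2 y] and every first-order factor needed at a point;
    [spread] is included as the quadratic part of each [dist2 y]. *)
Definition gens : list (config d -> R) :=
  (fun _ => 1) :: (fun x => cos (2 * PI * x szero)) :: (fun x => sin (2 * PI * x szero)) ::
  spread l :: List.map (fun k x => x k - x szero) l.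

Definition gen (i : 'I_(length gens)) := List.nth i gens (fun _ => 0).

Lemma gen_pol i : pol l (gen i).
Proof.
have : In (gen i) gens by apply: nth_In; apply/ltP.
move: (gen i) => F /= [<-|[<-|[<-|[<-|]]]].
- exact: pol_const.
- exact: pol_cos.
- exact: pol_sin.
- exact: pol_spread.
by move/in_map_iff => [k [<- kl]]; exact: pol_diff.
Qed.

Lemma gens_lincomb F : In F gens -> lincomb gen F.
Proof.
move=> /(In_nth _ _ (fun _ => 0)) [i [/ltP hi <-]].
exact: (lincomb_gen gen (Ordinal hi)).
Qed.

Lemma lincomb_pol F : lincomb gen F -> pol l F.
Proof.
move=> [c Hc]; have -> : F = fun x => sumL (fun i => c i * gen i x) (index_enum 'I_(length gens)).
  apply: functional_extensionality => x; rewrite Hc.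
  by elim: (index_enum _) => [|t s IH] /=; rewrite ?big_nil ?big_cons ?IH.
apply: pol_sumL => i _; apply: pol_mul; [exact: pol_const|exact: gen_pol].
Qed.

Lemma pol_bigprod n (P : pred 'I_n) (F : 'I_n -> config d -> R) :
  (forall i, pol l (F i)) -> pol l (fun x => \big[Rmult/1]_(i | P i) F i x).
Proof.
move=> H; elim: (index_enum 'I_n) => [|i s IH].
  have -> : (fun x => \big[Rmult/1]_(i <- [::] | P i) F i x) = fun _ => 1.
    by apply: functional_extensionality => x; rewrite big_nil.
  exact: pol_const.
case E : (P i).
  have -> : (fun x => \big[Rmult/1]_(i <- i :: s | P i) F i x) =
    fun x => F i x * \big[Rmult/1]_(i <- s | P i) F i x.
    by apply: functional_extensionality => x; rewrite big_cons E.
  exact: pol_mul.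
have -> // : (fun x => \big[Rmult/1]_(i <- i :: s | P i) F i x) =
    fun x => \big[Rmult/1]_(i <- s | P i) F i x.
by apply: functional_extensionality => x; rewrite big_cons E.
Qed.

(* Squared distance to the configuration [y], modulo the integer translations. *)
Definition dist2 (y : config d) x :=
  (cos (2 * PI * x szero) - cos (2 * PI * y szero)) * (cos (2 * PI * x szero) - cos (2 * PI * y szero)) +
  (sin (2 * PI * x szero) - sin (2 * PI * y szero)) * (sin (2 * PI * x szero) - sin (2 * PI * y szero)) +
  sumL (fun k => ((x k - x szero) - (y k - y szero)) * ((x k - x szero) - (y k - y szero))) l.

Lemma lincomb_gens_const c : lincomb gen (fun _ => c).
Proof.
have -> : (fun _ : config d => c) = (fun x => c * (fun _ => 1) x).
  by apply: functional_extensionality => x; lra.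
by apply: lincomb_scal; apply: gens_lincomb; left.
Qed.

Lemma lincomb_diff k : In k l -> lincomb gen (fun x => x k - x szero).
Proof.
move=> kl; apply: gens_lincomb; do 4 right.
by apply/in_map_iff; exists k.
Qed.

Lemma lincomb_cos : lincomb gen (fun x => cos (2 * PI * x szero)).
Proof. by apply: gens_lincomb; right; left. Qed.

Lemma lincomb_sin : lincomb gen (fun x => sin (2 * PI * x szero)).
Proof. by apply: gens_lincomb; right; right; left. Qed.

(** The quadratic terms do not depend on [y]: the phases contribute [cos^2 + sin^2 = 1] and the
    differences add up to [spread]. The rest is linear in the generators. *)
Lemma dist2_lincomb y : lincomb gen (dist2 y).
Proof.
have -> : dist2 y = fun x =>
    (2 + sumL (fun k => (y k - y szero) * (y k - y szero)) l) +
    (-2 * cos (2 * PI * y szero) * cos (2 * PI * x szero) +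
    (-2 * sin (2 * PI * y szero) * sin (2 * PI * x szero) +
    (spread l x + sumL (fun k => -2 * (y k - y szero) * (x k - x szero)) l))).
  apply: functional_extensionality => x; rewrite /dist2.
  have -> : sumL (fun k => ((x k - x szero) - (y k - y szero)) * ((x k - x szero) - (y k - y szero))) l
    = spread l x + sumL (fun k => -2 * (y k - y szero) * (x k - x szero)) l
      + sumL (fun k => (y k - y szero) * (y k - y szero)) l.
    by rewrite /spread -!sumL_add; apply: sumL_ext => k _; lra.
  have := sin2_cos2 (2 * PI * x szero); have := sin2_cos2 (2 * PI * y szero).
  by rewrite /Rsqr; lra.
apply: lincomb_add; first exact: lincomb_gens_const.
apply: lincomb_add; first exact: lincomb_scal lincomb_cos.
apply: lincomb_add; first exact: lincomb_scal lincomb_sin.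
apply: lincomb_add; first by apply: gens_lincomb; do 3 right; left.
apply: lincomb_sumL; first exact: lincomb_gens_const.
by move=> k kl; apply: lincomb_scal; exact: lincomb_diff.
Qed.

Lemma dist2_self y : dist2 y y = 0.
Proof.
rewrite /dist2 !Rminus_diag; have -> : sumL (fun k => (y k - y szero - (y k - y szero)) * (y k - y szero - (y k - y szero))) l
  = sumL (fun _ => 0) l by apply: sumL_ext => k _; rewrite Rminus_diag; lra.
by rewrite sumL_const; lra.
Qed.

Lemma dist2_DirD y v : DirD (dist2 y) y v 0.
Proof.
have -> : 0 = 0 + 0 + sumL (fun _ => 0) l by rewrite sumL_const; lra.
apply: DirD_add.
  apply: DirD_add; first exact: DirD_sq (DirD_phase_cos _ _) (erefl _).
  exact: DirD_sq (DirD_phase_sin _ _) (erefl _).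
by apply: DirD_sumL => k _; exact: DirD_sq (DirD_diff k _ _) (erefl _).
Qed.

Lemma dist2_ge0 y x : 0 <= dist2 y x.
Proof.
apply: Rplus_le_le_0_compat; first by apply: Rplus_le_le_0_compat; exact: Rle_0_sqr.
have := @sumL_le _ (fun _ => 0) (fun k => ((x k - x szero) - (y k - y szero)) * ((x k - x szero) - (y k - y szero))) l.
by rewrite sumL_const Rmult_0_r; apply=> k _; exact: Rle_0_sqr.
Qed.

Lemma dist2_eq0 y x : dist2 y x = 0 ->
  (exists z, y szero = x szero + IZR z) /\ forall k, In k l -> y k - y szero = x k - x szero.
Proof.
have sq a : 0 <= a * a by exact: Rle_0_sqr.
have sl L : 0 <= sumL (fun k => ((x k - x szero) - (y k - y szero)) * ((x k - x szero) - (y k - y szero))) L.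
  have := @sumL_le _ (fun _ => 0) (fun k => ((x k - x szero) - (y k - y szero)) * ((x k - x szero) - (y k - y szero))) L.
  by rewrite sumL_const Rmult_0_r; apply=> k _; exact: sq.
have sq0 a b : (a - b) * (a - b) = 0 -> a = b by move=> h; apply: Rminus_diag_uniq; exact: Rsqr_0_uniq.
move=> h; have [h1 h2] := sq_sum_eq0 (Rplus_le_le_0_compat _ _ (sq _) (sq _)) (sl l) h.
have [/sq0 hc /sq0 hs] := sq_sum_eq0 (sq _) (sq _) h1.
split; first exact: cos_sin_eq_mod1.
elim: (l) h2 => [|j L IH] //= {}h k [<-|].
  by have [/sq0 ->] := sq_sum_eq0 (sq _) (sl L) h.
by have [_ /IH] := sq_sum_eq0 (sq _) (sl L) h; apply.
Qed.

(* The group of translations acts freely on [X_{p,q}]. *)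
Lemma dist2_shift_pos x j : InX p q x -> ~ eqv omega j szero -> 0 < dist2 (translate j x) x.
Proof.
move=> Hx nj; have [//|e] := dist2_ge0 (translate j x) x.
have [[z Hz] Hk] := dist2_eq0 (esym e); case: nj.
have H k : x (sadd k j) = x k + IZR z.
  have [b [bl [w Hw]]] := cover k.
  have kE : k = sadd b (ssub k b) by rewrite sadd_ssub.
  have h1 := InX_lat PP Hx Hw b; have h2 := InX_lat PP Hx Hw (sadd b j).
  have e2 : sadd (sadd b j) (ssub k b) = sadd k j.
    by apply: functional_extensionality => m; rewrite /sadd /ssub; lia.
  rewrite -kE in h1; rewrite e2 in h2.
  by have := Hk b bl; rewrite /translate in Hz *; lra.
have [m [m0 Hm]] := lat_multiple PP j.
have mR : 0 < INR m by apply: (lt_INR 0); apply/ltP.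
have h : IZR z = inner j omega.
  apply: (Rmult_eq_reg_l (INR m)); last lra.
  by have := Hm x Hx szero; rewrite (iterate_shift H); lra.
by exists (- z)%Z; rewrite /InIomega inner_sub opp_IZR h inner_zero; lra.
Qed.

Let n := length l.
(** The number of factors is one for the function that carries the differential plus one for each
    site of [l]. *)
Definition monomial (f : {ffun 'I_n.+1 -> 'I_(length gens)}) x := \prod_i gen (f i) x.

Lemma monomial_pol f : pol l (monomial f).
Proof. exact: (pol_bigprod predT (fun i => gen_pol (f i))). Qed.

Section AtPoint.
Variables (x : config d) (ell : config d -> R).
Hypotheses (Hx : InX p q x) (ell_lin : lincomb gen ell) (ell0 : ell x = 0).

(** Index 0 carries [ell]. Translates by periods agree with [x] up to an integer and cannot be
    separated from it, so their factors are set to 1, which keeps the number of factors fixed. *)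
Definition factor (i : 'I_n.+1) : config d -> R :=
  if unlift ord0 i is Some j then
    let k := List.nth j l szero in
    if excluded_middle_informative (eqv omega k szero) then fun _ => 1 else dist2 (translate k x)
  else ell.

Lemma factor_lincomb i : lincomb gen (factor i).
Proof.
rewrite /factor; case: unliftP => [j _|_] //.
by case: excluded_middle_informative => h /=; [exact: lincomb_gens_const|exact: dist2_lincomb].
Qed.

(* Among the orbit of [x], this function is nonzero to first order at [x] only. *)
Definition selector := gau l (fun y => \prod_i factor i y).

(** One factor vanishes to second order at the translate, which kills the differential of the
    product. *)
Lemma selector_far j v : In j l -> ~ eqv omega j szero -> DirD selector (translate j x) v 0.
Proof.
move=> jl nj; have [i [/ltP hi ij]] := In_nth _ _ szero jl.
pose i0 := lift ord0 (Ordinal hi).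
have fi : factor i0 = dist2 (translate j x).
  by rewrite /factor /i0 liftK /= ij; case: excluded_middle_informative.
have -> : selector = fun y => dist2 (translate j x) y * gau l (fun y => \big[Rmult/1]_(i | i != i0) factor i y) y.
  apply: functional_extensionality => y; rewrite /selector /gau (bigD1 i0) //= fi; lra.
have [a ha] := gau_DirD (translate j x) v (pol_bigprod (fun i => i != i0) (fun i => lincomb_pol (factor_lincomb i))).
have := DirD_mul (dist2_DirD (translate j x) v) ha.
by congr DirD; rewrite dist2_self; lra.
Qed.

(** As [ell x = 0], only the derivative of [ell] survives in the product rule; its coefficient is
    positive by [dist2_shift_pos]. *)
Lemma selector_near : exists kappa, 0 < kappa /\
  forall v lam, DirD ell x v lam -> DirD selector x v (kappa * lam).
Proof.
pose rest y := \big[Rmult/1]_(j < n) factor (lift ord0 j) y.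
exists (gau l rest x); split.
  apply: Rmult_lt_0_compat; first exact: exp_pos.
  rewrite /rest; elim/big_ind: _ => [|a b a0 b0|j _]; [lra|exact: Rmult_lt_0_compat|].
  rewrite /factor liftK; case: excluded_middle_informative => h /=; first lra.
  exact: dist2_shift_pos.
move=> v lam Hlam.
have -> : selector = fun y => ell y * gau l rest y.
  apply: functional_extensionality => y; rewrite /selector /gau big_ord_recl /rest.
  by rewrite /factor unlift_none; lra.
have pr : pol l rest.
  by apply: (@pol_bigprod n predT (fun j => factor (lift ord0 j))) => j; exact: lincomb_pol (factor_lincomb _).
have [a ha] := gau_DirD x v pr.
by have := DirD_mul Hlam ha; congr DirD; rewrite ell0; lra.
Qed.

(** Sites of [l] equivalent to 0 translate [x] by an integer and each contribute the constant of
    [selector_near]; the others contribute nothing. As [szero] is in [l], the total is positive. *)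
Lemma selector_orbit : exists kappa, 0 < kappa /\ forall v lam, InV p v -> DirD ell x v lam ->
  DirD (fun y => sumL (fun j => selector (translate j y)) l) x v (kappa * lam).
Proof.
have [kappa [k0 Hk]] := selector_near.
pose m j := if excluded_middle_informative (eqv omega j szero) then kappa else 0.
have m0 j : 0 <= m j by rewrite /m; case: excluded_middle_informative => h /=; lra.
exists (sumL m l); split.
  have := @sumL_le_term _ (fun j => - m j) l szero (fun j _ => ltac:(have := m0 j; lra)) l0.
  have -> : sumL (fun j => - m j) l = - sumL m l.
    have -> : - sumL m l = -1 * sumL m l by lra.
    by rewrite -sumL_scal; apply: sumL_ext => j _; lra.
  rewrite {2}/m; case: excluded_middle_informative => h /=; first lra.
  by case: h; exact: eqv_refl.
move=> v lam Hv Hlam.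
rewrite [_ * lam]Rmult_comm -sumL_scal.
apply: (@DirD_sumL _ _ (fun j y => selector (translate j y)) (fun j => lam * m j)) => j jl.
rewrite /m; case: excluded_middle_informative => h /=; last first.
  by rewrite Rmult_0_r; exact: (@selector_far j (translate j v) jl h).
have := Hk v lam Hlam; rewrite [kappa * _]Rmult_comm /DirD.
congr derivable_pt_lim; apply: functional_extensionality => t.
have {}h : lat omega j.
  by have [z Hz] := h; exists z; move: Hz; rewrite /InIomega inner_sub inner_zero; lra.
have [z Hz] := h.
have -> : translate j (fun i => x i + t * v i) = fun i => (x i + t * v i) + IZR (- z).
  apply: functional_extensionality => i; rewrite /translate (InV_lat PP Hv h) opp_IZR.
  by have := InX_lat PP Hx Hz i; lra.
by rewrite /selector gau_shift //; apply: (@pol_bigprod n.+1 predT) => i; exact: lincomb_pol (factor_lincomb _).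
Qed.

End AtPoint.

Lemma monomials_span x (k : site d) : InX p q x -> In k l -> exists alpha, forall v, InV p v ->
  DirD (fun y => \sum_f alpha f * sumL (fun j => gau l (monomial f) (translate j y)) l) x v (v k).
Proof.
move=> Hx kl; have pi0 := PI_RGT_0.
pose cx := cos (2 * PI * x szero); pose sx := sin (2 * PI * x szero).
(* The phase part equals [sin (2 * PI * (y szero - x szero)) / (2 * PI)], a periodic substitute for
   [y szero - x szero] with the same differential at [x]; hence [ell] has differential [v k]
   there. *)
pose ell (y : config d) := (y k - y szero) + (- (x k - x szero) +
  (cx / (2 * PI) * sin (2 * PI * y szero) + - sx / (2 * PI) * cos (2 * PI * y szero))).
have ell_lin : lincomb gen ell.
  apply: lincomb_add; first exact: lincomb_diff.
  apply: lincomb_add; first exact: lincomb_gens_const.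
  by apply: lincomb_add; apply: lincomb_scal; [exact: lincomb_sin|exact: lincomb_cos].
have ell0 : ell x = 0 by rewrite /ell -/cx -/sx; field; lra.
have [kappa [k0 H]] := selector_orbit Hx ell_lin ell0.
have [alpha Halpha] := lincomb_prod (factor_lincomb x ell_lin).
exists (fun f => / kappa * alpha f) => v Hv.
have Hl : DirD ell x v (v k).
  have := DirD_add (DirD_diff k x v) (DirD_add (DirD_const (- (x k - x szero)) x v)
    (DirD_add (DirD_scal (cx / (2 * PI)) (DirD_phase_sin x v))
              (DirD_scal (- sx / (2 * PI)) (DirD_phase_cos x v)))).
  congr DirD; rewrite -/cx -/sx.
  have e : cx * cx + sx * sx = 1.
    by have := sin2_cos2 (2 * PI * x szero); rewrite /Rsqr -/cx -/sx; lra.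
  have -> : v k - v szero + (0 + (cx / (2 * PI) * (cx * (2 * PI * v szero)) +
     - sx / (2 * PI) * (- sx * (2 * PI * v szero)))) = v k - v szero + (cx * cx + sx * sx) * v szero.
    by field; lra.
  by rewrite e; lra.
have := DirD_scal (/ kappa) (H v (v k) Hv Hl).
have -> : / kappa * (kappa * v k) = v k by field; lra.
congr DirD; apply: functional_extensionality => y.
rewrite -sumL_scal rsum_sumL_exch.
apply: sumL_ext => j _; rewrite /selector /gau Halpha -!rsumZ.
have E a b c e : a * (b * (c * e)) = a * c * (b * e) by ring.
by apply: eq_bigr => f _; exact: E.
Qed.

End Spanning.

(** * The approximating potentials *)

Lemma derivable_pt_lim_bigsum (T : finType) (f : T -> R -> R) (D : T -> R) s :
  (forall t, derivable_pt_lim (f t) s (D t)) ->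
  derivable_pt_lim (fun s => \sum_t f t s) s (\sum_t D t).
Proof.
move=> H; elim: (index_enum T) => [|t L IH].
  rewrite big_nil; have -> : (fun s => \big[Rplus/0]_(t <- [::]) f t s) = fun _ => 0.
    by apply: functional_extensionality => x; rewrite big_nil.
  exact: derivable_pt_lim_const.
rewrite big_cons; have -> : (fun s => \big[Rplus/0]_(t <- t :: L) f t s) =
    fun s => f t s + \big[Rplus/0]_(t <- L) f t s.
  by apply: functional_extensionality => x; rewrite big_cons.
exact: derivable_pt_lim_plus.
Qed.

Lemma rsum_delta N (f : 'I_N -> R) b : \sum_c f c * (if c == b then 1 else 0) = f b.
Proof. by rewrite (@rsum_pick _ _ b) ?eqxx; [lra|move=> c /negbTE ->; lra]. Qed.

Lemma rsum_option (T : finType) (f : option T -> R) : \sum_t f t = f None + \sum_t f (Some t).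
Proof.
rewrite (bigD1 None) //=; congr (_ + _).
rewrite (reindex_omap Some id) /=; last by case.
by apply: eq_bigl => t; rewrite eqxx.
Qed.

Lemma fsumR_unit_le d (t : Fin.t d -> R) (c : Fin.t d -> Z) : (forall j, 0 <= t j < 1) ->
  Rabs (fsumR d (fun j => t j * IZR (c j))) <= IZR (fsumZ d (fun j => Z.abs (c j))).
Proof.
elim: d t c => [|d IH] t c Ht /=; first by rewrite Rabs_R0; lra.
rewrite plus_IZR; apply: Rle_trans (Rabs_triang _ _) _; apply: Rplus_le_compat; last by apply: IH.
rewrite Rabs_mult abs_IZR -[X in _ <= X]Rmult_1_l; apply: Rmult_le_compat_r; first exact: Rabs_pos.
by have := Ht Fin.F1; move=> ?; apply: Rabs_le; lra.
Qed.

(** Points of the half-open cell are bounded entrywise by sums of absolute values of the periods, so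
    a finite box can be filtered. *)
Lemma exists_EnumBp d (p : Fin.t d -> site d) : exists l, EnumBp p l.
Proof.
have [B HB] : exists B : nat, forall k, InBp p k -> forall m, (Z.abs (k m) <= Z.of_nat B)%Z.
  pose s m := fsumZ d (fun j => Z.abs (p j m)).
  have fs m : (Z.abs (s m) <= fsumZ d (fun m => Z.abs (s m)))%Z.
    exact: (@fsumZ_ge d (fun m => Z.abs (s m)) (fun m => Z.abs_nonneg _) m).
  exists (Z.to_nat (fsumZ d (fun m => Z.abs (s m)))) => k [t [ht hk]] m.
  suff h : Rabs (IZR (k m)) <= IZR (s m).
    by move: h; rewrite -abs_IZR => /le_IZR; have := fs m; lia.
  by rewrite hk; exact: fsumR_unit_le.
have [L HL] := finite_box d B.
have [L' HL'] : exists L', forall k, In k L' <-> In k L /\ InBp p k.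
  elim: (L) => [|k K [L' H]]; first by exists nil => k; split=> [|[]].
  case: (classic (InBp p k)) => hk.
    by exists (k :: L') => j /=; rewrite H; split=> [[<-|[? ?]]|[[->|?] ?]]; auto.
  by exists L' => j /=; rewrite H; split=> [[? ?]|[[e|?] hj]]; auto; subst j.
have [l [nd Hl]] := nodup_list L'.
exists l; split=> // k; rewrite -Hl HL'; split=> [[]//|hk]; split=> //.
by apply: HL; exact: HB.
Qed.

Lemma C2_with_translate d (F : config d -> R) D1 D2 j : C2_with F D1 D2 ->
  C2_with (fun x => F (translate j x)) (fun k x => D1 (ssub k j) (translate j x))
    (fun i k x => D2 (ssub i j) (ssub k j) (translate j x)).
Proof.
have inj i i' : sadd i j = sadd i' j -> i = i'.
  by move=> e; rewrite -(ssub_sadd j i) -(ssub_sadd j i') !(saddC j) e.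
have sE k : k = sadd (ssub k j) j by rewrite saddC sadd_ssub.
move=> [H1 [H2 H3]]; split=> [x k|].
  by rewrite {1}(sE k); exact: (Partial_pullb inj).
split=> [x i k|i k]; last exact: ContP_pullb.
by rewrite {1}(sE i); exact: (Partial_pullb inj (F := D1 (ssub k j))).
Qed.

Lemma bend_le_abs t : bend t <= 1 + Rabs t.
Proof.
have p := Rabs_pos t; apply: Rsqr_incr_0_var; last by lra.
by rewrite /Rsqr bend_sq; have := Rsqr_abs t; rewrite /Rsqr; lra.
Qed.

Section Approximation.
Variables (d : nat) (S : Pot d) (omega : Fin.t d -> Q) (p : Fin.t d -> site d) (q : Fin.t d -> Z).
Variables (r0 : R) (l : list (site d)).
Hypotheses (HS : LocalPot_r S r0) (PP : PrincipalPeriods omega p q) (Hl : EnumBp p l).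
Implicit Types (x v : config d).

Let l0 : In szero l.
Proof. by apply/(proj2 Hl); exact: Bp_zero. Qed.

Let cover k : exists b, In b l /\ eqv omega k b.
Proof. by have [b [hb e]] := Bp_cover PP k; exists b; split=> //; apply/(proj2 Hl). Qed.

Let T : finType := {ffun 'I_(length l).+1 -> 'I_(length (gens l))}.
Let P : T -> config d -> R := @monomial d l.
Let pP t : pol l (P t). Proof. exact: monomial_pol. Qed.

Definition perturbed (eps : R) (a : T -> R) : Pot d :=
  fun j x => S j x + eps * pert l P a (translate j x).

(** * The Morse property in class coordinates *)

Section Coordinates.
Variables (N' : nat) (r : 'I_N'.+1 -> site d) (cls : site d -> 'I_N'.+1).
Hypotheses (rl : forall i, In (r i) l) (clsE : forall k, eqv omega k (r (cls k))).
Hypotheses (cls_eqv : forall i k, eqv omega i k -> cls i = cls k) (clsK : forall i, cls (r i) = i).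

(** On [X_{p,q}] the periods force [x k - x (r (cls k))] to be this number, which is an integer. *)
Let o k := inner (ssub k (r (cls k))) omega.
Let X := affine cls o.

Lemma cls_lat i k : lat omega k -> cls (sadd i k) = cls i.
Proof. by move=> [z Hz]; apply: cls_eqv; exists z; rewrite ssub_sadd. Qed.

Lemma affine_InX y : InX p q (X y).
Proof.
move=> j; apply: functional_extensionality => i; rewrite /tau /X /affine /o.
have Hj : InIomega omega (p j) (q j) by have [] := PP.
rewrite cls_lat; last by exists (q j).
by move: Hj; rewrite /InIomega !inner_sub inner_add; lra.
Qed.

Lemma InX_affine x : InX p q x -> x = X (fun i => x (r i)).
Proof.
move=> Hx; apply: functional_extensionality => k; rewrite /X /affine /o.
have [z Hz] := clsE k; have := InX_lat PP Hx Hz (r (cls k)).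
by rewrite sadd_ssub; move: Hz; rewrite /InIomega; lra.
Qed.

Lemma cls_InV (w : 'I_N'.+1 -> R) : InV p (fun k => w (cls k)).
Proof.
move=> j; apply: functional_extensionality => i; rewrite /tau cls_lat; first lra.
by exists (q j); have [] := PP.
Qed.

Lemma InV_cls v : InV p v -> v = fun k => v (r (cls k)).
Proof.
move=> Hv; apply: functional_extensionality => k.
by have := InV_lat PP Hv (clsE k) (r (cls k)); rewrite sadd_ssub.
Qed.

Lemma line_affine y w t : (fun k => X y k + t * w (cls k)) = X (fun c => y c + t * w c).
Proof. by apply: functional_extensionality => k; rewrite /X /affine; lra. Qed.

Lemma morse_in_coordinates eps rho : 0 < eps -> 0 < rho ->
  exists a : T -> R, (forall t, Rabs (a t) <= rho) /\ MorseOnX p q (Wsum (perturbed eps a) l).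
Proof.
move=> eps0 rho0.
(* [None] is the action with its background part, treated as one more member of a family linear in
   the parameter. *)
pose F (t : option T) x := match t with
  | None => sumL (fun j => S j x + eps * background l (translate j x)) l
  | Some f => sumL (fun j => eps * gau l (P f) (translate j x)) l end.
have inj (j i i' : site d) : sadd i j = sadd i' j -> i = i'.
  by move=> e; rewrite -(ssub_sadd j i) -(ssub_sadd j i') !(saddC j) e.
have smoothF t : smooth (F t).
  case: t => [f|] /=; apply: smooth_sumL => j.
    apply: smooth_scal; apply: (smooth_pullb (inj j)).
    have [D1 [D2 [H _]]] := gau_C2 l0 (pP f).
    by split; [exact: C2_with_C2 H|exists l; exact: gau_depends].
  apply: smooth_add.
    have [/condA_iff [_ /(_ j) [H1 H2]] _] := HS.
    exact: smooth_of_ball H1 H2.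
  apply: smooth_scal; apply: (smooth_pullb (inj j)).
  split; first exact: C2_with_C2 (background_C2 l).
  by exists l; exact: background_depends.
have [u Hu] := ClassicalEpsilon.choice _ (fun t => smooth_coordinates cls o (smoothF t)).
have [U HU] := ClassicalEpsilon.choice _ Hu.
have SD t b := proj1 (HU t) b.
have UC t b c y := proj1 (proj2 (HU t)) b c y.
have dir t y w : DirD (F t) (X y) (fun k => w (cls k)) (\sum_b w b * u t b y).
  have := proj2 (proj2 (HU t)) y w; rewrite /DirD.
  by congr derivable_pt_lim; apply: functional_extensionality => s; rewrite line_affine.
have dirsum (a : option T -> R) y w : DirD (fun x => \sum_t a t * F t x) (X y) (fun k => w (cls k))
    (\sum_b w b * \sum_t a t * u t b y).
  have := DirD_bigsum (fun t => DirD_scal (a t) (dir t y w)).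
  congr DirD; under eq_bigr => t _ do rewrite -rsumZ.
  rewrite rsum_exch; apply: eq_bigr => b _; rewrite -rsumZ.
  by apply: eq_bigr => t _; lra.
have span y b : exists alpha : option T -> R,
    forall b', \sum_t alpha t * u t b' y = if b' == b then 1 else 0.
  have [alpha Halpha] := monomials_span PP l0 cover (affine_InX y) (rl b).
  (* The monomial members already carry the factor [eps], hence the division by it. *)
  exists (fun t => if t is Some f then alpha f / eps else 0) => b'.
  pose w c := if c == b' then 1 else 0.
  have h1 := dirsum (fun t => if t is Some f then alpha f / eps else 0) y w.
  have h2 := Halpha _ (cls_InV w).
  rewrite clsK {2}/w eq_sym in h2.
  have e (f : 'I_N'.+1 -> R) : \sum_b w b * f b = f b'.
    by rewrite -(rsum_delta f b'); apply: eq_bigr => c _; rewrite /w; lra.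
  rewrite e in h1; apply: (DirD_uniq h1); move: h2; congr DirD.
  apply: functional_extensionality => x; rewrite rsum_option Rmult_0_l Rplus_0_l.
  have E b1 s : b1 * s = b1 / eps * (eps * s) by field; lra.
  by apply: eq_bigr => f _; rewrite /F sumL_scal; exact: E.
(* The first bound keeps the coefficient of the action at least 1/2; with the second, the quotients
   by it stay below [rho]. *)
pose rho' := Rmin (/ 2) (rho / 2).
have rho'0 : 0 < rho' by apply: Rmin_glb_lt; lra.
(* The coefficient of the action itself is perturbed too, and normalised to 1 afterwards. *)
have [a [near nondeg]] := nondegenerate_parameter SD UC span
  (fun t => if t is None then 1 else 0) rho'0.
have aN : / 2 <= a None.
  have := near None; have : rho' <= / 2 by exact: Rmin_l.
  by move=> ? /Rabs_le_elim; lra.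
exists (fun f => a (Some f) / a None); split=> [f|].
  rewrite /Rdiv Rabs_mult Rabs_inv (Rabs_right (a None)); last lra.
  have := near (Some f); rewrite Rminus_0_r => h1.
  have h2 : rho' <= rho / 2 by exact: Rmin_r.
  apply: (Rmult_le_reg_r (a None)); first lra.
  rewrite Rmult_assoc Rinv_l ?Rmult_1_r; last lra.
  by have := Rmult_le_compat_l rho _ _ (Rlt_le _ _ rho0) aN; lra.
set W := Wsum _ l.
have WE x : W x = / a None * \sum_t a t * F t x.
  rewrite rsum_option -[F None x]/(sumL (fun j => S j x + eps * background l (translate j x)) l).
  have -> : \sum_t a (Some t) * F (Some t) x =
      sumL (fun j => \sum_t a (Some t) * (eps * gau l (P t) (translate j x))) l.
    exact: rsum_sumL_exch.
  rewrite Rmult_plus_distr_l -Rmult_assoc Rinv_l ?Rmult_1_l; last lra.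
  rewrite -sumL_scal -sumL_add /W /Wsum.
  have foldE (f : site d -> R) L : fold_right (fun j acc => f j + acc) 0 L = sumL f L.
    by elim: L => [|j L IH] //=; rewrite IH.
  rewrite foldE; apply: sumL_ext => j _.
  rewrite /perturbed /pert Rmult_plus_distr_l -!rsumZ -!Rplus_assoc; congr (_ + _).
  by apply: eq_bigr => t _; rewrite /Rdiv; ring.
have dirW y w : DirD W (X y) (fun k => w (cls k)) (\sum_b w b * (/ a None * grad u a b y)).
  have := DirD_scal (/ a None) (dirsum a y w); congr DirD.
    by apply: functional_extensionality => x; rewrite WE.
  by rewrite -rsumZ; apply: eq_bigr => b _; rewrite /grad; lra.
move=> x Hx crit v Hv v0.
pose y i := x (r i); pose eta i := v (r i).
have xE : x = X y by exact: InX_affine.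
have vE : v = fun k => eta (cls k) by exact: InV_cls.
have G b : grad u a b y = 0.
  pose w c := if c == b then 1 else 0.
  have h1 := crit _ (cls_InV w); rewrite xE in h1.
  have := DirD_uniq h1 (dirW y w).
  have -> : \sum_c w c * (/ a None * grad u a c y) = / a None * grad u a b y.
    rewrite -(rsum_delta (fun c => / a None * grad u a c y) b).
    by apply: eq_bigr => c _; exact: Rmult_comm.
  move=> h; have i0 : 0 < / a None by apply: Rinv_0_lt_compat; lra.
  by apply: (Rmult_eq_reg_l (/ a None)); [rewrite Rmult_0_r; exact: esym h|lra].
have [c Hc] : exists c, \sum_b eta b * hess U a b c y <> 0.
  apply: NNPP => H; apply: v0; rewrite vE; apply: functional_extensionality => k.
  apply: (nondeg y eta G) => c; apply: NNPP => Hc; apply: H; by exists c.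
(* The coordinate direction in which the Hessian applied to [eta] is nonzero. *)
pose w b := if b == c then 1 else 0.
exists (fun k => w (cls k)), (/ a None * \sum_b eta b * hess U a b c y).
split; first exact: cls_InV.
split; last first.
  apply: Rmult_integral_contrapositive_currified => //.
  by apply: Rinv_neq_0_compat; lra.
exists (fun t => \sum_b eta b * (/ a None * grad u a b (fun c => y c + t * w c))); split.
  move=> t; rewrite xE vE line_affine; exact: dirW.
rewrite -rsumZ.
have -> : \sum_b / a None * (eta b * hess U a b c y) =
    \sum_b eta b * (/ a None * hess U a b c y) by apply: eq_bigr => b _; ring.
apply: derivable_pt_lim_bigsum => b; apply: derivable_pt_lim_scal; apply: derivable_pt_lim_scal.
apply: derivable_pt_lim_bigsum => t; apply: derivable_pt_lim_scal.
have := strictly_differentiable_dir y w (SD t b).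
by rewrite /w rsum_delta.
Qed.

End Coordinates.

Lemma exists_morse eps rho : 0 < eps -> 0 < rho ->
  exists a : T -> R, (forall t, Rabs (a t) <= rho) /\ MorseOnX p q (Wsum (perturbed eps a) l).
Proof.
have [N' [r [cls [rl [clsE [cls_eqv clsK]]]]]] := representatives szero
  (@eqv_refl d omega) (@eqv_sym d omega) (@eqv_trans d omega) cover.
exact: (morse_in_coordinates rl clsE cls_eqv clsK).
Qed.

Lemma translate_zero x : translate szero x = x.
Proof. by apply: functional_extensionality => i; rewrite /translate sadd0. Qed.

(** * Admissibility and closeness of the perturbed potentials *)

Section Estimates.
Variables (rho K R1 : R).
Hypothesis K0 : 0 < K.
Hypothesis est : forall a : T -> R, (forall t, Rabs (a t) <= rho) ->
  exists D1 D2, C2_with (pert l P a) D1 D2 /\ forall x,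
    Rabs (pert l P a x - background l x) <= K /\ (forall k, Rabs (D1 k x) <= K) /\
    (forall i k, Rabs (D2 i k x) <= K) /\ forall i k, i <> k -> D2 i k x <= 0.
Hypothesis HR1 : forall k, In k l -> IZR (snorm k) <= R1.
Variables (eps : R) (a : T -> R).
Hypotheses (eps0 : 0 < eps) (Ha : forall t, Rabs (a t) <= rho).

(** The perturbation adds only nonpositive mixed derivatives, so strictness at nearest neighbours is
    inherited from [S]; coercivity survives because the perturbation is bounded below. *)
Lemma perturbed_LocalPot : LocalPot_r (perturbed eps a) (Rmax r0 R1).
Proof.
have [/condA_iff [r00 HA] [HB [HC [[HD1 HD2] [E HE]]]]] := HS.
have [D1 [D2 [CP est']]] := est Ha.
have [G1 HG1] := ClassicalEpsilon.choice _ (fun j => C2_withP (proj1 (HA j))).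
have [G2 CS] := ClassicalEpsilon.choice _ HG1.
have Cj j := C2_with_add (CS j) (C2_with_scal eps (C2_with_translate j CP)).
have val j x i k z : Partial2 (perturbed eps a j) x i k z ->
    z = G2 j i k x + eps * D2 (ssub i j) (ssub k j) (translate j x).
  by move=> h; apply: Partial2_uniq h (C2_with_Partial2 x i k (Cj j)).
have ssub_neq (i k j : site d) : i <> k -> ssub i j <> ssub k j.
  by move=> ne e; apply: ne; rewrite -(sadd_ssub i j) -(sadd_ssub k j) e.
have lower x : - K <= pert l P a x.
  have [h _] := est' x; have := Rabs_le_elim h; have := background_ge0 l x; lra.
split.
  apply/condA_iff; split; first by apply: Rlt_le_trans r00 (Rmax_l _ _).
  move=> j; have [_ dep] := HA j; split; first exact: C2_with_C2 (Cj j).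
  move=> x y Hxy; rewrite /perturbed (dep x y); last first.
    by move=> k hk; apply: Hxy; apply: Rle_trans hk (Rmax_l _ _).
  congr (_ + _ * _); apply: (pert_depends l0 pP) => k kl; apply: Hxy.
  apply: Rle_trans (Rmax_r _ _); have -> : ssub (sadd k j) j = k by rewrite saddC ssub_sadd.
  exact: HR1.
split.
  move=> j k z x; rewrite /perturbed HB; congr (_ + _ * _).
  rewrite -(pert_shift pP a (translate (sadd j k) x) z); congr pert.
  by apply: functional_extensionality => i; rewrite /translate /tau saddA.
split.
  move=> j; have [[m Hm] Hc] := HC j; split.
    exists (m + eps * - K) => x; apply: Rplus_le_compat; first exact: Hm.
    by apply: Rmult_le_compat_l; [lra|exact: lower].
  move=> k hk M; have [Rr HRr] := Hc k hk (M + eps * K); exists Rr => x /HRr h.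
  rewrite /perturbed.
  by have := Rmult_le_compat_l eps _ _ (Rlt_le _ _ eps0) (lower (translate j x)); lra.
have neg i k j x : i <> k -> eps * D2 (ssub i j) (ssub k j) (translate j x) <= 0.
  move=> ne; have [_ [_ [_ h]]] := est' (translate j x).
  by have := Rmult_le_compat_l eps _ _ (Rlt_le _ _ eps0) (h _ _ (ssub_neq i k j ne)); lra.
split; first split.
- move=> j i k x z ne /val ->.
  have := HD1 j i k x _ ne (C2_with_Partial2 x i k (CS j)); have := neg i k j x ne; lra.
- move=> i k x z ik /val ->; have ne : i <> k.
    move=> e; move: ik; rewrite e; have -> : ssub k k = szero.
      by apply: functional_extensionality => m; rewrite /ssub /szero; lia.
    suff -> : snorm (@szero d) = 0%Z by [].
    by rewrite /snorm /szero; elim: (d) => [|n IH] //=; rewrite IH.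
  have := HD2 i k x _ ik (C2_with_Partial2 x i k (CS i)); have := neg i k i x ne; lra.
exists (E + eps * K) => j i k x z /val ->.
apply: Rle_trans (Rabs_triang _ _) _; apply: Rplus_le_compat.
  exact: HE (C2_with_Partial2 x i k (CS j)).
rewrite Rabs_mult (Rabs_right eps); last lra.
apply: Rmult_le_compat_l; first lra.
by have [_ [_ [h _]]] := est' (translate j x).
Qed.

(** First derivatives are supported on [l] and second ones on pairs of sites of [l], each bounded by
    [eps * K]. *)
Lemma perturbed_C1normLe : let n := INR (length l) in
  C1normLe (fun x => perturbed eps a szero x - S szero x) (eps * (n * K + n * (n * K))).
Proof.
move=> n; have [D1 [D2 [CP est']]] := est Ha.
have -> : (fun x => perturbed eps a szero x - S szero x) = fun x => eps * pert l P a x.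
  by apply: functional_extensionality => x; rewrite /perturbed translate_zero; lra.
have CE := C2_with_scal eps CP.
have eK : 0 <= eps * K by apply: Rmult_le_pos; lra.
have dep : depends_on (pert l P a) l by exact: (pert_depends l0 pP).
have z1 k x : ~ In k l -> D1 k x = 0 by exact: (depends_on_partial0 (proj1 CP) dep).
have z2 i k x : ~ (In i l /\ In k l) -> D2 i k x = 0.
  move=> h; case: (classic (In k l)) => kl.
    have il : ~ In i l by move=> il; apply: h.
    exact: (@depends_on_partial0 _ (D1 k) (fun i => D2 i k) l
      (fun y j => proj1 (proj2 CP) y j k) (depends_on_partial (proj1 CP) dep _) i x il).
  apply: (Partial_uniq (proj1 (proj2 CP) x i k)).
  have -> : D1 k = fun _ => 0 by apply: functional_extensionality => y; exact: z1.
  exact: Partial_const.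
exists l, (fun i => if excluded_middle_informative (In i l) then eps * K else 0),
  (fun i k => if excluded_middle_informative (In i l /\ In k l) then eps * K else 0).
split; first by case: Hl.
split; first by move=> i h; case: excluded_middle_informative.
split; first by move=> i k h; case: excluded_middle_informative => // -[il kl]; case: h.
have bnd z : Rabs z <= K -> Rabs (eps * z) <= eps * K.
  move=> h; rewrite Rabs_mult (Rabs_right eps); last lra.
  by apply: Rmult_le_compat_l; lra.
split.
  move=> x i z h1; rewrite (Partial_uniq h1 (proj1 CE x i)) {h1}.
  case: excluded_middle_informative => h /=; last by rewrite z1 // Rmult_0_r Rabs_R0; lra.
  by apply: bnd; have [_ [h1 _]] := est' x.
split.
  move=> x i k z h1; rewrite (Partial2_uniq h1 (C2_with_Partial2 x i k CE)) {h1}.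
  case: excluded_middle_informative => h' /=; last by rewrite z2 // Rmult_0_r Rabs_R0; lra.
  by apply: bnd; have [_ [_ [h1 _]]] := est' x.
apply: Req_le; rewrite (@sumL_ext _ _ (fun _ => eps * K)); last first.
  by move=> i il; case: excluded_middle_informative.
rewrite sumL_const (@sumL_ext _ _ (fun _ => n * (eps * K))).
  by rewrite sumL_const -/n; lra.
move=> i il; rewrite (@sumL_ext _ _ (fun _ => eps * K)) ?sumL_const // => k kl.
by case: excluded_middle_informative => // h; case: h.
Qed.

(** [bend] grows linearly, and [birkhoff_bound] controls every difference by a number independent of
    the configuration and of [j]. *)
Lemma background_birkhoff : exists B, forall j x, Birkhoff x -> InX p q x ->
  background l (translate j x) <= B.
Proof.
exists (sumL (fun u => sumL (fun w => 1 + (Rabs (inner (ssub u w) omega) + 2)) l) l) => j x Bx Xx.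
apply: sumL_le => u _; apply: sumL_le => w _; apply: Rle_trans (bend_le_abs _) _.
apply: Rplus_le_compat_l; rewrite /translate.
have := birkhoff_bound PP Bx Xx (ssub u w) (sadd w j).
by have -> : sadd (sadd w j) (ssub u w) = sadd u j
  by apply: functional_extensionality => m; rewrite /sadd /ssub; lia.
Qed.

Lemma perturbed_close B j x : background l (translate j x) <= B ->
  Rabs (perturbed eps a j x - S j x) <= eps * (B + K).
Proof.
move=> HB; have [D1 [D2 [CP est']]] := est Ha.
have -> : perturbed eps a j x - S j x = eps * pert l P a (translate j x) by rewrite /perturbed; lra.
rewrite Rabs_mult (Rabs_right eps); last lra.
apply: Rmult_le_compat_l; first lra.
have [h _] := est' (translate j x); have := Rabs_le_elim h.
have := background_ge0 l (translate j x) => *; apply: Rabs_le; lra.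
Qed.

End Estimates.

Lemma small_eps C eps : 0 < eps -> exists N : nat, forall n : nat, (N <= n)%coq_nat ->
  / (INR n + 1) * C <= eps.
Proof.
move=> eps0; have [N [_ HN]] := exists_nat_ge (Rabs C / eps).
exists N => n /le_INR Hn; have n0 := pos_INR n.
apply: (Rmult_le_reg_l (INR n + 1)); first lra.
rewrite -Rmult_assoc Rinv_r ?Rmult_1_l; last lra.
have : Rabs C <= INR N * eps.
  have -> : Rabs C = Rabs C / eps * eps by field; lra.
  by apply: Rmult_le_compat_r; lra.
by have := Rle_abs C; have := Rmult_le_compat_r eps _ _ (Rlt_le _ _ eps0) Hn; lra.
Qed.

Lemma approximation : exists Sn : nat -> Pot d,
    (exists Rmax, forall n, exists r, r <= Rmax /\ LocalPot_r (Sn n) r) /\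
    (forall n, MorseOnX p q (Wsum (Sn n) l)) /\
    (forall eps, 0 < eps -> exists N, forall n, (N <= n)%coq_nat ->
       C1normLe (fun x => Sn n szero x - S szero x) eps) /\
    (forall j eps, 0 < eps -> exists N, forall n, (N <= n)%coq_nat ->
       forall x, Birkhoff x -> InX p q x -> Rabs (Sn n j x - S j x) <= eps).
Proof.
have [rho [K [rho0 [K0 est]]]] := pert_estimates l0 pP.
have [R1 HR1] : exists R1, forall k, In k l -> IZR (snorm k) <= R1.
  elim: (l) => [|k L [R1 H]]; first by exists 0.
  exists (Rmax (IZR (snorm k)) R1) => j /= [<-|/H h]; first exact: Rmax_l.
  exact: Rle_trans h (Rmax_r _ _).
pose eps n := / (INR n + 1).
have eps0 n : 0 < eps n by apply: Rinv_0_lt_compat; have := pos_INR n; lra.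
have [a Ha] := ClassicalEpsilon.choice _ (fun n => exists_morse (eps0 n) rho0).
exists (fun n => perturbed (eps n) (a n)); split.
  exists (Rmax r0 R1) => n; exists (Rmax r0 R1); split; first by lra.
  exact: (perturbed_LocalPot est HR1 (eps0 n) (proj1 (Ha n))).
split; first by move=> n; exact: (proj2 (Ha n)).
split=> [e e0|j e e0].
  pose n := INR (length l); have [N HN] := small_eps (n * K + n * (n * K)) e0.
  exists N => m /HN hm.
  have [L [M1 [M2 [h1 [h2 [h3 [h4 [h5 h6]]]]]]]] :=
    perturbed_C1normLe K0 est (eps0 m) (proj1 (Ha m)).
  exists L, M1, M2; do 5 split => //; exact: Rle_trans h6 hm.
have [B HB] := background_birkhoff.
have [N HN] := small_eps (B + K) e0.
exists N => m /HN hm x Bx Xx; apply: Rle_trans hm.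
exact: (perturbed_close est (eps0 m) (proj1 (Ha m)) (HB j x Bx Xx)).
Qed.

End Approximation.

Lemma Wsum_permutation d (S : Pot d) (l l' : list (site d)) x :
  Permutation.Permutation l l' -> Wsum S l x = Wsum S l' x.
Proof.
rewrite /Wsum; elim=> {l l'} [|j l l' _ IH|j k l|l1 l2 l3 _ h1 _ h2] //=; rewrite ?IH ?h1 //.
by lra.
Qed.

Lemma EnumBp_permutation d (p : Fin.t d -> site d) l l' :
  EnumBp p l -> EnumBp p l' -> Permutation.Permutation l l'.
Proof.
by move=> [n1 h1] [n2 h2]; apply: Permutation.NoDup_Permutation => // k; rewrite h1 h2.
Qed.

(** The construction fixes one enumeration of [B_p], whereas the theorem speaks of every
    enumeration; two of them are permutations of each other. *)
Lemma MorseOnX_EnumBp d (S : Pot d) (p : Fin.t d -> site d) q l l' :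
  EnumBp p l -> EnumBp p l' -> MorseOnX p q (Wsum S l) -> MorseOnX p q (Wsum S l').
Proof.
move=> h h'; have -> // : Wsum S l = Wsum S l'.
by apply: functional_extensionality => x; apply: Wsum_permutation; exact: EnumBp_permutation h h'.
Qed.

End MorseApproximation.

Theorem mainTheorem14 (d : nat) (S : Pot d) (omega : Fin.t d -> Q)
    (p : Fin.t d -> site d) (q : Fin.t d -> Z) :
  LocalPot S ->
  PrincipalPeriods omega p q ->
  exists Sn : nat -> Pot d,
    (* (1),(2): each family satisfies (A)-(E), ranges uniformly bounded *)
    (exists Rmax, forall n, exists r, r <= Rmax /\ LocalPot_r (Sn n) r) /\
    (* (3): W^n_{p,q} Morse on X_{p,q} *)
    (forall n l, EnumBp p l -> MorseOnX p q (Wsum (Sn n) l)) /\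
    (* (4): ||grad S_0^n - grad S_0||_{C^1} -> 0 *)
    (forall eps, 0 < eps -> exists N, forall n, (N <= n)%nat ->
       C1normLe (fun x => Sn n szero x - S szero x) eps) /\
    (* (5): S_j^n -> S_j uniformly on B ∩ X_{p,q} *)
    (forall j eps, 0 < eps -> exists N, forall n, (N <= n)%nat ->
       forall x, Birkhoff x -> InX p q x -> Rabs (Sn n j x - S j x) <= eps).
Proof.
intros [r0 HS] PP.
destruct (MorseApproximation.exists_EnumBp p) as [l Hl].
destruct (MorseApproximation.approximation HS PP Hl) as [Sn [H1 [H2 [H3 H4]]]].
exists Sn; repeat split; try assumption.
intros n l' Hl'.
exact (MorseApproximation.MorseOnX_EnumBp Hl Hl' (H2 n)).
Qed.
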